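(* Let $p\in[1,\infty)$ and let $q\in(1,\infty]$ satisfy $p^{-1}+q^{-1}=1$. Let $E$ be a real Banach space, assumed to be reflexive if $p\in(1,\infty)$. Let $F\colon I\times E\multimap E$ be a set-valued map such that: (F1) for every $(t,x)\in I\times E$ the set $F(t,x)$ is nonempty, closed and convex; (F2) for every $x\in E$ the map $F(\cdot,x)$ has a strongly measurable selection; (F3) for a.a. $t\in I$ the map $F(t,\cdot)$ is upper hemicontinuous; (F4) there is $c\in L^p(I,\mathbb{R})$ such that $\sup\{|y|\colon y\in F(t,x)\}\leqslant c(t)(1+|x|)$ for a.a. $t\in I$ and all $x\in E$; (F5) there is $\eta\in L^p(I,\mathbb{R})$ such that for all bounded subsets $\Omega\subset E$ and for a.a. $t\in I$, $\chi(F(t,\Omega))\leqslant\eta(t)\chi(\Omega)$. Let $k\colon\triangle\to\mathcal{L}(E)$ be such that: (k1) for every $s\in I$ the function $k(\cdot,s)\colon[s,T]\to\mathcal{L}(E)$ is differentiable; (k2) for all $t\in I$ the function $k(t,\cdot)\colon[0,t]\to\mathcal{L}(E)$ is continuous; (k3) the function $t\mapsto k(t,t)\in\mathcal{L}(E)$ is continuous on $I$ and the operator $k(t,t)$ is invertible for all $t\in I$; (k4) there exists $\mu\in L^q(I,\mathbb{R})$ such that $\left\|\frac{\partial}{\partial t}k(t,s)\right\|_{\mathcal{L}}\leqslant\mu(s)$ for every $(t,s)\in\triangle$. Let $S_F^p\colon C(I,E)\multimap C(I,E)$ be the map assigning to each $h\in C(I,E)$ the set of all solutions of $$x(t)\in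 h(t)+\int_0^tk(t,s)F(s,x(s))\,ds,\quad t\in I.$$ Then for every nonempty compact convex set $M\subset C(I,E)$ the image $S_F^p(M)=\bigcup_{h\in M}S_F^p(h)$ is compact and acyclic.
   Context: $I=[0,T]$, $\triangle=\{(t,s)\in I\times I\colon 0\leqslant s\leqslant t\leqslant T\}$. $E$ has norm $|\cdot|$; $\mathcal{L}(E)$ is the space of bounded linear endomorphisms of $E$ with operator norm $\|\cdot\|_{\mathcal{L}}$; $E^*$ is the dual. $C(I,E)$ carries the maximum norm; $L^p(I,E)$ is the space of Bochner $p$-integrable maps. A set-valued map assigns to each point a nonempty subset. A map $G\colon E\multimap E$ is upper hemicontinuous if for each $e^*\in E^*$ the function $x\mapsto\sup_{y\in G(x)}\langle e^*,y\rangle\in\mathbb{R}\cup\{+\infty\}$ is upper semicontinuous. $\chi$ is the Hausdorff measure of noncompactness: $\chi(\Omega)=\inf\{\varepsilon>0\colon\Omega\text{ admits a finite covering by balls of radius }\varepsilon\}$; $F(t,\Omega)=\bigcup_{x\in\Omega}F(t,x)$. A solution of the integral inclusion is a function $x\in C(I,E)$ such that $x(t)=h(t)+\int_0^tk(t,s)w(s)\,ds$ for all $t\in I$, for some $w\in L^p(I,E)$ with $w(t)\in F(t,x(t))$ for a.a. $t\in I$. $H_*(\cdot)$ denotes the Čech homology functor with coefficients in $\mathbb{Q}$ on compact metric spaces. A (compact metric) space $X$ is acyclic if $H_0(X)=\mathbb{Q}$ and $H_q(X)=0$ for all $q\geqslant1$. *)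

(* Defs.v *)
From HB Require Import structures.
From mathcomp Require Import all_boot all_order all_algebra ring_quotient.
From mathcomp Require Import all_classical all_reals all_analysis.

Set Implicit Arguments.
Unset Strict Implicit.
Unset Printing Implicit Defensive.

Import Order.TTheory GRing.Theory Num.Theory.
Import numFieldNormedType.Exports.

Local Open Scope classical_set_scope.
Local Open Scope ring_scope.

Section SupNorm.
Context {R : realType} {X : Type} {W : normedModType R} (S : set X).
Implicit Types f g : X -> W.

Definition supnorm f : R := sup [set `|f x| | x in S].

Definition bounded_over f := exists M : R, forall x, S x -> `|f x| <= M.

Lemma supnorm_ub f : bounded_over f -> forall x, S x -> `|f x| <= supnorm f.
Proof.
move=> [M fM] x Sx; apply: ub_le_sup; last by exists x.
by exists M => _ [y Sy <-]; exact: fM.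
Qed.

Lemma supnorm_le f M : 0 <= M -> (forall x, S x -> `|f x| <= M) ->
  supnorm f <= M.
Proof.
rewrite /supnorm => M0 fM; have [->|/set0P[x Sx]] := eqVneq S set0.
  by rewrite image_set0 sup0.
apply: ge_sup; first by exists `|f x|, x.
by move=> _ [y Sy <-]; exact: fM.
Qed.

Lemma supnorm_ge0 f : bounded_over f -> 0 <= supnorm f.
Proof.
move=> bf; have [S0|/set0P[x Sx]] := eqVneq S set0.
  by rewrite /supnorm S0 image_set0 sup0.
by rewrite (le_trans _ (supnorm_ub bf Sx)).
Qed.

Lemma supnormD f g : bounded_over f -> bounded_over g ->
  supnorm (f + g) <= supnorm f + supnorm g.
Proof.
move=> bf bg; apply: supnorm_le => [|x Sx]; first by rewrite addr_ge0// supnorm_ge0.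
by rewrite (le_trans (ler_normD _ _))// lerD// supnorm_ub.
Qed.

Lemma supnormZ (l : R) f : bounded_over f ->
  supnorm (l *: f) = `|l| * supnorm f.
Proof.
move=> bf; apply/eqP; rewrite eq_le; apply/andP; split.
  apply: supnorm_le => [|x Sx]; first by rewrite mulr_ge0// supnorm_ge0.
  by rewrite /= normrZ ler_wpM2l// supnorm_ub.
have blf : bounded_over (l *: f).
  exists (`|l| * supnorm f) => x Sx.
  by rewrite /= normrZ ler_wpM2l// supnorm_ub.
have [->|l0] := eqVneq l 0.
  by rewrite normr0 mul0r supnorm_ge0//; exists 0 => x _ /=; rewrite scale0r normr0.
rewrite -ler_pdivlMl ?normr_gt0//; apply: supnorm_le => [|x Sx].
  by rewrite mulr_ge0 ?invr_ge0// supnorm_ge0.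
by rewrite ler_pdivlMl ?normr_gt0// -normrZ (supnorm_ub blf).
Qed.

Lemma supnorm0_eq0 f : bounded_over f -> supnorm f = 0 ->
  forall x, S x -> f x = 0.
Proof.
move=> bf f0 x Sx; apply/eqP; rewrite -normr_le0 -f0; exact: supnorm_ub.
Qed.

End SupNorm.

Section BoundedLinear.
Context {R : realType} (V W : normedModType R).

Definition is_blin (f : V -> W) :=
  linear f /\ exists M : R, forall x, `|f x| <= M * `|x|.

Definition blin_pred : {pred V -> W} := fun f => `[< is_blin f >].

Lemma blin_submod_closed : submod_closed blin_pred.
Proof.
split=> [|a f g /asboolP[lf [M fM]] /asboolP[lg [N gN]]]; apply/asboolP.
  split=> [a x y|]; first by rewrite /= scaler0 addr0.
  by exists 0 => x; rewrite normr0 mul0r.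
have fgE z : (a *: f + g) z = a *: f z + g z by [].
split=> [b x y|]; first by rewrite !fgE lf lg !scalerDr addrACA !scalerA mulrC.
exists (`|a| * M + N) => x; rewrite fgE (le_trans (ler_normD _ _))// mulrDl.
by rewrite lerD// normrZ -mulrA ler_wpM2l.
Qed.

HB.instance Definition _ :=
  GRing.isSubmodClosed.Build R (V -> W) blin_pred blin_submod_closed.

(* bounded linear maps from V to W with the operator norm *)
Record blin := BLin { blin_fun :> V -> W; blinP : blin_fun \in blin_pred }.

HB.instance Definition _ := [isSub for blin_fun].
HB.instance Definition _ := [Choice of blin by <:].
HB.instance Definition _ := [SubChoice_isSubLmodule of blin by <:].

Definition opnorm (f : blin) : R := supnorm [set x : V | `|x| <= 1] f.

Lemma blin_linear (f : blin) : linear f.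
Proof. by have /asboolP[] := blinP f. Qed.

Lemma blin_bounded (f : blin) : bounded_over [set x : V | `|x| <= 1] f.
Proof.
have /asboolP[_ [M fM]] := blinP f; exists `|M| => x /= x1.
rewrite (le_trans (fM _))// (le_trans (ler_wpM2r _ (ler_norm M)))//.
by rewrite ler_piMr.
Qed.

Lemma opnormD f g : opnorm (f + g) <= opnorm f + opnorm g.
Proof. by apply: supnormD; exact: blin_bounded. Qed.

Lemma opnormZ l f : opnorm (l *: f) = `|l| * opnorm f.
Proof. by apply: supnormZ; exact: blin_bounded. Qed.

Lemma opnorm_eq0 f : opnorm f = 0 -> f = 0.
Proof.
move=> f0; apply/val_inj/funext => x /=.
have lin := blin_linear f.
have fZ a y : f (a *: y) = a *: f y.
  have f00 : f 0 = 0.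
    by have := lin (-1) 0 0; rewrite scaleN1r oppr0 addr0 scaleN1r addNr.
  by have := lin a y 0; rewrite addr0 f00 addr0.
have [->|x0] := eqVneq x 0; first by rewrite -(scale0r 0) fZ scale0r.
have : f (`|x|^-1 *: x) = 0.
  apply: (supnorm0_eq0 (blin_bounded f) f0) => /=.
  by rewrite normrZ normfV normr_id mulVf// normr_eq0.
rewrite fZ => /eqP; rewrite scaler_eq0 invr_eq0 normr_eq0 (negbTE x0)/=.
by move=> /eqP.
Qed.

HB.instance Definition _ :=
  Lmodule_isNormed.Build R blin opnormD opnormZ opnorm_eq0.

End BoundedLinear.

Section Duality.
Context {R : realType} (V : normedModType R).

Definition dual := blin V R^o.

(* the canonical embedding of V into its bidual is onto *)
Definition reflexive_space :=
  forall Phi : blin dual R^o, exists x : V, forall f : dual, Phi f = f x.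

Definition invertible_op (f : blin V V) :=
  exists g : blin V V, cancel f g /\ cancel g f.

End Duality.

Section ContinuousMaps.
Context {R : realType} (T : R) (E : normedModType R).

Definition tint : set R := [set` `[0, T]].

Definition cmap_pred : {pred tint -> E} := fun x => `[< continuous x >].

Lemma cmap_submod_closed : submod_closed cmap_pred.
Proof.
split=> [|a f g /asboolP cf /asboolP cg]; apply/asboolP => t.
  exact: (@cst_continuous tint E 0 t).
by have := cvgD (cvgZl_tmp (k := a) (cf t)) (cg t); apply.
Qed.

HB.instance Definition _ :=
  GRing.isSubmodClosed.Build R (tint -> E) cmap_pred cmap_submod_closed.

(* C([0, T], E) with the maximum norm *)
Record cmap := CMap { cmap_fun :> tint -> E; cmapP : cmap_fun \in cmap_pred }.

HB.instance Definition _ := [isSub for cmap_fun].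
HB.instance Definition _ := [Choice of cmap by <:].
HB.instance Definition _ := [SubChoice_isSubLmodule of cmap by <:].

Lemma cmap_bounded (x : cmap) : bounded_over [set: tint] x.
Proof.
have /asboolP cx := cmapP x.
have xE : sigL tint ('valL_0 x) = x by exact: valLK.
have cwx : {within tint, continuous ('valL_0 x)}.
  by apply/subspace_sigL_continuousP; rewrite xE.
have /compact_bounded[M [_ Mx]] := continuous_compact cwx (@segment_compact R 0 T).
exists (M + 1) => t _; apply: (Mx (M + 1)); first by rewrite ltrDl.
by exists (set_val t); [exact: set_valP|rewrite -[in RHS]xE].
Qed.

Definition maxnorm (x : cmap) : R := supnorm [set: tint] x.

Lemma maxnormD x y : maxnorm (x + y) <= maxnorm x + maxnorm y.
Proof. by apply: supnormD; exact: cmap_bounded. Qed.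

Lemma maxnormZ l x : maxnorm (l *: x) = `|l| * maxnorm x.
Proof. by apply: supnormZ; exact: cmap_bounded. Qed.

Lemma maxnorm_eq0 x : maxnorm x = 0 -> x = 0.
Proof.
move=> x0; apply/val_inj/funext => t /=.
exact: (supnorm0_eq0 (cmap_bounded x) x0).
Qed.

HB.instance Definition _ :=
  Lmodule_isNormed.Build R cmap maxnormD maxnormZ maxnorm_eq0.

End ContinuousMaps.

Section Bochner.
Context {R : realType} (E : normedModType R).
Local Notation mu := (@lebesgue_measure R).
Implicit Types (D : set R) (f : R -> E).

Definition simple_fun f :=
  finite_set (range f) /\ forall y, measurable (f @^-1` [set y] : set R).

Definition simple_integral D f : E :=
  \sum_(y \in range f) fine (mu (D `&` f @^-1` [set y])) *: y.

(* measurability up to a null set, i.e. for the Lebesgue (not Borel)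
   sigma-algebra *)
Definition strongly_measurable D f :=
  exists g : nat -> R -> E, (forall n, simple_fun (g n)) /\
    \forall t \ae mu, D t -> g n t @[n --> \oo] --> f t.

(* v is the Bochner integral of f over D; D is meant to have finite measure,
   so that every simple function is integrable on D *)
Definition bochner_integral D f (v : E) :=
  exists g : nat -> R -> E,
  [/\ forall n, simple_fun (g n),
      \forall t \ae mu, D t -> g n t @[n --> \oo] --> f t,
      (\int[mu]_(t in D) (`|f t - g n t|%:E))%E @[n --> \oo] --> 0%E &
      simple_integral D (g n) @[n --> \oo] --> v].

Definition in_Lp D (p : \bar R) f :=
  strongly_measurable D f /\
  ('N[mu]_p[(fun t => `|f t|%:E) \_ D] < +oo)%E.

End Bochner.

Section SetValued.
Context {R : realType} (E : normedModType R).

Definition upper_semicontinuous (g : E -> \bar R) := forall x (a : R),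
  (g x < a%:E)%E -> exists2 V, nbhs x V & forall y, V y -> (g y < a%:E)%E.

Definition upper_hemicontinuous (G : E -> set E) := forall f : dual E,
  upper_semicontinuous (fun x => ereal_sup [set (f y : R)%:E | y in G x]).

(* Hausdorff measure of noncompactness *)
Definition hausdorff_mnc (A : set E) : \bar R :=
  ereal_inf [set e%:E | e in [set e : R | 0 < e /\
    exists s : seq E, A `<=` \bigcup_(c in [set` s]) ball c e]].

End SetValued.

(* l is the derivative of f at t relative to A; if t is isolated in A, every l
   qualifies *)
Definition derivative_within (R : realType) (W : normedModType R)
    (f : R -> W) (A : set R) (t : R) (l : W) :=
  (u - t)^-1 *: (f u - f t) @[u --> within A t^'] --> l.

Section VolterraInclusion.
Context {R : realType} {E : completeNormedModType R}.
Variables (T : R) (p : \bar R).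
Variables (k : R -> R -> blin E E) (F : R -> E -> set E).
Local Notation mu := (@lebesgue_measure R).

(* F and k are total; only F t for t in [0, T] and k t s for
   0 <= s <= t <= T matter *)
Definition volterra_solutions (h : cmap T E) : set (cmap T E) :=
  [set x | exists w : R -> E,
    [/\ in_Lp (tint T) p w,
        \forall s \ae mu, forall t : tint T, set_val t = s -> F s (x t) (w s) &
        forall t : tint T, exists2 v : E,
          bochner_integral [set` `[0, set_val t]]
            (fun s => k (set_val t) s (w s)) v &
          x t = h t + v]].

End VolterraInclusion.

Section QuotientSpace.
Local Open Scope quotient_scope.
Context {K : fieldType} {V : vectType K} (B : {vspace V}).

(* the quotient vector space V / B *)
Definition vquot := Quotient.quot B.
HB.instance Definition _ := GRing.Zmodule.on vquot.
HB.instance Definition _ := EqQuotient.on vquot.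

Definition vquot_pi (x : V) : vquot := \pi_vquot x.

Definition vquot_scale (a : K) (x : vquot) : vquot := \pi_vquot (a *: repr x).

Lemma vquot_piE (x y : V) : x - y \in B -> \pi_vquot x = \pi_vquot y.
Proof. by move=> xyB; apply/eqP; rewrite -Quotient.idealrBE. Qed.

Lemma vquot_piD (x y : V) : \pi_vquot (x + y) = \pi_vquot x + \pi_vquot y.
Proof. by have := @Quotient.pi_add V B x y. Qed.

Lemma vquot_scale_pi a (x : V) : vquot_scale a (\pi_vquot x) = \pi_vquot (a *: x).
Proof.
apply: vquot_piE; rewrite -scalerBr memvZ// Quotient.idealrBE.
by apply/eqP; exact: reprK.
Qed.

Fact vquot_scaleA a b x :
  vquot_scale a (vquot_scale b x) = vquot_scale (a * b) x.
Proof. by rewrite -[x]reprK (vquot_scale_pi b) !vquot_scale_pi scalerA. Qed.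

Fact vquot_scale1 : left_id 1 vquot_scale.
Proof. by move=> x; rewrite -[x]reprK vquot_scale_pi scale1r. Qed.

Fact vquot_scaleDr : right_distributive vquot_scale +%R.
Proof.
move=> a x y; rewrite -[x]reprK -[y]reprK -vquot_piD !vquot_scale_pi.
by rewrite scalerDr vquot_piD.
Qed.

Fact vquot_scaleDl x : {morph vquot_scale^~ x : a b / a + b}.
Proof.
by move=> a b; rewrite -[x]reprK !vquot_scale_pi scalerDl vquot_piD.
Qed.

HB.instance Definition _ := GRing.Zmodule_isLmodule.Build K vquot
  vquot_scaleA vquot_scale1 vquot_scaleDr vquot_scaleDl.

End QuotientSpace.

Record finite_open_cover (X : topologicalType) := FiniteOpenCover {
  cover_size : nat;
  cover_set :> 'I_cover_size -> set X;
  cover_open : forall i, open (cover_set i);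
  cover_total : \bigcup_i cover_set i = [set: X] }.

Section NerveHomology.
Context {X : topologicalType}.
Implicit Types U V : finite_open_cover X.

(* Ordered q-simplices of the nerve of U: tuples of q + 1 vertices, possibly
   with repetitions, whose sets have a common point. *)
Definition nerve_simplex U q (s : q.+1.-tuple 'I_(cover_size U)) : bool :=
  `[< \bigcap_(i in [set` s]) U i !=set0 >].

Definition simplex U q := {s : q.+1.-tuple 'I_(cover_size U) | nerve_simplex s}.

Definition chain U q := {ffun simplex U q -> rat^o}.

Definition face U q (i : 'I_q.+2) (s : q.+2.-tuple 'I_(cover_size U)) :
  q.+1.-tuple 'I_(cover_size U) := [tuple tnth s (lift i j) | j < q.+1].

Definition boundary U q (c : chain U q.+1) : chain U q :=
  [ffun t => \sum_(i < q.+2)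
    \sum_(s | face i (val s) == val t) (-1) ^+ i * c s].

Definition cycles U q : {vspace chain U q} :=
  if q is q'.+1 return {vspace chain U q}
  then lker (linfun (@boundary U q')) else fullv.

Definition boundaries U q : {vspace chain U q} := limg (linfun (@boundary U q)).

(* H_q of the nerve of U, with rational coefficients *)
Definition homology U q :=
  vquot (linfun (vsval : subvs_of (cycles U q) -> _) @^-1: boundaries U q)%VS.
HB.instance Definition _ U q := GRing.Lmodule.on (homology U q).

(* f is a refinement projection from V to U *)
Definition refinement U V (f : 'I_(cover_size V) -> 'I_(cover_size U)) :=
  forall i, V i `<=` U (f i).

Definition chain_map U V (f : 'I_(cover_size V) -> 'I_(cover_size U)) q
    (c : chain V q) : chain U q :=
  [ffun t => \sum_(s | map_tuple f (val s) == val t) c s].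

(* vsproj coerces the chain, which is a cycle when f is a refinement
   projection, into the space of cycles. *)
Definition homology_map U V (f : 'I_(cover_size V) -> 'I_(cover_size U)) q
    (z : homology V q) : homology U q :=
  vquot_pi _ (vsproj (cycles U q) (chain_map f (vsval (repr z)))).

End NerveHomology.

Section CechHomology.
Variable X : topologicalType.

(* Cech homology of a compact space X: the inverse limit of the homology of
   the nerves of the finite open covers of X, as a linear subspace of the
   product. *)
Definition cech_homology q : set (forall U : finite_open_cover X, homology U q) :=
  [set z | forall U V (f : 'I_(cover_size V) -> 'I_(cover_size U)),
    refinement f -> homology_map f (z V) = z U].

Definition acyclic :=
  (exists f : rat^o -> forall U : finite_open_cover X, homology U 0,
     (forall U, linear (fun a => f a U)) /\
     set_bij [set: rat^o] (@cech_homology 0) f) /\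
  (forall q, (1 <= q)%N -> @cech_homology q = [set fun=> 0]).

End CechHomology.

(* Main.v *)
(* S is the set of h + V w with h in M, w an integrable selection of F along the
   solution, and V the Volterra operator with kernel k. Approximate solutions,
   for which w(s) is only taken in the convex hull of F(s, B(x(s), r)), satisfy
   uniform a priori and equicontinuity bounds. By the Heinz inequality and (F5)
   a sequence of them with r -> 0 is relatively compact; convex combinations of
   its selections converge almost everywhere, and separation by functionals
   together with (F3) puts the limit in S. Hence S is compact and approximate
   solutions are uniformly close to S.

   For acyclicity it is enough to contract S at every scale by finitely many
   steps, possibly discontinuous but moving neighbouring points by little, since
   successive steps then induce contiguous maps between nerves. The steps follow
   x in S (replaced by a finite convex combination of solutions, in order to
   have a continuous selection) up to a time tau and an Euler polygon afterwards,
   with tau decreasing from T to 0; then the inhomogeneity h is moved to a fixed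
   point of M. All these curves are approximate solutions, hence close to S, and
   depend uniformly continuously on x and tau. *)
Require Import Defs.
From HB Require Import structures.
From mathcomp Require Import all_boot all_order all_algebra.
From mathcomp Require Import all_classical all_reals all_analysis.
From mathcomp Require Import measurable_realfun ess_sup_inf ring lra.

Set Implicit Arguments.
Unset Strict Implicit.
Unset Printing Implicit Defensive.

Import Order.TTheory GRing.Theory Num.Theory.
Import numFieldNormedType.Exports.

Local Open Scope classical_set_scope.
Local Open Scope ring_scope.

(** * Cochains on nerves and contiguous refinements *)

(** Neither uniqueness nor a continuous selection is available, so S has no evident contraction: a
    control of a solution need not vary continuously with the solution. Approximate solutions,
    however, can be built explicitly from controls that are finite combinations of given ones, with
    coefficients depending continuously on the parameter; closeness to S then allows a discontinuous
    return to S. Controls are measured by the integral of [m |u|], where m bounds both the kernel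
    and its Lipschitz constant in t (from k1, k3 and k4). In this norm the Volterra operator is
    bounded into C([0, T], E), and cutting a control at a moving time is continuous. Limits of
    selections come from total boundedness of their values at almost every s, combined with the
    parallelogram law for scalar coefficient functions; this gives convergence in norm. Integrals
    are tested by functionals, so that linearity, limits and norm bounds reduce to real integrals
    and separation. *)

Section ListCochains.
Context {I J : eqType}.
Implicit Types (l : seq I).

(** The alternating sum of phi over the lists obtained by deleting one entry, in recursive form, so
    that identities are proved by induction on lists and not by manipulating face indices. A
    singleton gives [phi [::]]: this is the augmented coboundary. *)
Fixpoint lcobd (K : Type) (phi : seq K -> rat) (l : seq K) : rat :=
  if l is x :: l' then phi l' - lcobd (fun m => phi (x :: m)) l' else 0.

(* the transpose of the prism operator of two vertex maps h and g *)
Fixpoint lprism (h g : I -> J) (phi : seq J -> rat) (l : seq I) : rat :=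
  if l is x :: l' then
    phi [:: h x, g x & map g l'] - lprism h g (fun m => phi (h x :: m)) l'
  else 0.

Lemma lcobdB (K : Type) (phi psi : seq K -> rat) (l : seq K) :
  lcobd (fun m => phi m - psi m) l = lcobd phi l - lcobd psi l.
Proof.
by elim: l phi psi => [|x l IH] phi psi /=; rewrite ?subr0// IH; ring.
Qed.

Lemma lprismB h g (phi psi : seq J -> rat) l :
  lprism h g (fun m => phi m - psi m) l = lprism h g phi l - lprism h g psi l.
Proof.
by elim: l phi psi => [|x l IH] phi psi /=; rewrite ?subr0// IH; ring.
Qed.

Lemma lcobd_map (g : I -> J) (psi : seq J -> rat) l :
  lcobd (fun m => psi (map g m)) l = lcobd psi (map g l).
Proof.
elim: l psi => //= y l IH psi.
by rewrite (IH (fun m => psi (g y :: m))).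
Qed.

(** Transposed form of the homotopy formula for the prism operator. For [x :: l] the coboundary
    terms starting with [h x, g x] cancel, and the rest is the induction hypothesis for
    [phi (h x :: _)]. *)
Lemma lprism_homotopy h g (phi : seq J -> rat) l :
  lprism h g (lcobd phi) l + lcobd (lprism h g phi) l =
  phi (map g l) - phi (map h l).
Proof.
elim: l phi => [|x l IH] phi /=; first by rewrite addr0 subrr.
have E1 : lprism h g (fun m => phi m - lcobd (fun m0 => phi (h x :: m0)) m) l
  = lprism h g phi l - lprism h g (lcobd (fun m0 => phi (h x :: m0))) l.
  exact: lprismB.
have E2 : lcobd (fun m => phi [:: h x, g x & map g m] -
      lprism h g (fun m0 => phi (h x :: m0)) m) l =
    lcobd (fun m => phi [:: h x, g x & map g m]) l -
    lcobd (lprism h g (fun m0 => phi (h x :: m0))) l.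
  exact: lcobdB.
rewrite E1 E2 (lcobd_map g (fun m => phi [:: h x, g x & m])).
by have := IH (fun m => phi (h x :: m)); rewrite /=; lra.
Qed.

(** The prism only sees lists with one more entry, drawn from both images of l. For contiguous maps
    these are simplices of the nerve, so values of phi off the nerve do not matter. *)
Lemma lprism_ext h g (phi psi : seq J -> rat) l :
  (forall m, size m = (size l).+1 ->
    {subset m <= map h l ++ map g l} -> phi m = psi m) ->
  lprism h g phi l = lprism h g psi l.
Proof.
elim: l phi psi => [//|x l IH] phi psi e /=; congr (_ - _).
  apply: e => [|y]; first by rewrite /= size_map.
  by rewrite !inE mem_cat /= !inE => /or3P[] ->; rewrite /= ?orbT.
apply: IH => m sm sub; apply: e => [|y]; first by rewrite /= sm.
rewrite inE => /orP[/eqP->|/sub]; first by rewrite /= mem_head.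
rewrite !mem_cat /= !inE.
by move=> /orP[->|->]; rewrite ?orbT.
Qed.

Lemma lprism_sum (A : finType) h g (a : A -> rat) (psi : A -> seq J -> rat) l :
  lprism h g (fun m => \sum_i a i * psi i m) l =
  \sum_i a i * lprism h g (psi i) l.
Proof.
elim: l psi => [|x l IH] psi /=; first by rewrite big1// => i _; rewrite mulr0.
rewrite (IH (fun i m => psi i (h x :: m))) -sumrB.
by apply: eq_bigr => i _; rewrite mulrBr.
Qed.

End ListCochains.

(** * Chains on nerves, contiguity and the homology of the limit *)

Section NerveChains.
Context {X : topologicalType}.
Implicit Types U V : finite_open_cover X.

(** Chains are compared through their pairings with functions on all lists of vertices, simplices or
    not; chain identities then become identities between list functions, free of subtypes. *)
Definition pairing U q (c : chain U q) (phi : seq 'I_(cover_size U) -> rat) :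
  rat := \sum_s c s * phi (val s).

Definition ind U (l m : seq 'I_(cover_size U)) : rat := (l == m)%:R.

Lemma pairing_ind U q (c : chain U q) (t : simplex U q) :
  pairing c (ind (val t)) = c t.
Proof.
rewrite /pairing (bigD1 t)//= /ind eqxx mulr1 big1 ?addr0// => s st.
rewrite (_ : _ == _ = false) ?mulr0//; apply/negbTE; apply: contra st.
by rewrite eq_sym => /eqP st; apply/eqP/val_inj/val_inj.
Qed.

Lemma pairing_ext U q (c : chain U q) phi psi :
  (forall s : simplex U q, phi (val (val s)) = psi (val (val s))) ->
  pairing c phi = pairing c psi.
Proof. by move=> e; apply: eq_bigr => s _; rewrite e. Qed.

Lemma nerve_simplexS U q p (s : q.+1.-tuple 'I_(cover_size U))
    (t : p.+1.-tuple 'I_(cover_size U)) :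
  {subset t <= s} -> nerve_simplex s -> nerve_simplex t.
Proof.
move=> ts /asboolP[x sx]; apply/asboolP; exists x => i /= /ts it; exact: sx.
Qed.

Lemma face_cons0 U q (x : 'I_(cover_size U))
    (t : q.+1.-tuple 'I_(cover_size U)) : face ord0 [tuple of x :: t] = t.
Proof. by apply: eq_from_tnth => i; rewrite tnth_mktuple tnthS. Qed.

Lemma face_consS U q (x : 'I_(cover_size U))
    (t : q.+2.-tuple 'I_(cover_size U)) (i : 'I_q.+2) :
  face (lift ord0 i) [tuple of x :: t] = [tuple of x :: face i t].
Proof.
apply: eq_from_tnth => j; rewrite tnth_mktuple.
case: (unliftP ord0 j) => [k|] ->.
  rewrite tnthS tnth_mktuple -[RHS](tnthS x); congr (tnth _ _).
  by apply/val_inj; rewrite /= /bump/= !add1n ltnS; case: leqP.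
rewrite [RHS]tnth0 (_ : lift _ _ = ord0) ?tnth0//.
by apply/val_inj.
Qed.

Lemma lcobd_face U q (phi : seq 'I_(cover_size U) -> rat)
    (s : q.+2.-tuple 'I_(cover_size U)) :
  lcobd phi s = \sum_(i < q.+2) (-1) ^+ i * phi (face i s).
Proof.
elim: q phi s => [|q IH] phi s.
  rewrite !big_ord_recl big_ord0 addr0 expr0 mul1r.
  case/tupleP: s => x t; rewrite face_cons0 /=.
  case/tupleP: t => y t; rewrite (tuple0 t) /= subr0 expr1 mulN1r.
  by rewrite enum_ordSl/= (_ : enum 'I_0 = [::]) ?(size0nil (size_enum_ord 0))//=.
case/tupleP: s => x t.
rewrite [lcobd _ _]/= big_ord_recl expr0 mul1r face_cons0; congr (_ + _).
rewrite (IH (fun m => phi (x :: m)) t) -sumrN; apply: eq_bigr => i _.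
by rewrite face_consS /= /bump/= add1n exprS mulN1r mulNr.
Qed.

Lemma pairing_boundary U q (c : chain U q.+1) phi :
  pairing (boundary c) phi = pairing c (lcobd phi).
Proof.
rewrite /pairing; under eq_bigr do rewrite ffunE mulr_suml.
rewrite exchange_big /=; under [RHS]eq_bigr do rewrite lcobd_face mulr_sumr.
rewrite [RHS]exchange_big /=; apply: eq_bigr => i _.
under eq_bigr do rewrite mulr_suml; rewrite (exchange_big_dep predT)//=.
apply: eq_bigr => s _.
have fs : nerve_simplex (face i (val s)).
  apply: (nerve_simplexS _ (valP s)) => x /tnthP[j ->].
  by rewrite tnth_mktuple mem_tnth.
rewrite (big_pred1 (Sub (face i (val s)) fs)) => [|t]; first last.
  by rewrite -val_eqE SubK eq_sym.
by rewrite SubK /= mulrA [c s * _]mulrC.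
Qed.

Lemma pairing_chain_map U V (f : 'I_(cover_size V) -> 'I_(cover_size U)) q
    (c : chain V q) phi :
  (forall s : q.+1.-tuple _, nerve_simplex s -> nerve_simplex (map_tuple f s)) ->
  pairing (chain_map f c) phi = pairing c (phi \o map f).
Proof.
move=> fs; rewrite /pairing; under eq_bigr do rewrite ffunE mulr_suml.
rewrite (exchange_big_dep predT)//=; apply: eq_bigr => s _.
rewrite (big_pred1 (Sub (map_tuple f (val s)) (fs _ (valP s)))) => [|t].
  by rewrite SubK.
by rewrite -val_eqE SubK eq_sym.
Qed.

(* the chain representing the linear functional [phi |-> pairing c (P phi)] *)
Definition transp U V q p (P : (seq 'I_(cover_size U) -> rat) ->
    seq 'I_(cover_size V) -> rat) (c : chain V q) : chain U p :=
  [ffun t : simplex U p => pairing c (P (ind (val t)))].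

(** The first hypothesis lets phi be replaced by the combination of indicators of simplices with the
    same values on the nerve; the second moves P through this finite sum. *)
Lemma pairing_transp U V q p P (c : chain V q) phi :
  (forall s : simplex V q, forall phi psi,
    (forall t : simplex U p, phi (val (val t)) = psi (val (val t))) ->
    P phi (val (val s)) = P psi (val (val s))) ->
  (forall (a : simplex U p -> rat) (psi : simplex U p -> _ -> rat) l,
    P (fun m => \sum_i a i * psi i m) l = \sum_i a i * P (psi i) l) ->
  pairing (transp p P c : chain U p) phi = pairing c (P phi).
Proof.
move=> Pe Ps; rewrite /pairing /transp.
under eq_bigr do rewrite ffunE mulr_suml.
rewrite exchange_big /=; apply: eq_bigr => s _.
under eq_bigr do rewrite -mulrA; rewrite -mulr_sumr; congr (_ * _).
under eq_bigr do rewrite mulrC; rewrite -Ps; apply: Pe => t.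
rewrite (bigD1 t)//= /ind eqxx mulr1 big1 ?addr0// => u ut.
rewrite (_ : _ == _ = false) ?mulr0//; apply/negbTE; apply: contra ut.
by move=> /eqP ut; apply/eqP/val_inj/val_inj.
Qed.

Lemma pairing0 U q phi : pairing (0 : chain U q) phi = 0.
Proof. by rewrite /pairing big1// => s _; rewrite ffunE mul0r. Qed.

Lemma pairingB U q (c d : chain U q) phi :
  pairing (c - d) phi = pairing c phi - pairing d phi.
Proof.
rewrite /pairing -sumrB; apply: eq_bigr => s _.
by rewrite !ffunE mulrBl.
Qed.

Lemma pairing_inj U q (c d : chain U q) :
  (forall phi, pairing c phi = pairing d phi) -> c = d.
Proof. by move=> e; apply/ffunP => t; rewrite -!pairing_ind. Qed.

Definition contiguous U V (h g : 'I_(cover_size V) -> 'I_(cover_size U)) :=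
  forall l : seq 'I_(cover_size V), \bigcap_(i in [set` l]) V i !=set0 ->
    \bigcap_(i in [set` map h l ++ map g l]) U i !=set0.

Lemma contiguous_simplex U V h g q (s : q.+1.-tuple 'I_(cover_size V)) p
    (t : p.+1.-tuple 'I_(cover_size U)) : contiguous h g ->
  nerve_simplex s -> {subset t <= map h s ++ map g s} -> nerve_simplex t.
Proof.
move=> hg /asboolP/hg[x xs] sub; apply/asboolP; exists x => i /= it.
exact/xs/sub.
Qed.

Lemma contiguous_homotopy U V (h g : 'I_(cover_size V) -> 'I_(cover_size U)) q
    (c : chain V q) : contiguous h g ->
  (forall phi, phi [::] = 0 -> pairing c (lcobd phi) = 0) ->
  exists d : chain U q.+1, chain_map g c - chain_map h c = boundary d.
Proof.
move=> hg c0; exists (transp q.+1 (lprism h g) c).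
apply: pairing_inj => phi; rewrite pairingB pairing_boundary pairing_transp.
- rewrite !pairing_chain_map.
  + rewrite -[LHS]subr0 -(c0 (lprism h g phi) erefl) /pairing -!sumrB.
    apply: eq_bigr => s _; rewrite -!mulrBr; congr (_ * _).
    by have /= := lprism_homotopy h g phi (val (val s)); lra.
  + move=> s ss; apply: (contiguous_simplex hg ss) => x xs.
    by rewrite mem_cat xs.
  + move=> s ss; apply: (contiguous_simplex hg ss) => x xs.
    by rewrite mem_cat xs orbT.
- move=> s phi' psi e; apply: lprism_ext => m; rewrite size_tuple => sm sub.
  have tm : size m == q.+2 by rewrite sm.
  have nt : nerve_simplex (Tuple tm).
    exact: (contiguous_simplex hg (valP s)).
  exact: (e (Sub (Tuple tm) nt)).
- by move=> a psi l; rewrite lprism_sum.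
Qed.

(** The boundary of the cone with apex v over the image. Here phi is not normalized at [[::]]: in
    degree 0 the hypothesis says that the augmentation vanishes, in positive degree it holds for
    cycles by [cycleS]. *)
Lemma const_boundary U V (v : 'I_(cover_size U)) q (c : chain V q) :
  U v !=set0 -> (forall phi, pairing c (lcobd phi) = 0) ->
  exists d : chain U q.+1, chain_map (fun=> v) c = boundary d.
Proof.
move=> [x Uvx] c0.
have vs p (s : p.+1.-tuple 'I_(cover_size U)) :
    {subset s <= [:: v]} -> nerve_simplex s.
  move=> sv; apply/asboolP; exists x => i /= /sv.
  by rewrite inE => /eqP ->.
pose P (phi : seq 'I_(cover_size U) -> rat) (l : seq 'I_(cover_size V)) :=
  phi (v :: map (fun=> v) l).
exists (transp q.+1 P c); apply: pairing_inj => phi.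
rewrite pairing_boundary pairing_transp.
- rewrite pairing_chain_map; last first.
    by move=> s _; apply: vs => i /mapP[_ _ ->]; rewrite mem_head.
  rewrite -[RHS]addr0 -(c0 (fun m => phi (v :: map (fun=> v) m))) /pairing.
  rewrite -big_split/=; apply: eq_bigr => s _; rewrite -mulrDr; congr (_ * _).
  by rewrite /P/= (lcobd_map (fun=> v) (fun m => phi (v :: m))) subrK.
- move=> s phi' psi e; rewrite /P.
  have nt : nerve_simplex [tuple of v :: map (fun=> v) (val s)].
    by apply: vs => i; rewrite inE => /predU1P[->|/mapP[_ _ ->]]; rewrite mem_head.
  exact: (e (Sub _ nt)).
- by [].
Qed.

Lemma boundary_linear U q : linear (@boundary X U q).
Proof.
move=> a c d; apply: pairing_inj => phi; rewrite pairing_boundary.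
have pD p (u v : chain U p) psi :
    pairing (a *: u + v) psi = a * pairing u psi + pairing v psi.
  rewrite /pairing mulr_sumr -big_split/=; apply: eq_bigr => s _.
  by rewrite !ffunE mulrDl mulrA.
by rewrite !pD !pairing_boundary.
Qed.

HB.instance Definition _ U q :=
  GRing.isLinear.Build rat (chain U q.+1) (chain U q) _ (@boundary X U q)
    (@boundary_linear U q).

Lemma boundariesP U q (c : chain U q) :
  reflect (exists d : chain U q.+1, c = boundary d) (c \in boundaries U q).
Proof.
apply: (iffP memv_imgP) => [[d _ ->]|[d ->]].
  by exists d; rewrite lfunE.
by exists d; rewrite ?memvf// lfunE.
Qed.

(** On a singleton [lcobd phi] equals [phi [::]], so normalizing phi at the empty list makes every
    0-chain a cycle and gives one criterion for all degrees. *)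
Lemma cyclesP U q (c : chain U q) :
  c \in cycles U q <-> forall phi, phi [::] = 0 -> pairing c (lcobd phi) = 0.
Proof.
case: q c => [|q] c /=.
  split=> [_ phi phi0|_]; last by rewrite memvf.
  rewrite /pairing big1// => s _; case: (val s) => -[//|x [|//]] /= _.
  by rewrite phi0 subr0 mulr0.
rewrite memv_ker lfunE/=; split=> [/eqP c0 phi _|c0].
  by rewrite -pairing_boundary c0 pairing0.
apply/eqP/pairing_inj => phi; rewrite pairing_boundary pairing0.
pose psi (l : seq 'I_(cover_size U)) := if l is [::] then 0 else phi l.
rewrite -(c0 psi erefl); apply: pairing_ext => s.
by case: (val s) => -[//|x [//|y l]] /= _.
Qed.

Lemma cycleS U q (c : chain U q.+1) : c \in cycles U q.+1 ->
  forall phi, pairing c (lcobd phi) = 0.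
Proof.
rewrite /= memv_ker lfunE/= => /eqP c0 phi.
by rewrite -pairing_boundary c0 pairing0.
Qed.

Lemma homology_eq U q (z w : homology U q) :
  vsval (repr z) - vsval (repr w) \in boundaries U q -> z = w.
Proof.
move=> zw; rewrite -[z]reprK -[w]reprK; apply: vquot_piE.
by rewrite -memv_preim lfunE/=.

Qed.

Lemma repr_pi U q (c : subvs_of (cycles U q)) :
  vsval c - vsval (repr (vquot_pi _ c : homology U q)) \in boundaries U q.
Proof.
set z := vquot_pi _ c.
have : c - repr z \in (linfun (vsval : subvs_of (cycles U q) -> _) @^-1:
    boundaries U q)%VS.
  by rewrite Quotient.idealrBE; apply/eqP; rewrite reprK.
by rewrite -memv_preim lfunE/=.
Qed.

Lemma chain_map_cycle U V (f : 'I_(cover_size V) -> 'I_(cover_size U)) q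
    (c : chain V q) : refinement f -> c \in cycles V q ->
  chain_map f c \in cycles U q.
Proof.
move=> rf /cyclesP c0; apply/cyclesP => phi phi0; rewrite pairing_chain_map.
  rewrite -(c0 (fun l => phi (map f l))) ?phi0//; apply: pairing_ext => s /=.
  by rewrite lcobd_map.
move=> s /asboolP[x xs]; apply/asboolP; exists x => i /= /mapP[j js ->].
exact/rf/xs.
Qed.

Lemma homology_mapE U V (f : 'I_(cover_size V) -> 'I_(cover_size U)) q
    (z : homology V q) : refinement f ->
  vsval (repr (homology_map f z)) - chain_map f (vsval (repr z))
    \in boundaries U q.
Proof.
move=> rf; rewrite -opprB memvN.
have := repr_pi (vsproj (cycles U q) (chain_map f (vsval (repr z)))).
rewrite vsprojK//; apply: chain_map_cycle => //; exact: subvsP.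
Qed.

Definition contracting U V (f : 'I_(cover_size V) -> 'I_(cover_size U)) :=
  exists N (g : nat -> 'I_(cover_size V) -> 'I_(cover_size U)) v,
  [/\ g 0%N = f, forall j, (j < N)%N -> contiguous (g j) (g j.+1),
      U v !=set0 & g N = fun=> v].

Lemma contracting_homotopy U V f q (c : chain V q) :
  @contracting U V f -> c \in cycles V q ->
  exists2 v, U v !=set0 &
    chain_map (fun=> v) c - chain_map f c \in boundaries U q.
Proof.
move=> [N [g [v [<- cg Uv gN]]]] /cyclesP c0; exists v => //.
rewrite -gN {gN}.
elim: N cg => [|N IH] cg; first by rewrite subrr mem0v.
rewrite -(subrK (chain_map (g N) c) (chain_map _ _)) -addrA memvD//; last first.
  by apply: IH => j jN; apply: cg; exact: leqW.
by apply/boundariesP; exact: contiguous_homotopy (cg N _) c0.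
Qed.

Lemma contracting_boundary U V f q (c : chain V q.+1) :
  @contracting U V f -> c \in cycles V q.+1 ->
  chain_map f c \in boundaries U q.+1.
Proof.
move=> cf cc; have [v Uv vf] := contracting_homotopy cf cc.
rewrite -(subKr (chain_map (fun=> v) c) (chain_map f c)) memvB//.
by apply/boundariesP; apply: const_boundary => //; exact: cycleS.
Qed.

Lemma repr_homology0 U q :
  vsval (repr (0 : homology U q)) \in boundaries U q.
Proof.
have := repr_pi (0 : subvs_of (cycles U q)); rewrite sub0r memvN.
suff -> : vquot_pi _ (0 : subvs_of (cycles U q)) = 0 :> homology U q by [].
rewrite /vquot_pi; apply: (addrI (\pi_(vquot _) 0)%qT).
by rewrite -vquot_piD !addr0.
Qed.

Lemma refinement_simplex U V (f : 'I_(cover_size V) -> 'I_(cover_size U)) q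
    (s : q.+1.-tuple 'I_(cover_size V)) : refinement f ->
  nerve_simplex s -> nerve_simplex (map_tuple f s).
Proof.
move=> rf /asboolP[x xs]; apply/asboolP; exists x => i /= /mapP[j js ->].
exact/rf/xs.
Qed.

Lemma chain_map_boundaries U V (f : 'I_(cover_size V) -> 'I_(cover_size U)) q
    (c : chain V q) : refinement f -> c \in boundaries V q ->
  chain_map f c \in boundaries U q.
Proof.
move=> rf /boundariesP[d ->]; apply/boundariesP; exists (chain_map f d).
have fs p (s : p.+1.-tuple _) := @refinement_simplex U V f p s rf.
apply: pairing_inj => phi; rewrite pairing_boundary.
rewrite (pairing_chain_map _ _ (fs _)) (pairing_chain_map _ _ (fs _)).
by rewrite pairing_boundary; apply: pairing_ext => s; rewrite /= -lcobd_map.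
Qed.

(** By compatibility the component of a family at U is the image of its component at V under a
    contracting refinement, hence a boundary. *)
Lemma cech_homologyS q :
  (forall U, exists V (f : 'I_(cover_size V) -> 'I_(cover_size U)),
    refinement f /\ contracting f) ->
  @cech_homology X q.+1 = [set fun=> 0].
Proof.
move=> ctr; apply/seteqP; split=> [z cz|_ ->] /=.
  apply: functional_extensionality_dep => U.
  have [V [f [rf cf]]] := ctr U; rewrite -(cz U V f rf).
  apply: homology_eq; rewrite memvB ?repr_homology0//.
  have h := homology_mapE (z V) rf.
  rewrite -(subrK (chain_map f (vsval (repr (z V)))) (vsval _)) memvD//.
  by apply: contracting_boundary => //; exact: subvsP.
move=> U V f rf; apply: homology_eq; rewrite memvB ?repr_homology0//.
have h := homology_mapE (0 : homology V q.+1) rf.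
rewrite -(subrK (chain_map f (vsval (repr (0 : homology V q.+1)))) (vsval _)).
by rewrite memvD// chain_map_boundaries// repr_homology0.
Qed.

Definition augm U (c : chain U 0) : rat := pairing c (fun=> 1).

Lemma augmD U (c d : chain U 0) a : augm (a *: c + d) = a * augm c + augm d.
Proof.
rewrite /augm /pairing mulr_sumr -big_split/=; apply: eq_bigr => s _.
by rewrite !ffunE !mulr1.
Qed.

Lemma augm_chain_map U V (f : 'I_(cover_size V) -> 'I_(cover_size U))
    (c : chain V 0) : refinement f -> augm (chain_map f c) = augm c.
Proof.
by move=> rf; rewrite /augm pairing_chain_map// => s; exact: refinement_simplex.
Qed.

Lemma augm_boundary U (c : chain U 0) : c \in boundaries U 0 -> augm c = 0.
Proof.
move=> /boundariesP[d ->]; rewrite /augm pairing_boundary /pairing big1// => s _.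
case: (val s) => -[//|x [//|y [|//]]] /= _; lra.
Qed.

Definition vtx U q (s : simplex U q) : chain U q := [ffun t => (t == s)%:R].

Lemma pairing_vtx U q (s : simplex U q) phi : pairing (vtx s) phi = phi (val s).
Proof.
rewrite /pairing (bigD1 s)//= ffunE eqxx mul1r big1 ?addr0// => t ts.
by rewrite ffunE (negbTE ts) mul0r.
Qed.

Lemma chainE U q (c : chain U q) : c = \sum_s c s *: vtx s.
Proof.
apply/ffunP => t; rewrite sum_ffunE (bigD1 t)//= !ffunE eqxx.
rewrite big1 ?addr0 => [|s st]; first by rewrite [RHS]mulr1.
by rewrite !ffunE eq_sym (negbTE st) scaler0.
Qed.

Lemma edge U (s t : simplex U 0) x :
  (forall i, i \in val s -> U i x) -> (forall i, i \in val t -> U i x) ->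
  vtx t - vtx s \in boundaries U 0.
Proof.
move=> sx tx; have st : nerve_simplex [tuple thead (val s); thead (val t)].
  apply/asboolP; exists x => i /=; rewrite !inE => /orP[]/eqP->.
    by apply: sx; exact: mem_tnth.
  by apply: tx; exact: mem_tnth.
apply/boundariesP; exists (vtx (Sub _ st)); apply: pairing_inj => phi.
rewrite pairing_boundary pairingB !pairing_vtx SubK /=.
have vE (r : simplex U 0) : tval (val r) = [:: thead (val r)].
  by case: (val r) => -[//|y [|//]] p.
by rewrite (vE s) (vE t) subr0.
Qed.

(** Connectedness of the nerve of U: both vertices are moved by an edge to images of vertices of V,
    and the difference of the latter contracts to a constant chain of augmentation 0, that is, to
    0. *)
Lemma contracting_vtx U V f (s t : simplex U 0) :
  @refinement X U V f -> contracting f -> vtx t - vtx s \in boundaries U 0.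
Proof.
move=> rf cf.
have near_vtx (r : simplex U 0) : exists r' : simplex V 0,
    chain_map f (vtx r') - vtx r \in boundaries U 0.
  have /asboolP[x rx] := valP r.
  have : [set: X] x by []. rewrite -(cover_total V) => -[i _ Vix].
  have ri : nerve_simplex [tuple i].
    by apply/asboolP; exists x => j /=; rewrite inE => /eqP ->.
  exists (Sub _ ri).
  have rfi : nerve_simplex [tuple f i].
    by apply/asboolP; exists x => j /=; rewrite inE => /eqP ->; exact: rf.
  have -> : chain_map f (vtx (Sub _ ri : simplex V 0)) = vtx (Sub _ rfi).
    apply: pairing_inj => phi; rewrite pairing_chain_map; last first.
      by move=> ?; exact: refinement_simplex.
    by rewrite !pairing_vtx.
  apply: (@edge U _ _ x) => j; first exact: rx.
  by rewrite /= inE => /eqP ->; exact: rf.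
have [s' ss'] := near_vtx s; have [t' tt'] := near_vtx t.
pose c : chain V 0 := (-1) *: vtx s' + vtx t'.
have [v Uv cv] := contracting_homotopy cf (memvf c : c \in cycles V 0).
have cv0 : chain_map (fun=> v) c = 0 :> chain U 0.
  apply: pairing_inj => phi; rewrite pairing_chain_map => [|r _]; last first.
    have [x Uvx] := Uv.
    by apply/asboolP; exists x => j /= /mapP[? _ ->].
  have aug0 : augm c = 0 by rewrite augmD /augm !pairing_vtx mulN1r addNr.
  rewrite pairing0 -[RHS](mulr0 (phi [:: v])) -aug0 /augm /pairing mulr_sumr.
  apply: eq_bigr => r _; case: (val r) => -[//|y [|//]] /= _.
  by rewrite mulr1 mulrC.
have cE : chain_map f c = chain_map f (vtx t') - chain_map f (vtx s') :> chain U 0.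
  have fs q (r : q.+1.-tuple _) := @refinement_simplex U V f q r rf.
  apply: pairing_inj => phi; rewrite pairingB !(pairing_chain_map _ _ (fs _)).
  rewrite /pairing -sumrB; apply: eq_bigr => r _.
  by rewrite !ffunE -mulrBl scaleN1r addrC.
move: cv; rewrite cv0 sub0r memvN cE => cv.
rewrite (_ : vtx t - vtx s = (chain_map f (vtx t') - chain_map f (vtx s')) -
  (chain_map f (vtx t') - vtx t) + (chain_map f (vtx s') - vtx s)); last first.
  apply/ffunP => r; rewrite !ffunE; ring.
by rewrite memvD// memvB.
Qed.

Lemma augm_vtx U (s : simplex U 0) : augm (vtx s) = 1.
Proof. by rewrite /augm pairing_vtx. Qed.

Lemma exists_vtx (x : X) U : exists s : simplex U 0, forall i, i \in val s -> U i x.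
Proof.
have : [set: X] x by []. rewrite -(cover_total U) => -[i _ Uix].
have si : nerve_simplex [tuple i].
  by apply/asboolP; exists x => j /=; rewrite inE => /eqP ->.
by exists (Sub _ si) => j; rewrite /= inE => /eqP ->.
Qed.

Section Contractible.
Hypothesis ctr : forall U, exists V
  (f : 'I_(cover_size V) -> 'I_(cover_size U)), refinement f /\ contracting f.
Variable x0 : X.

Lemma boundaries0P U (c : chain U 0) : augm c = 0 -> c \in boundaries U 0.
Proof.
move=> c0; have [V [f [rf cf]]] := ctr U; have [s0 _] := exists_vtx x0 U.
have -> : c = \sum_s c s *: (vtx s - vtx s0).
  rewrite {1}[c]chainE; under [RHS]eq_bigr do rewrite scalerBr.
  rewrite sumrB -scaler_suml -[LHS]subr0; congr (_ - _).
  have -> : \sum_s c s = augm c by apply: eq_bigr => s _; rewrite mulr1.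
  by rewrite c0 scale0r.
by apply: memv_suml => s _; rewrite memvZ// (contracting_vtx _ _ rf cf).
Qed.

Definition haugm U (z : homology U 0) : rat := augm (vsval (repr z)).

Lemma haugm_inj U (z w : homology U 0) : haugm z = haugm w -> z = w.
Proof.
move=> zw; apply: homology_eq; apply: boundaries0P.
rewrite -scaleN1r addrC augmD; move: zw; rewrite /haugm => ->.
by rewrite mulN1r addNr.
Qed.

Lemma haugm_map U V (f : 'I_(cover_size V) -> 'I_(cover_size U))
  (z : homology V 0) : refinement f -> haugm (homology_map f z) = haugm z.
Proof.
move=> rf; have := augm_boundary (homology_mapE z rf).
rewrite -scaleN1r addrC augmD augm_chain_map// mulN1r => /eqP.
by rewrite addrC subr_eq0 => /eqP.
Qed.

Lemma haugm_pi U (c : chain U 0) :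
  haugm (vquot_pi _ (vsproj (cycles U 0) c) : homology U 0) = augm c.
Proof.
have := augm_boundary (repr_pi (vsproj (cycles U 0) c)).
rewrite -scaleN1r addrC augmD mulN1r vsprojK ?memvf// => /eqP.
by rewrite addrC subr_eq0 => /eqP.
Qed.

Lemma contracting_acyclic : acyclic X.
Proof.
split=> [|[//|q] _]; last exact: cech_homologyS.
pose s U := projT1 (cid (exists_vtx x0 U)).
pose f (a : rat^o) U : homology U 0 :=
  vquot_pi _ (vsproj (cycles U 0) (a *: vtx (s U))).
have haf a U : haugm (f a U) = a.
  by rewrite haugm_pi -[_ *: _]addr0 augmD augm_vtx /augm pairing0 addr0 mulr1.
have tot : \bigcup_(_ in [set: 'I_1]) setT = [set: X].
  by apply/seteqP; split => // y _; exists ord0.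
(* Every cover refines the one-set cover, so the component there determines the augmentations of all
   components of a compatible family. *)
pose triv := @FiniteOpenCover X 1 (fun=> setT) (fun=> openT) tot.
exists f; split=> [U a b c|]; first last.
  split=> [a _ U V g rg|a b _ _ ab|z cz].
  - by apply: haugm_inj; rewrite haugm_map// !haf.
  - by rewrite -(haf a triv) ab haf.
  - exists (haugm (z triv)) => //; apply: functional_extensionality_dep => U.
    apply: haugm_inj; rewrite haf.
    by rewrite -(cz triv U (fun=> ord0)) ?haugm_map.
have -> : a *: f b U = vquot_scale a (f b U) by [].
by rewrite /f /vquot_pi vquot_scale_pi -vquot_piD -linearP/= scalerDl scalerA.
Qed.

End Contractible.

End NerveChains.

(** * Finite coverings and total boundedness *)

Section TotallyBounded.
Context {R : realType} {W : normedModType R}.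
Implicit Types (A B : set W) (e : R).

Definition fcov e A :=
  exists s : seq W, forall x, A x -> exists2 c, c \in s & `|x - c| < e.

Definition tbd A := forall e, 0 < e -> fcov e A.

Lemma fcov_sub e A B : A `<=` B -> fcov e B -> fcov e A.
Proof. by move=> AB [s sB]; exists s => x /AB/sB. Qed.

Lemma fcov_le e e' A : e <= e' -> fcov e A -> fcov e' A.
Proof.
move=> ee' [s sA]; exists s => x /sA[c cs xc]; exists c => //.
exact: lt_le_trans ee'.
Qed.

(** Centres may be taken in A at the price of doubling the radius: each useful centre is replaced by
    a point of A near it. *)
Lemma fcov_in e A : fcov (e / 2) A -> exists s : seq W,
  (forall c, c \in s -> A c) /\ forall x, A x -> exists2 c, c \in s & `|x - c| < e.
Proof.
move=> [s sA].
have /choice[f fP] : forall c : W, exists y : W,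
    (exists2 x, A x & `|x - c| < e / 2) -> A y /\ `|y - c| < e / 2.
  move=> c; have [[x Ax xc]|n] := pselect (exists2 x, A x & `|x - c| < e / 2).
    by exists x.
  by exists c => /n.
exists [seq f c | c <- s & `[< exists2 x, A x & `|x - c| < e / 2 >]]; split.
  move=> _ /mapP[c + ->]; rewrite mem_filter => /andP[/asboolP cA _].
  by have [] := fP c cA.
move=> x Ax; have [c cs xc] := sA x Ax.
have cA : exists2 x, A x & `|x - c| < e / 2 by exists x.
exists (f c).
  by apply: map_f; rewrite mem_filter cs andbT; apply/asboolP.
have [_ fc] := fP c cA.
rewrite -(subrK c x) -addrA (le_lt_trans (ler_normD _ _))// [e]splitr ltrD//.
by rewrite distrC.
Qed.

Lemma tbd_in A : tbd A -> forall e, 0 < e -> exists s : seq W,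
  (forall c, c \in s -> A c) /\ forall x, A x -> exists2 c, c \in s & `|x - c| < e.
Proof. by move=> tA e e0; apply: fcov_in; apply: tA; rewrite divr_gt0. Qed.

Lemma compact_tbd A : compact A -> tbd A.
Proof.
rewrite compact_cover => cA e e0.
have [|x Ax|D _ AD] := cA W A (fun c => ball c e).
- by move=> c _; exact: ball_open.
- by exists x => //; exact: ballxx.
exists (finmap.enum_fset D) => x /AD[c /= cD]; rewrite -ball_normE /= => xc.
by exists c => //; rewrite distrC.
Qed.

End TotallyBounded.

(** * A metric criterion for acyclicity *)

Section AcyclicCriterion.
Context {R : realType} {W : normedModType R} (S : set W).

Lemma lebesgue_number (U : finite_open_cover (set_type S)) : compact S ->
  exists2 e : R, 0 < e & forall x : set_type S,
    exists i, forall y : set_type S, `|val x - val y| < e -> U i y.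
Proof.
move=> /compact_near_coveringP cS.
pose P (e : R) (x : W) := forall Sx : x \in S, exists i, forall y : set_type S,
  `|x - val y| < e -> U i y.
have := cS R (0 : R)^'+ P _; case=> [x Sx|e /= e0 eP].
  have : [set: set_type S] (SigSub (mem_set Sx)) by [].
  rewrite -(cover_total U) => -[i _ Uix].
  have := cover_open i; rewrite openE => /(_ _ Uix).
  rewrite /interior nbhsE => -[B [[C oC <-] /= Cx] BU].
  move: oC; rewrite openE => /(_ _ Cx); rewrite /interior.
  move=> /nbhs_ballP[r /= r0 rC].
  have r20 : 0 < r / 2 by rewrite divr_gt0.
  exists (ball x (r / 2), [set e | 0 < e < r / 2]) => /=.
    split; first exact: nbhsx_ballx.
    apply/nbhs_ballP; exists (r / 2) => //= t; rewrite -ball_normE /= sub0r normrN.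
    by move=> tr t0; rewrite t0 (le_lt_trans (ler_norm t)).
  move=> [x' e] /= []; rewrite -ball_normE /= => xx' /andP[_ er] _.
  exists i => y x'y; apply: BU => /=; apply: rC; rewrite -ball_normE.
  change (`|x - val y| < r); rewrite -(subrK x' x) -addrA.
  rewrite (le_lt_trans (ler_normD _ _))// [r]splitr ltrD//.
  exact: lt_trans er.
exists (e / 2); first by rewrite divr_gt0.
move=> x; apply: (eP (e / 2)) => //=; rewrite ?divr_gt0//.
  by rewrite sub0r normrN gtr0_norm ?divr_gt0// ltr_pdivrMr// ltr_pMr// ltr1n.
exact: set_valP.
exact: valP.
Unshelve. all: by end_near. Qed.

(* A discrete, possibly discontinuous, null-homotopy at every scale. *)
Lemma discrete_contraction_acyclic : compact S -> S !=set0 ->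
  (forall e : R, 0 < e -> exists2 d : R, 0 < d &
    exists N (g : nat -> W -> W), [/\ forall j x, S x -> S (g j x),
      forall x, g 0%N x = x, exists y, forall x, S x -> g N x = y &
      forall j x y, (j < N)%N -> S x -> S y -> `|x - y| < d ->
        `|g j x - g j y| < e /\ `|g j x - g j.+1 y| < e]) ->
  acyclic (set_type S).
Proof.
move=> cS [x0 Sx0] H.
pose toS (x : W) (Sx : S x) : set_type S := SigSub (mem_set Sx).
apply: (contracting_acyclic _ (toS _ Sx0)) => U.
have [e e0 lamU] := lebesgue_number U cS.
have [lam lamP] := choice lamU.
have [d d0 [N [g [gS g0 [y gN] gd]]]] := H e e0.
(* The new cover consists of balls of radius [d' / 2]: two that meet have centres closer than d, so
   the contraction estimate applies to them, and since [d' <= e] each is contained in the member of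
   U chosen by [lam] for its centre. *)
pose d' := Num.min d e; have d'0 : 0 < d' by rewrite lt_min d0.
have [|s [sS Ss]] := tbd_in (compact_tbd cS) (e := d' / 2).
  by rewrite divr_gt0.
pose c (i : 'I_(size s)) := nth 0 s i.
have cP i : S (c i) by apply: sS; exact: mem_nth.
pose V0 (i : 'I_(size s)) := [set z : set_type S | `|val z - c i| < d' / 2].
have oV i : open (V0 i).
  exists (ball (c i) (d' / 2)); first exact: ball_open.
  by apply/seteqP; split => z; rewrite /V0 /= -ball_normE /= distrC.
have totV : \bigcup_i V0 i = [set: set_type S].
  apply/seteqP; split => // z _; have [b bs zb] := Ss (val z) (set_valP z).
  have bi : (index b s < size s)%N by rewrite index_mem.
  by exists (Ordinal bi) => //=; rewrite /V0 /= /c/= nth_index.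
pose V := FiniteOpenCover oV totV.
have clo (z : set_type S) i j : V i z -> V j z -> `|c i - c j| < d'.
  move=> /= Vi Vj; rewrite -(subrK (val z) (c i)) -addrA.
  by rewrite (le_lt_trans (ler_normD _ _))// [d']splitr ltrD// distrC.
exists V, (fun i => lam (toS _ (cP i))); split.
  move=> i z /= Viz; apply: lamP => /=; rewrite distrC (lt_le_trans Viz)//.
  have : d' <= e by rewrite ge_min lexx orbT.
  by lra.
exists N, (fun j i => lam (toS _ (gS j _ (cP i)))).
have cont j : (j < N)%N -> contiguous (U := U) (V := V)
    (fun i => lam (toS _ (gS j _ (cP i))))
    (fun i => lam (toS _ (gS j.+1 _ (cP i)))).
  move=> jN [_|i0 l [z lz]]; first by exists (toS _ Sx0).
  (* The image of one centre is within e of the images of all the other centres under both steps, so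
     it lies in all the chosen members of U. *)
  exists (toS _ (gS j _ (cP i0))) => i ii.
  have {ii} : i \in map (fun i => lam (toS _ (gS j _ (cP i)))) (i0 :: l) ++
    map (fun i => lam (toS _ (gS j.+1 _ (cP i)))) (i0 :: l) by exact: ii.
  rewrite mem_cat.
  have il k : k \in i0 :: l -> `|c i0 - c k| < d.
    move=> kl; have := clo z i0 k (lz _ (mem_head _ _)) (lz _ kl).
    by move=> /lt_le_trans; apply; rewrite ge_min lexx.
  move=> /orP[]/mapP[k kl ->]; apply: lamP => /=; rewrite distrC.
    by have [] := gd j (c i0) (c k) jN (cP _) (cP _) (il k kl).
  by have [] := gd j (c i0) (c k) jN (cP _) (cP _) (il k kl).
have [i0 _] : exists i : 'I_(size s), True.
  have [b bs _] := Ss x0 Sx0; have bi : (index b s < size s)%N by rewrite index_mem.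
  by exists (Ordinal bi).
have Sy : S y by rewrite -(gN (c i0) (cP i0)); exact: (gS _ _ (cP i0)).
exists (lam (toS _ Sy)); split => //.
- by apply/funext => i; congr lam; apply/val_inj; rewrite /= (g0 (c i)).
- by exists (toS _ Sy); apply: lamP; rewrite /= subrr normr0.
- by apply/funext => i; congr lam; apply/val_inj; rewrite /= (gN (c i) (cP i)).
Qed.

End AcyclicCriterion.

(** * Separation of points from closed convex sets *)

Lemma convex_setE (R : realType) (V : lmodType R) (C : set V) x y (t : R) : convex_set C ->
  C x -> C y -> 0 <= t -> t <= 1 -> C (t *: x + (1 - t) *: y).
Proof.
move=> cC Cx Cy t0 t1.
by have := cC x y (Itv01 t0 t1) (mem_set Cx) (mem_set Cy); rewrite inE.
Qed.

Section HahnBanach.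
Context {R : realType} {V : normedModType R}.
Implicit Types (p q : V -> R) (C : set V) (x y v : V).

Definition sublinear p := (forall x y, p (x + y) <= p x + p y) /\
  forall t x, 0 <= t -> p (t *: x) = t * p x.

Lemma sublinear0 p : sublinear p -> p 0 = 0.
Proof. by move=> [_ pZ]; rewrite -(scale0r 0) pZ// mul0r. Qed.

Lemma sublinearN p x : sublinear p -> - p (- x) <= p x.
Proof.
move=> sp; have [pD _] := sp; have := pD x (- x).
by rewrite subrr (sublinear0 sp); lra.
Qed.

(* Lowers p so that it is at most -d on -C; applied to C = {y} it shows that a
   minimal sublinear functional is odd. *)
Definition lower p C d x : R :=
  inf [set p (x + u.1 *: u.2) - u.1 * d | u in [set u : R * V | 0 <= u.1 /\ C u.2]].

Section Lower.
Variables (p : V -> R) (C : set V) (d : R).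
Hypotheses (sp : sublinear p) (cC : convex_set C) (C0 : C !=set0).
Hypothesis dp : forall c, C c -> d <= p c.

Let lower_lb x t c : 0 <= t -> C c -> - p (- x) <= p (x + t *: c) - t * d.
Proof.
move=> t0 Cc; have [pD pZ] := sp; have := pD (x + t *: c) (- x).
rewrite addrAC subrr add0r pZ//; have := ler_wpM2l t0 (dp Cc); lra.
Qed.

Let has_inf_lower x : has_inf
  [set p (x + u.1 *: u.2) - u.1 * d | u in [set u : R * V | 0 <= u.1 /\ C u.2]].
Proof.
have [c Cc] := C0; split; first by eexists; exists (0, c).
by exists (- p (- x)) => _ [[t c'] /= [t0 Cc'] <-]; exact: lower_lb.
Qed.

Lemma lower_le x t c : 0 <= t -> C c -> lower p C d x <= p (x + t *: c) - t * d.
Proof.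
by move=> t0 Cc; apply: ge_inf; [exact: (has_inf_lower x).2|exists (t, c)].
Qed.

Lemma le_lower x a : (forall t c, 0 <= t -> C c -> a <= p (x + t *: c) - t * d) ->
  a <= lower p C d x.
Proof.
move=> H; apply: lb_le_inf; first exact: (has_inf_lower x).1.
by move=> _ [[t c] /= [t0 Cc] <-]; exact: H.
Qed.

Lemma lower_lep x : lower p C d x <= p x.
Proof.
have [c Cc] := C0.
by have := lower_le x (lexx 0) Cc; rewrite scale0r addr0 mul0r subr0.
Qed.

Lemma lower_neg c : C c -> lower p C d (- c) <= - d.
Proof.
move=> Cc; have := lower_le (- c) ler01 Cc.
by rewrite scale1r addNr (sublinear0 sp) mul1r sub0r.
Qed.

Lemma lower_sublinear : sublinear (lower p C d).
Proof.
have [pD pZ] := sp; split=> [x y|t x].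
  rewrite -lerBlDr; apply: le_lower => t c t0 Cc.
  rewrite lerBlDr -lerBlDl; apply: le_lower => s b s0 Cb; rewrite lerBlDl.
  have [/eqP|ts] := eqVneq (t + s) 0.
    rewrite paddr_eq0// => /andP[/eqP -> /eqP ->].
    rewrite !scale0r !addr0 !mul0r !subr0.
    exact: le_trans (lower_lep _) (pD _ _).
  have ts0 : 0 < t + s by rewrite lt_neqAle eq_sym ts addr_ge0.
  have Ccb : C ((t / (t + s)) *: c + (1 - t / (t + s)) *: b).
    apply: convex_setE => //; first by rewrite divr_ge0// ltW.
    by rewrite ler_pdivrMr// mul1r lerDl.
  apply: le_trans (lower_le (x + y) (ltW ts0) Ccb) _.
  rewrite scalerDr !scalerA mulrCA divff// mulr1 mulrBr mulr1 mulrCA divff// mulr1.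
  rewrite [t + s - t]addrAC subrr add0r addrACA mulrDl.
  have := pD (x + t *: c) (y + s *: b); lra.
rewrite le_eqVlt => /predU1P[<-|t0].
  rewrite scale0r mul0r; apply/eqP; rewrite eq_le.
  rewrite -{1}(sublinear0 sp) lower_lep/=; apply: le_lower => s c s0 Cc.
  by have := lower_lb 0 s0 Cc; rewrite oppr0 (sublinear0 sp) oppr0.
have le1 s z : 0 < s -> s * lower p C d z <= lower p C d (s *: z).
  move=> s0; apply: le_lower => u c u0 Cc.
  rewrite -ler_pdivlMl// mulrBr.
  have := lower_le z (divr_ge0 u0 (ltW s0)) Cc.
  by rewrite -pZ ?invr_ge0 ?(ltW s0)// scalerDr !scalerA mulVf ?gt_eqF// scale1r
    ![s^-1 * _]mulrC mulrAC.
apply/eqP; rewrite eq_le le1// andbT -ler_pdivrMl//.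
have := le1 t^-1 (t *: x); rewrite invr_gt0 t0 scalerA mulVf ?gt_eqF// scale1r.
exact.
Qed.

End Lower.

(** Zorn's lemma for the reversed pointwise order. The infimum of a chain is finite since any
    sublinear functional below p is at least [- p (- x)] at x, and it is subadditive because two
    members of a chain are comparable. *)
Lemma minimal_sublinear p : sublinear p -> exists q,
  [/\ sublinear q, forall x, q x <= p x &
      forall q', sublinear q' -> (forall x, q' x <= q x) -> q' = q].
Proof.
move=> sp.
pose T := {q : V -> R | sublinear q /\ forall x, q x <= p x}.
pose rel (q q' : T) := `[< forall x, sval q' x <= sval q x >].
have [|||A totA|[q [sq qp]] qmin] := @Zorn T rel.
- by move=> q; apply/asboolP.
- move=> q1 q2 q3 /asboolP h1 /asboolP h2; apply/asboolP => x.
  exact: le_trans (h2 x) (h1 x).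
- move=> [q1 P1] [q2 P2] /asboolP/= h1 /asboolP/= h2; apply: eq_exist.
  by apply/funext => x; apply/eqP; rewrite eq_le h1 h2.
- have [A0|] := pselect (A !=set0); last first.
    move=> nA; exists (exist _ p (conj sp (fun x => lexx (p x)))) => s As.
    by exfalso; apply: nA; exists s.
  pose m x := inf [set sval q x | q in A].
  have hi x : has_inf [set sval q x | q in A].
    case: A0 => q Aq; split; first by exists (sval q x), q.
    exists (- p (- x)) => _ [[r [sr rp]] /= _ <-].
    by apply: le_trans (sublinearN _ sr); rewrite lerN2.
  have mle (q : T) x : A q -> m x <= sval q x.
    by move=> Aq; apply: ge_inf; [exact: (hi x).2|exists q].
  have lem x a : (forall q : T, A q -> a <= sval q x) -> a <= m x.
    move=> h; apply: lb_le_inf; first exact: (hi x).1.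
    by move=> _ [q Aq <-]; exact: h.
  have sm : sublinear m.
    split=> [x y|t x t0].
      rewrite -lerBlDr; apply: (lem x) => q Aq; rewrite lerBlDr -lerBlDl.
      apply: (lem y) => q' Aq'; rewrite lerBlDl.
      have key (r : T) : A r -> sval r x <= sval q x -> sval r y <= sval q' y ->
          m (x + y) <= sval q x + sval q' y.
        move=> Ar rx ry; apply: le_trans (mle _ _ Ar) _.
        by apply: le_trans ((proj2_sig r).1.1 _ _) _; rewrite lerD.
      by have [/asboolP h|/asboolP h] := totA q q' Aq Aq'; [apply: (key q')|apply: (key q)].
    have rZ (r : T) : sval r (t *: x) = t * sval r x.
      by rewrite (proj2_sig r).1.2.
    move: t0; rewrite le_eqVlt => /predU1P[t0|t0].
      rewrite -t0 scale0r mul0r; apply/eqP; rewrite eq_le; apply/andP; split.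
        case: A0 => r Ar; rewrite (le_trans (mle r _ Ar))//.
        by rewrite (sublinear0 (proj2_sig r).1).
      by apply: lem => r Ar; rewrite (sublinear0 (proj2_sig r).1).
    apply/eqP; rewrite eq_le; apply/andP; split.
      rewrite -ler_pdivrMl//; apply: lem => r Ar; rewrite ler_pdivrMl// -rZ.
      exact: mle.
    by apply: lem => r Ar; rewrite rZ ler_wpM2l ?(ltW t0)// mle.
  have mp x : m x <= p x.
    case: A0 => r Ar; apply: le_trans (mle r _ Ar) _.
    exact: (proj2_sig r).2.
  by exists (exist _ m (conj sm mp)) => s As; apply/asboolP => x /=; exact: mle.
- exists q; split => // q' sq' q'q.
  have q'p x : q' x <= p x := le_trans (q'q x) (qp x).
  have := qmin (exist _ q' (conj sq' q'p)); rewrite /rel /=.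
  have -> : `[< forall x, q' x <= q x >] by apply/asboolP.
  by move=> /(_ isT) [].
Qed.

Lemma convex_set1 (y : V) : convex_set [set y].
Proof.
move=> x z t /set_mem-> /set_mem->; apply/mem_set.
exact: (@convmm R (convex_lmodType V) t y).
Qed.

Lemma hahn_banach_sublinear p : sublinear p ->
  exists2 f : V -> R, (forall t x y, f (t *: x + y) = t * f x + f y) &
    forall x, f x <= p x.
Proof.
move=> /minimal_sublinear[q [sq qp qmin]]; exists q => //.
have qN y : q (- y) = - q y.
  have y0 : [set y] !=set0 by exists y.
  have qy c : [set y] c -> q y <= q c by move=> ->.
  have qlow := qmin _ (lower_sublinear sq (@convex_set1 y) y0 qy)
    (lower_lep sq y0 qy).
  apply/eqP; rewrite eq_le; apply/andP; split.
    by rewrite -{1}qlow (lower_neg sq y0 qy).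
  by have := sublinearN (- y) sq; rewrite opprK.
have [qD qZ] := sq.
have qadd x y : q (x + y) = q x + q y.
  apply/eqP; rewrite eq_le qD/=.
  have := qD (- x) (- y); rewrite -opprD !qN; lra.
have qscale t x : q (t *: x) = t * q x.
  have [t0|/ltW t0] := leP 0 t; first exact: qZ.
  by rewrite -[t in LHS]opprK scaleNr qN qZ ?oppr_ge0// mulNr opprK.
by move=> t x y; rewrite qadd qscale.
Qed.

(** With r a positive lower bound for the distance from v to C, the norm is at least r on the set of
    all [v - y]. It is lowered so as to be at most -r on the opposite set; a linear functional below
    it satisfies [f y <= f v - r] on C. *)
Lemma separation C v : closed C -> convex_set C -> C !=set0 -> ~ C v ->
  exists (f : dual V) (a : R), (forall y, C y -> (f y : R) <= a) /\ a < f v.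
Proof.
move=> clC cC [c0 Cc0] Cv.
have [r r0 rC] : exists2 r : R, 0 < r & forall y, C y -> r <= `|v - y|.
  have : open (~` C) by rewrite openC.
  rewrite openE => /(_ _ Cv); rewrite /interior => /nbhs_ballP[r /= r0 rC].
  exists r => // y Cy; rewrite leNgt; apply/negP => vy.
  by apply: (rC y) Cy; rewrite -ball_normE.
pose D := [set v - y | y in C].
have sn : sublinear (fun x : V => `|x|).
  by split=> [x y|t x t0]; [exact: ler_normD|rewrite normrZ ger0_norm].
have cD : convex_set D.
  move=> _ _ t /set_mem[x Cx <-] /set_mem[y Cy <-]; apply/mem_set.
  exists (t%:inum *: x + (1 - t%:inum) *: y).
    by apply: convex_setE.
  rewrite [RHS]/conv/= !scalerBr addrACA -opprD; congr (_ - _).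
  by rewrite -scalerDl addrC subrK scale1r.
have D0 : D !=set0 by exists (v - c0), c0.
have rD c : D c -> r <= `|c| by move=> [y Cy <-]; exact: rC.
have [f lf fp] := hahn_banach_sublinear (lower_sublinear sn cD D0 rD).
have fN x : f (- x) = - f x.
  have f0 : f 0 = 0.
    by have := lf (-1) 0 0; rewrite scaleN1r oppr0 addr0; lra.
  by have := lf (-1) x 0; rewrite scaleN1r addr0 f0; lra.
have fb : f \in @blin_pred R V R^o.
  apply/asboolP; split; first by move=> t x y; exact: lf.
  exists 1 => x; rewrite mul1r ler_norml.
  have fx y : f y <= `|y| := le_trans (fp y) (lower_lep sn D0 rD y).
  by rewrite fx lerNl -fN -(normrN x) fx.
exists (BLin fb), (f v - r); split=> [y Cy|/=]; last by rewrite ltrBlDr ltrDl.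
have Dy : D (v - y) by exists y.
have := le_trans (fp _) (lower_neg sn D0 rD Dy).
rewrite fN.
have -> : f (v - y) = f v - f y by rewrite addrC -scaleN1r lf; lra.
by change (- (f v - f y) <= - r -> f y <= f v - r); lra.
Qed.

End HahnBanach.

(** * Strong measurability and the integral *)

Section StrongMeasurability.
Context {R : realType}.
Implicit Types (W : normedModType R).

Definition separable_range W (f : R -> W) :=
  exists y : nat -> W, forall t (e : R), 0 < e -> exists j, `|f t - y j| < e.

(** Strong measurability on the whole line and without exceptional null sets. Every strongly
    measurable function has such a representative ([strongly_measurable_smeas]), and closure under
    continuous operations and pointwise limits then involves no bookkeeping of null sets. *)
Definition smeas W (f : R -> W) :=
  separable_range f /\ forall U : set W, open U -> measurable (f @^-1` U : set R).

Lemma measurable_countable_cover (I : countType) (A : I -> set R) (P : I -> Prop)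
    (B : set R) : (forall i, measurable (A i)) ->
  B = \bigcup_(i in P) A i -> measurable B.
Proof.
move=> mA ->; rewrite bigcup_mkcond; apply: countable_bigcupT_measurable => // i.
by case: ifPn.
Qed.

Lemma open_ballP W (U : set W) x : open U -> U x ->
  exists n : nat, forall y, `|x - y| < 2 / n.+1%:R -> U y.
Proof.
rewrite openE => oU /oU; rewrite /interior => /nbhs_ballP[e /= e0 eU].
have e2 : 0 < e / 2 by rewrite divr_gt0.
have [n ne] := ltr_add_invr (y := 0) e2.
exists n => y xy; apply: eU; rewrite -ball_normE /=; apply: lt_trans xy _.
rewrite add0r in ne; rewrite mulrC -ltr_pdivlMr//.
Qed.

Lemma smeas_norm W (f : R -> W) : separable_range f ->
  (forall z, measurable_fun [set: R] (fun t => `|f t - z| : R)) -> smeas f.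
Proof.
move=> [y fy] mf; split=> [|U oU]; first by exists y.
pose A (i : nat * nat) := [set t | `|f t - y i.1| < i.2.+1%:R^-1].
apply: (@measurable_countable_cover _ A
  [set i | forall z, `|z - y i.1| < i.2.+1%:R^-1 -> U z]) => [i|].
  have := mf (y i.1) measurableT [set` `]-oo, (i.2.+1%:R^-1 : R)[%R].
  rewrite setTI; move=> /(_ (measurable_itv _)).
  by congr measurable; apply/seteqP; split => t; rewrite /A/= in_itv.
apply/seteqP; split=> t /=; last by move=> [i /= iU /iU].
move=> Uft; have [n nU] := open_ballP oU Uft.
have n0 : 0 < n.+1%:R^-1 :> R by rewrite invr_gt0.
have [j fj] := fy t _ n0; exists (j, n) => //= z zj; apply: nU.
rewrite -(subrK (y j) (f t)) -addrA (le_lt_trans (ler_normD _ _))//.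
by rewrite mulr_natl mulr2n ltrD// distrC.
Qed.

(** The preimage of an open set is a countable union of intersections of preimages of balls around
    the two approximating sequences, so f and g are only ever tested separately. *)
Lemma smeas_bin (W1 W2 W : normedModType R) (phi : W1 * W2 -> W) f g :
  continuous phi -> smeas f -> smeas g -> smeas (fun t => phi (f t, g t)).
Proof.
move=> cphi [[y fy] mf] [[z gz] mg]; split.
  exists (fun n => if unpickle n is Some (i, j) then phi (y i, z j) else 0) => t e e0.
  have /nbhs_ballP[d /= d0 dphi] := cphi (f t, g t) _ (nbhsx_ballx _ _ e0).
  have [i fi] := fy t d d0; have [j gj] := gz t d d0.
  exists (pickle (i, j)); rewrite pickleK.
  have : ball (f t, g t) d (y i, z j) by split; rewrite -ball_normE.
  by move=> /dphi; rewrite /= -ball_normE.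
move=> U oU.
have oV : open (phi @^-1` U) by move/continuousP : cphi; apply.
pose A (i : nat * nat * nat) :=
  (f @^-1` ball (y i.1.1) i.2.+1%:R^-1) `&` (g @^-1` ball (z i.1.2) i.2.+1%:R^-1).
apply: (@measurable_countable_cover _ A
  [set i | forall a b, ball (y i.1.1) i.2.+1%:R^-1 a ->
                       ball (z i.1.2) i.2.+1%:R^-1 b -> U (phi (a, b))]) => [i|].
  by apply: measurableI; [apply: mf|apply: mg]; apply: ball_open; rewrite invr_gt0.
apply/seteqP; split=> t /=; last by move=> [i /= iU [/iU h /h]].
move=> Uft; have := oV; rewrite openE => /(_ (f t, g t) Uft).
rewrite /interior => /nbhs_ballP[e /= e0 eU].
have e2 : 0 < e / 2 by rewrite divr_gt0.
have [n] := ltr_add_invr (y := 0) e2; rewrite add0r => ne.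
have n0 : 0 < n.+1%:R^-1 :> R by rewrite invr_gt0.
have [i fi] := fy t _ n0; have [j gj] := gz t _ n0.
exists (i, j, n); last first.
  by rewrite /A/= -!ball_normE /= (distrC (y i)) (distrC (z j)).
move=> a b /=; rewrite -!ball_normE /= => ia jb; apply: (eU (a, b)).
split; rewrite -ball_normE /=.
- rewrite -(subrK (y i) (f t)) -addrA (le_lt_trans (ler_normD _ _))//.
  by rewrite [e]splitr ltrD// (lt_trans _ ne).
- rewrite -(subrK (z j) (g t)) -addrA (le_lt_trans (ler_normD _ _))//.
  by rewrite [e]splitr ltrD// (lt_trans _ ne).
Qed.

Lemma smeas_comp W1 W (phi : W1 -> W) f :
  continuous phi -> smeas f -> smeas (phi \o f).
Proof.
move=> cphi sf; apply: (smeas_bin (phi := phi \o fst) (g := f)) => //.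
by move=> x; apply: continuous_comp; [exact: cvg_fst|exact: cphi].
Qed.

Lemma smeas_cst W (w : W) : smeas (fun=> w).
Proof.
split=> [|U oU]; first by exists (fun=> w) => t e e0; exists 0%N; rewrite subrr normr0.
have [Uw|Uw] := pselect (U w).
  by rewrite (_ : _ @^-1` _ = setT)//; apply/seteqP; split.
by rewrite (_ : _ @^-1` _ = set0)//; apply/seteqP; split.
Qed.

Lemma smeasD W (f g : R -> W) : smeas f -> smeas g ->
  smeas (fun t => f t + g t).
Proof.
move=> sf sg; apply: (smeas_bin (phi := fun x => x.1 + x.2)) => //.
exact: add_continuous.
Qed.

Lemma smeasZ W (a : R -> R^o) (f : R -> W) : smeas a -> smeas f ->
  smeas (fun t => a t *: f t).
Proof.
move=> sa sf; apply: (smeas_bin (phi := fun x : R^o * W => x.1 *: x.2)) => //.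
exact: scale_continuous.
Qed.

Lemma smeasZl W (a : R) (f : R -> W) : smeas f -> smeas (fun t => a *: f t).
Proof. by move=> sf; apply: smeasZ => //; exact: smeas_cst. Qed.

Lemma smeasN W (f : R -> W) : smeas f -> smeas (fun t => - f t).
Proof.
move=> sf; rewrite (_ : (fun _ => _) = (fun t => (-1) *: f t)) ?smeasZl//.
  exact: smeasZl.
by apply/funext => t; rewrite scaleN1r.
Qed.

Lemma smeasB W (f g : R -> W) : smeas f -> smeas g ->
  smeas (fun t => f t - g t).
Proof. by move=> sf sg; apply: smeasD => //; exact: smeasN. Qed.

Lemma smeas_normr W (f : R -> W) : smeas f -> smeas (fun t => `|f t| : R^o).
Proof. by move=> sf; apply: smeas_comp (sf) => x; exact: norm_continuous. Qed.

Lemma smeas_measurable (f : R -> R^o) : smeas f -> measurable_fun [set: R] (f : R -> R).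
Proof.
move=> [_ mf] mT; apply: (measurability _ (measurable_realfun.RGenOpens.measurableE R)) => //.
move=> _ [_ [a [b ->] <-]]; rewrite setTI; apply: mf; exact: interval_open.
Qed.

Lemma rat_dense_seq : exists y : nat -> R, forall x e : R, 0 < e ->
  exists j, `|x - y j| < e.
Proof.
exists (fun n => if unpickle n is Some q then ratr (q : rat) else 0) => x e e0.
have xe : x < x + e by rewrite ltrDl.
have [q] := rat_in_itvoo xe; rewrite in_itv/= => /andP[xq qx].
exists (pickle q); rewrite pickleK distrC ger0_norm ?subr_ge0 1?ltW//.
by rewrite ltrBlDl.
Qed.

Lemma measurable_smeas (f : R -> R) :
  measurable_fun [set: R] f -> smeas (f : R -> R^o).
Proof.
move=> mf; apply: smeas_norm => [|z].
  by have [y hy] := rat_dense_seq; exists y => t e /(hy (f t)).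
by apply: measurableT_comp => //; apply: measurable_funB.
Qed.

Lemma smeas_lim W (f_ : nat -> R -> W) f : (forall n, smeas (f_ n)) ->
  (forall t, f_ n t @[n --> \oo] --> f t) -> smeas f.
Proof.
move=> sf_ ff; apply: smeas_norm => [|z].
  have [y hy] := choice (fun n => (sf_ n).1).
  exists (fun n => if unpickle n is Some (i, j) then y i j else 0) => t e e0.
  have e2 : 0 < e / 2 by rewrite divr_gt0.
  have /cvgrPdist_lt/(_ _ e2)[n _ /(_ n (leqnn n)) fn] := ff t.
  have [j fj] := hy n t _ e2; exists (pickle (n, j)); rewrite pickleK.
  rewrite -(subrK (f_ n t) (f t)) -addrA (le_lt_trans (ler_normD _ _))//.
  by rewrite [e]splitr ltrD.
apply: (@measurable_fun_cvg _ _ _ _ (fun n t => `|f_ n t - z|)) => // [n|t _].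
  apply: smeas_measurable; apply: smeas_normr; apply: smeasB => //.
  exact: smeas_cst.
by apply: cvg_norm; apply: cvgB => //; exact: cvg_cst.
Qed.

Lemma smeas_if W (A : set R) (f g : R -> W) : measurable A -> smeas f -> smeas g ->
  smeas (fun t => if t \in A then f t else g t).
Proof.
move=> mA [[y fy] mf] [[z gz] mg]; split=> [|U oU].
  exists (fun n => if unpickle n is Some (b, j) then (if b : bool then y j else z j)
    else 0) => t e e0.
  case: ifPn => _; [have [j h] := fy t e e0|have [j h] := gz t e e0].
    by exists (pickle (true, j)); rewrite pickleK.
  by exists (pickle (false, j)); rewrite pickleK.
rewrite (_ : _ @^-1` _ = (A `&` f @^-1` U) `|` (~` A `&` g @^-1` U)).
  apply: measurableU; apply: measurableI; [by []|exact: mf| |exact: mg].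
  exact: measurableC.
apply/seteqP; split=> t /=.
  by case: ifPn => [/set_mem At Uf|/negP At Ug]; [left|right; split=> // /mem_set].
by case: ifPn => [/set_mem At [[]//|[]//]|/negP At [[/mem_set]//|[]//]].
Qed.

Lemma smeas_simple W (f : R -> W) : finite_set (range f) -> smeas f -> simple_fun f.
Proof.
move=> ff [_ mf]; split=> // y; rewrite -[X in measurable X]setCK.
apply: measurableC; rewrite -[X in measurable X]/(f @^-1` (~` [set y])); apply: mf.
by rewrite openC; apply: compact_closed; [exact: norm_hausdorff|exact: compact_set1].
Qed.

Lemma simple_smeas W (f : R -> W) : simple_fun f -> smeas f.
Proof.
move=> [/finite_seqP[s fs] mf]; have fin t : f t \in s.
  by have : range f (f t) by []; rewrite fs.
split=> [|U oU].
  exists (nth 0 s) => t e e0; exists (index (f t) s).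
  by rewrite nth_index// subrr normr0.
apply: (@measurable_countable_cover _ (fun i => f @^-1` [set nth 0 s i])
  [set i | U (nth 0 s i)]) => [i|]; first exact: mf.
apply/seteqP; split=> t /=; last by move=> [i /= Ui ->].
by move=> Ut; exists (index (f t) s); rewrite /= nth_index.
Qed.

Lemma smeas_lt_measurable (f g : R -> R^o) : smeas f -> smeas g ->
  measurable [set t | (f t : R) < g t].
Proof.
move=> sf sg; have [_ /(_ [set z : R^o | 0 < (z : R)])] := smeasB sg sf.
have o0 : open [set z : R^o | 0 < (z : R)] by exact: open_gt.
move=> /(_ o0); congr measurable; apply/seteqP; split=> t /=.
  by rewrite subr_gt0.
by rewrite subr_gt0.
Qed.

(* the point of {0, y 0, ..., y n.-1} closest to f t *)
Fixpoint nearest W (y : nat -> W) (f : R -> W) n : R -> W := if n is m.+1 then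
  fun t => if t \in [set t | (`|f t - y m| : R) < `|f t - nearest y f m t|]
    then y m else nearest y f m t
  else fun=> 0.

Section Nearest.
Variables (W : normedModType R) (y : nat -> W) (f : R -> W).
Local Notation g := (nearest y f).

Lemma nearestS n t : `|f t - g n.+1 t| <= Num.min `|f t - y n| `|f t - g n t|.
Proof.
rewrite /=; case: ifPn.
  by rewrite inE /= => h; rewrite le_min lexx ltW.
by rewrite notin_setE /= => /negP; rewrite -leNgt => h; rewrite le_min h lexx.
Qed.

Lemma nearest_nincr n m t : (n <= m)%N -> `|f t - g m t| <= `|f t - g n t|.
Proof.
elim: m => [|m IH]; first by rewrite leqn0 => /eqP ->.
rewrite leq_eqVlt => /predU1P[->//|]; rewrite ltnS => /IH.
by apply: le_trans; apply: le_trans (nearestS _ _) _; rewrite ge_min lexx orbT.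
Qed.

Lemma nearest_le n t : `|f t - g n t| <= `|f t|.
Proof. by have := nearest_nincr t (leq0n n); rewrite subr0. Qed.

Lemma nearest_lt n j t : (j < n)%N -> `|f t - g n t| <= `|f t - y j|.
Proof.
move=> jn; apply: le_trans (nearest_nincr t jn) _.
by apply: le_trans (nearestS _ _) _; rewrite ge_min lexx.
Qed.

Lemma nearest_in n t : g n t = 0 \/ g n t \in mkseq y n.
Proof.
elim: n => [|n IH]; first by left.
have sub x : x \in mkseq y n -> x \in mkseq y n.+1.
  move=> /mapP[i]; rewrite mem_iota add0n /= => iK ->.
  by apply: map_f; rewrite mem_iota add0n leqW.
rewrite /=; case: ifPn => _; last by case: IH => [->|/sub]; [left|right].
by right; apply: map_f; rewrite mem_iota add0n leqnn.
Qed.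

Lemma smeas_nearest n : smeas f -> smeas (g n).
Proof.
move=> sf; elim: n => [|n IH]; first exact: smeas_cst.
apply: smeas_if => //; last exact: smeas_cst.
apply: smeas_lt_measurable; apply: smeas_normr; apply: smeasB => //.
exact: smeas_cst.
Qed.

Lemma simple_nearest n : smeas f -> simple_fun (g n).
Proof.
move=> sf; apply: smeas_simple; last exact: smeas_nearest.
apply: (@sub_finite_set _ _ ([set 0] `|` [set` mkseq y n])).
  by move=> _ [t _ <-]; have [->|h] := nearest_in n t; [left|right].
by rewrite finite_setU; split; [exact: finite_set1|exact: finite_seq].
Qed.

End Nearest.

(** Nearest-point approximation; 0 being among the candidates, the error never exceeds [|f|], which
    is the domination used for convergence in [L1]. *)
Lemma smeas_approx W (f : R -> W) : smeas f -> exists g : nat -> R -> W,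
  [/\ forall n, simple_fun (g n), forall t, g n t @[n --> \oo] --> f t &
     forall n t, `|f t - g n t| <= `|f t|].
Proof.
move=> sf; have [[y fy] _] := sf; exists (nearest y f); split=> [n|t|n t].
- exact: simple_nearest.
- apply/cvgrPdist_lt => e e0; have [j fj] := fy t e e0.
  by exists j.+1 => // n /= jn; apply: le_lt_trans (nearest_lt y f t jn) fj.
- exact: nearest_le.
Qed.

Lemma strongly_measurable_smeas W (D : set R) (f : R -> W) : measurable D ->
  strongly_measurable D f -> exists2 f' : R -> W, smeas f' &
    \forall t \ae (@lebesgue_measure R), D t -> f t = f' t.
Proof.
move=> mD [g [sg [N [mN N0 gN]]]].
exists (fun t => if t \in D `\` N then f t else 0).
  apply: (@smeas_lim _ (fun n t => if t \in D `\` N then g n t else 0)) => [n|t].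
    apply: smeas_if; [exact: measurableD|exact: simple_smeas|exact: smeas_cst].
  case: ifPn => [|_]; last exact: cvg_cst.
  move=> /set_mem[Dt Nt]; move: Dt; apply: contra_notP Nt => h; exact: gN.
exists N; split=> // t /= h; apply: contrapT => Nt; apply: h => Dt.
by rewrite mem_set.
Qed.

Lemma smeas_strongly_measurable W (D : set R) (f : R -> W) :
  smeas f -> strongly_measurable D f.
Proof.
by move=> /smeas_approx[g [sg gf _]]; exists g; split => //; apply: aeW => t _.
Qed.

End StrongMeasurability.

Section BoundedOperators.
Context {R : realType} {V W : normedModType R}.
Implicit Types f : blin V W.

Lemma blinZ f a x : f (a *: x) = a *: f x.
Proof.
have lin := blin_linear f.
have f0 : f 0 = 0 by have := lin (-1) 0 0; rewrite !scaleN1r oppr0 addr0 addNr.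
by have := lin a x 0; rewrite addr0 f0 addr0.
Qed.

Lemma blinD f x y : f (x + y) = f x + f y.
Proof. by have := blin_linear f 1 x y; rewrite !scale1r. Qed.

Lemma blinN f x : f (- x) = - f x.
Proof. by rewrite -scaleN1r blinZ scaleN1r. Qed.

Lemma blinB f x y : f (x - y) = f x - f y.
Proof. by rewrite blinD blinN. Qed.

Lemma blin0 f : f 0 = 0.
Proof. by rewrite -(scale0r 0) blinZ scale0r. Qed.

Lemma blin_le f x : `|f x| <= `|f| * `|x|.
Proof.
have [->|x0] := eqVneq x 0; first by rewrite blin0 !normr0 mulr0.
have nx : 0 < `|x| by rewrite normr_gt0.
rewrite -ler_pdivrMr// mulrC -(ger0_norm (ltW _ : 0 <= `|x|^-1)) ?invr_gt0//.
rewrite -normrZ -blinZ; apply: (supnorm_ub (blin_bounded f)) => /=.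
by rewrite normrZ ger0_norm ?invr_ge0// mulVf// gt_eqF.
Qed.

Lemma blin_continuous f : continuous f.
Proof.
move=> x; apply/cvgrPdist_lt => e e0.
have M0 : 0 < `|f| + 1 by rewrite ltr_wpDl.
apply/nbhs_ballP; exists (e / (`|f| + 1)) => /=; first by rewrite divr_gt0.
move=> y; rewrite -ball_normE /= => xy; rewrite -blinB.
apply: le_lt_trans (blin_le _ _) _.
apply: (@le_lt_trans _ _ ((`|f| + 1) * `|x - y|)).
  by rewrite ler_wpM2r// lerDl.
by rewrite mulrC -ltr_pdivlMr.
Qed.

Lemma blin_eval_continuous : continuous (fun x : blin V W * V => x.1 x.2).
Proof.
move=> [f x]; apply/cvgrPdist_lt => e e0.
pose M := `|f| + `|x| + 1; have M0 : 0 < M by rewrite ltr_wpDl// addr_ge0.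
pose d := Num.min 1 (e / M / 2).
have d0 : 0 < d by rewrite lt_min ltr01 !divr_gt0.
have d1 : d <= 1 by rewrite ge_min lexx.
have dM : d * M < e.
  apply: (@le_lt_trans _ _ (e / M / 2 * M)).
    by rewrite ler_wpM2r ?(ltW M0)// ge_min lexx orbT.
  rewrite mulrAC divfK ?gt_eqF//; lra.
exists (ball f d, ball x d) => /=; first by split; exact: nbhsx_ballx.
move=> [g y] [/=]; rewrite -!ball_normE /= => fg xy.
have -> : f x - g y = f (x - y) + (f - g) y by rewrite blinB /=; rewrite addrA subrK.
apply: le_lt_trans (ler_normD _ _) _.
have h1 := blin_le f (x - y); have h2 := blin_le (f - g) y.
have ny : `|y| <= `|x| + 1.
  rewrite -(subrK x y) (le_trans (ler_normD _ _))// addrC lerD2l distrC.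
  exact: le_trans (ltW xy) d1.
have h3 : `|f - g| * `|y| <= d * (`|x| + 1) by rewrite ler_pM// ltW.
have h4 : `|f| * `|x - y| <= `|f| * d by rewrite ler_wpM2l// ltW.
apply: le_lt_trans dM; rewrite /M; lra.
Qed.

End BoundedOperators.

(** * Integrals of norms and almost everywhere reasoning *)

Section L1Norm.
Context {R : realType}.
Local Notation mu := (@lebesgue_measure R).
Variables (D : set R) (mD : measurable D).
Implicit Types W : normedModType R.

Lemma ae_imp (P Q : R -> Prop) : (forall s, P s -> Q s) ->
  (\forall s \ae mu, P s) -> \forall s \ae mu, Q s.
Proof.
move=> PQ; exact: (@filterS _ _ (ae_filter_ringOfSetsType mu) P Q PQ).
Qed.

Lemma ae_and (P Q : R -> Prop) : (\forall s \ae mu, P s) ->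
  (\forall s \ae mu, Q s) -> \forall s \ae mu, P s /\ Q s.
Proof.
move=> Ps Qs; exact: (@filterI _ _ (ae_filter_ringOfSetsType mu) P Q Ps Qs).
Qed.

Lemma ae_all (P : nat -> R -> Prop) : (forall n, \forall s \ae mu, P n s) ->
  \forall s \ae mu, forall n, P n s.
Proof.
move=> Pn; have := negligible_bigcup Pn.
by apply: negligibleS => s /= /existsNP[n nP]; exists n.
Qed.

Definition L1 W (u : R -> W) : \bar R := (\int[mu]_(s in D) (`|u s|)%:E)%E.

Lemma smeas_norm_EFin W (u : R -> W) A : smeas u ->
  measurable_fun A (fun s => (`|u s|)%:E).
Proof.
move=> su; apply/measurable_EFinP; apply: measurable_funTS.
exact: smeas_measurable (smeas_normr su).
Qed.

Lemma L1_ge0 W (u : R -> W) : (0 <= L1 u)%E.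
Proof. by apply: integral_ge0 => s _; rewrite lee_fin. Qed.

Lemma le_L1 W1 W2 (u : R -> W1) (v : R -> W2) : smeas u -> smeas v ->
  (\forall s \ae mu, D s -> `|u s| <= `|v s|) -> (L1 u <= L1 v)%E.
Proof.
move=> su sv uv; apply: ae_ge0_le_integral => //.
- exact: smeas_norm_EFin.
- exact: smeas_norm_EFin.
Qed.

Lemma eq_L1 W (u v : R -> W) : smeas u -> smeas v ->
  (\forall s \ae mu, D s -> u s = v s) -> L1 u = L1 v.
Proof.
move=> su sv uv; apply/eqP; rewrite eq_le; apply/andP; split; apply: le_L1 => //;
by apply: ae_imp uv => s h /h ->.
Qed.

Lemma L1D W (u v : R -> W) : smeas u -> smeas v ->
  (L1 (fun s => u s + v s)%R <= L1 u + L1 v)%E.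
Proof.
move=> su sv; rewrite /L1 -ge0_integralD//; first last.
- exact: smeas_norm_EFin.
- exact: smeas_norm_EFin.
apply: ge0_le_integral => //.
- by apply: smeas_norm_EFin; exact: smeasD.
- by apply: emeasurable_funD; exact: smeas_norm_EFin.
- by move=> s _; rewrite -EFinD lee_fin ler_normD.
Qed.

Lemma L1Z W (u : R -> W) a : smeas u -> L1 (fun s => a *: u s) = (`|a|%:E * L1 u)%E.
Proof.
move=> su; rewrite /L1 -ge0_integralZl//; last exact: smeas_norm_EFin.
by apply: eq_integral => s _; rewrite normrZ EFinM.
Qed.

Lemma L1B W (u v : R -> W) : smeas u -> smeas v ->
  (L1 (fun s => u s - v s)%R <= L1 u + L1 v)%E.
Proof.
move=> su sv; apply: le_trans (L1D su (smeasN sv)) _.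
rewrite leeD2l// le_L1//; first exact: smeasN.
by apply: aeW => s _; rewrite normrN.
Qed.

Lemma L1_fin W (u : R -> W) : (L1 u < +oo)%E -> (L1 u = (fine (L1 u))%:E)%E.
Proof. by move=> u1; rewrite fineK// ge0_fin_numE// L1_ge0. Qed.

Lemma L1_integrable (u : R -> R^o) : smeas u -> (L1 u < +oo)%E ->
  mu.-integrable D (fun s => (u s : R)%:E).
Proof.
move=> su u1; apply/integrableP; split => //.
by apply/measurable_EFinP/measurable_funTS; exact: smeas_measurable.
Qed.

Lemma smeas_dual W (l : dual W) (u : R -> W) : smeas u ->
  smeas (fun s => l (u s) : R^o).
Proof. by move=> su; apply: (smeas_comp (phi := l)) => //; exact: blin_continuous. Qed.

Lemma L1_dual W (l : dual W) (u : R -> W) : smeas u ->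
  (L1 (fun s => l (u s) : R^o) <= `|l|%:E * L1 u)%E.
Proof.
move=> su; rewrite -[X in (X%:E * _)%E]ger0_norm// -L1Z//.
apply: le_L1; [exact: smeas_dual|exact: smeasZl|].
by apply: aeW => s _; rewrite normrZ normr_id; exact: blin_le.
Qed.

Lemma dual_integrable W (l : dual W) (u : R -> W) : smeas u -> (L1 u < +oo)%E ->
  mu.-integrable D (fun s => (l (u s) : R)%:E).
Proof.
move=> su u1; apply: (L1_integrable (smeas_dual l su)).
apply: le_lt_trans (L1_dual l su) _; rewrite (L1_fin u1) -EFinM; exact: ltry.
Qed.

Lemma L1_dct W (f_ : nat -> R -> W) f (g : R -> R) : (forall n, smeas (f_ n)) ->
  smeas f -> mu.-integrable D (EFin \o g) ->
  (\forall s \ae mu, D s -> f_ n s @[n --> \oo] --> f s) ->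
  (\forall s \ae mu, forall n, D s -> `|f s - f_ n s| <= g s) ->
  (L1 (fun s => f s - f_ n s)%R @[n --> \oo] --> 0)%E.
Proof.
move=> sf_ sf ig ff fg; rewrite /L1.
have sB n : smeas (fun s => f s - f_ n s) by exact: smeasB.
have [||_ _] := @dominated_convergence _ _ _ mu D mD
  (fun n s => (`|f s - f_ n s|)%:E) (fun=> 0%E) (EFin \o g)
  (fun n => smeas_norm_EFin (sB n)) (measurable_cst _) _ ig _; last by rewrite integral0.
  apply: ae_imp ff => s h /h {}h.
  apply: cvg_EFin; first by apply: nearW.
  rewrite (_ : fine \o _ = (fun n => `|f s - f_ n s|))//.
  rewrite -(normr0 W) -(subrr (f s)); apply: cvg_norm.
  by apply: cvgB => //; exact: cvg_cst.
apply: ae_imp fg => s h n Ds.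
by rewrite abse_EFin normr_id lee_fin; exact: h.
Qed.

End L1Norm.

Lemma convex_setP (R : realType) (V : lmodType R) (B : set V) :
  (forall x y (t : R), B x -> B y -> 0 <= t -> t <= 1 ->
     B (t *: x + (1 - t) *: y)) -> convex_set B.
Proof.
move=> h x y t /set_mem Bx /set_mem By; apply/mem_set.
by apply: (h x y t%:num).
Qed.

Lemma ball_convex (R : realType) (V : normedModType R) (C : R) :
  convex_set [set y : V | `|y| <= C].
Proof.
apply: convex_setP => x y t /= Bx By t0 t1.
have t1' : 0 <= 1 - t by rewrite subr_ge0.
apply: le_trans (ler_normD _ _) _; rewrite !normrZ.
rewrite (ger0_norm t0) (ger0_norm t1').
have := ler_wpM2l t0 Bx; have := ler_wpM2l t1' By; lra.
Qed.

(** * The integral tested by functionals *)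

Section PettisIntegral.
Context {R : realType} {E : completeNormedModType R}.
Local Notation mu := (@lebesgue_measure R).
Variables (D : set R) (mD : measurable D).
Implicit Types (u f g : R -> E) (v w : E).

(* v is the Pettis integral of f over D *)
Definition bint f v := [/\ smeas f, (L1 D f < +oo)%E &
  forall l : dual E, (l v : R) = \int[mu]_(s in D) (l (f s) : R)].

(** Otherwise a functional separates v from a ball whose radius lies between the two sides, and
    integrating it along f contradicts the value of [l v]. *)
Lemma bint_norm f v : bint f v -> (`|v|%:E <= L1 D f)%E.
Proof.
move=> [sf f1 fv]; rewrite (L1_fin f1) lee_fin leNgt; apply/negP => Cv.
(* The midpoint: below [|v|], and positive even when C is 0, so that scaling into the ball bounds l
   by a multiple of the norm. *)
set C := fine (L1 D f) in Cv; pose C' := (C + `|v|) / 2.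
have C0 : 0 <= C by apply: fine_ge0; exact: L1_ge0.
have C'0 : 0 < C' by rewrite /C'; lra.
have CC' : C <= C' by rewrite /C'; lra.
have C'v : C' < `|v| by rewrite /C'; lra.
pose B := [set y : E | `|y| <= C'].
have clB : closed B.
  rewrite (_ : B = (fun y : E => `|y| : R) @^-1` [set r : R | r <= C']).
    by apply: closed_comp; [move=> y _; exact: norm_continuous|exact: closed_le].
  by [].
have cB : convex_set B by exact: ball_convex.
have B0 : B !=set0 by exists 0; rewrite /B /= normr0 ltW.
have Bv : ~ B v by rewrite /B /=; apply/negP; rewrite -ltNge.
have [l [a [la av]]] := separation clB cB B0 Bv.
have a0 : 0 <= a by have := la 0; rewrite blin0; apply; rewrite /B /= normr0 ltW.
have lB z : l z <= a / C' * `|z|.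
  have [->|z0] := eqVneq z 0; first by rewrite blin0 normr0 mulr0.
  have nz : 0 < `|z| by rewrite normr_gt0.
  have : B ((C' / `|z|) *: z).
    by rewrite /B /= normrZ normrM normfV normr_id divfK ?gt_eqF// gtr0_norm.
  move=> /la; rewrite blinZ => h.
  have {}h : C' / `|z| * (l z : R) <= a by exact: h.
  suff key (x n : R) : 0 < n -> C' / n * x <= a -> x <= a / C' * n by exact: key h.
  move=> n0 hx; have nC : 0 <= n / C' by rewrite divr_ge0// ltW.
  have := ler_wpM2l nC hx.
  have -> : n / C' * (C' / n * x) = x by field; rewrite !gt_eqF.
  by rewrite [n / C' * a]mulrAC [n * a]mulrC [a * n / C']mulrAC.
suff : (l v : R) <= a by rewrite leNgt av.
have iN : mu.-integrable D (fun s => (`|f s|)%:E).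
  apply/integrableP; split; first exact: smeas_norm_EFin.
  rewrite (_ : (\int[_]_(_ in _) _)%E = L1 D f)//.
  by apply: eq_integral => s _; rewrite abse_EFin normr_id.
rewrite fv; apply: (@le_trans _ _ (\int[mu]_(s in D) (a / C' * `|f s|))).
  apply: le_Rintegral => //; first exact: dual_integrable.
  rewrite (_ : EFin \o _ = (fun s => (a / C')%:E * (`|f s|)%:E)%E); last first.
    by apply/funext => s; rewrite /= EFinM.
  exact: integrableZl.
rewrite RintegralZl// -/C -(_ : C = \int[mu]_(s in D) `|f s|)//.
by rewrite mulrAC ler_pdivrMr// ler_wpM2l.
Qed.

Lemma bintD f g v w (a : R) : bint f v -> bint g w ->
  bint (fun s => a *: f s + g s) (a *: v + w).
Proof.
move=> [sf f1 fv] [sg g1 gw].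
have s1 : smeas (fun s => a *: f s) by exact: smeasZl.
have a1 : (L1 D (fun s => a *: f s) < +oo)%E.
  by rewrite L1Z// (L1_fin f1) -EFinM ltry.
split; first exact: smeasD.
  by apply: le_lt_trans (L1D mD s1 sg) _; rewrite (L1_fin a1) (L1_fin g1) -EFinD ltry.
move=> l; rewrite blinD blinZ.
have -> : \int[mu]_(s in D) (l (a *: f s + g s) : R) =
    \int[mu]_(s in D) ((l (a *: f s) : R) + (l (g s) : R)).
  by apply: eq_Rintegral => s _; rewrite blinD.
rewrite RintegralD//; [|exact: dual_integrable..].
have -> : \int[mu]_(s in D) (l (a *: f s) : R) = \int[mu]_(s in D) (a * (l (f s) : R)).
  by apply: eq_Rintegral => s _; rewrite blinZ.
by rewrite RintegralZl ?dual_integrable// -fv -gw.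
Qed.

Lemma bintB f g v w : bint f v -> bint g w ->
  bint (fun s => f s - g s) (v - w).
Proof.
move=> bf bg; have := bintD (-1) bg bf; rewrite scaleN1r addrC.
by rewrite (_ : (fun _ => _) = (fun s => f s - g s))//; apply/funext => s; rewrite scaleN1r addrC.
Qed.

Lemma bint_dist f g v w : bint f v -> bint g w ->
  (`|v - w|%:E <= L1 D (fun s => f s - g s)%R)%E.
Proof. by move=> bf bg; apply: bint_norm; exact: bintB. Qed.

Lemma bint_unique f g v w : bint f v -> bint g w ->
  (\forall s \ae mu, D s -> f s = g s) -> v = w.
Proof.
move=> bf bg fg; have := bint_dist bf bg.
have sB : smeas (fun s => f s - g s) by apply: smeasB; [case: bf|case: bg].
have -> : L1 D (fun s => f s - g s) = L1 D (fun=> 0 : E).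
  apply: eq_L1 => //; first exact: smeas_cst.
  by apply: ae_imp fg => s h /h ->; rewrite subrr.
rewrite /L1; under eq_integral do rewrite normr0.
by rewrite integral0 lee_fin normr_le0 subr_eq0 => /eqP.
Qed.

Lemma bint_ae f g v : bint f v -> smeas g ->
  (\forall s \ae mu, D s -> f s = g s) -> bint g v.
Proof.
move=> [sf f1 fv] sg fg; split=> //; first by rewrite -(eq_L1 _ sf sg fg).
move=> l; rewrite fv; congr fine; apply: ae_eq_integral => //.
- by apply/measurable_EFinP/measurable_funTS; exact: (smeas_measurable (smeas_dual l sf)).
- by apply/measurable_EFinP/measurable_funTS; exact: (smeas_measurable (smeas_dual l sg)).
- by apply: ae_imp fg => s h /h ->.
Qed.

Lemma bint_lim (f_ : nat -> R -> E) (v_ : nat -> E) f v :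
  (forall n, bint (f_ n) (v_ n)) -> smeas f -> (L1 D f < +oo)%E ->
  (L1 D (fun s => f s - f_ n s)%R @[n --> \oo] --> 0)%E -> v_ n @[n --> \oo] --> v ->
  bint f v.
Proof.
move=> bf sf f1 fc vc; split=> // l.
have lv : (l (v_ n) : R) @[n --> \oo] --> (l v : R).
  exact: (continuous_cvg _ (@blin_continuous _ _ _ l v) vc).
apply: (cvg_unique _ lv) => //=.
apply/cvgrPdist_lt => e e0.
have l0 : 0 < `|l| + 1 by rewrite ltr_wpDl.
have := fc; move/fine_cvgP => [_ /cvgrPdist_lt/(_ (e / (`|l| + 1)))].
rewrite divr_gt0// => /(_ isT)[N _ hN]; exists N => // n /hN /=.
rewrite sub0r normrN => h; have [sn n1 ->] := bf n.
have dB : smeas (fun s => f s - f_ n s) by exact: smeasB.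
have dB1 : (L1 D (fun s => f s - f_ n s)%R < +oo)%E.
  by apply: le_lt_trans (L1B mD sf sn) _; rewrite (L1_fin f1) (L1_fin n1) ltry.
rewrite -RintegralB ?dual_integrable//.
have -> : \int[mu]_(s in D) ((l (f s) : R) - (l (f_ n s) : R)) =
    \int[mu]_(s in D) (l (f s - f_ n s) : R).
  by apply: eq_Rintegral => s _; rewrite blinB.
apply: le_lt_trans (@le_normr_Rintegral _ _ _ mu D _ mD (dual_integrable mD l dB dB1)) _.
have := L1_dual mD l dB; rewrite (L1_fin dB1) => h2.
apply: (@le_lt_trans _ _ ((`|l| + 1) * fine (L1 D (fun s => f s - f_ n s)%R))).
  rewrite -lee_fin /Rintegral fineK; last first.
    rewrite ge0_fin_numE; last exact: L1_ge0.
    by apply: le_lt_trans h2 _; rewrite -EFinM ltry.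
  apply: le_trans h2 _; rewrite -EFinM lee_fin ler_wpM2r ?lerDl// fine_ge0//.
  exact: L1_ge0.
rewrite mulrC -ltr_pdivlMr//; apply: le_lt_trans h; exact: ler_norm.
Qed.

End PettisIntegral.

Section AeIntegral.
Context {R : realType}.
Local Notation mu := (@lebesgue_measure R).
Import HBNNSimple.

(* no measurability assumption: the integral is a supremum over simple
   functions, and these can be cut off on a null set *)
Lemma ge0_integral_ae_eq (A : set R) (u w : R -> \bar R) :
  (forall s, 0 <= u s)%E -> (forall s, 0 <= w s)%E ->
  (\forall s \ae mu, A s -> u s = w s) ->
  (\int[mu]_(s in A) u s = \int[mu]_(s in A) w s)%E.
Proof.
wlog suff : u w / (forall s, 0 <= u s)%E -> (forall s, 0 <= w s)%E ->
    (\forall s \ae mu, A s -> u s = w s) ->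
    (\int[mu]_(s in A) u s <= \int[mu]_(s in A) w s)%E.
  move=> H u0 w0 uw; apply/eqP; rewrite eq_le; apply/andP; split; apply: H => //.
  by apply: ae_imp uw => s h /h ->.
move=> u0 w0 [N [mN N0 uw]].
rewrite !ge0_integralE//; apply: ge_ereal_sup => _ [h /= hu <-].
pose h' := proj_nnsfun h (measurableC mN).
have -> : sintegral mu h = sintegral mu h'.
  have := @ge0_ae_eq_integral _ _ _ mu setT (EFin \o h) (EFin \o h') measurableT.
  rewrite !integral_nnsfun//; rewrite !patch_setT; apply.
  - by apply/measurable_EFinP.
  - by apply/measurable_EFinP.
  - by move=> x _; rewrite lee_fin.
  - by move=> x _; rewrite lee_fin.
  exists N; split=> // s /= ; apply: contra_notP => Ns _.
  by rewrite /h' /= mindicE mem_set// mulr1.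
apply: ereal_sup_ubound; exists h' => //= s.
rewrite mindicE; have [Ns|Ns] := pselect (N s).
  rewrite memNset ?mulr0; last by move=> /(_ Ns).
  by rewrite patchE; case: ifPn.
rewrite mem_set// mulr1; apply: le_trans (hu s) _; rewrite !patchE.
case: ifPn => // /set_mem As; rewrite (_ : u s = w s)//.
by apply: contrapT => uws; apply: Ns; apply: uw => /= /(_ As).
Qed.

End AeIntegral.

Lemma cauchy_cvgn (R : realType) (W : completeNormedModType R) (v : nat -> W) :
  (forall e : R, 0 < e -> exists N, forall n m, (N <= n)%N -> (N <= m)%N ->
    `|v n - v m| < e) -> cvgn v.
Proof.
move=> cv; apply/cauchy_cvgP; apply: cauchy_exP => e e0.
have [N vN] := cv e e0; exists (v N); exists N => // n /= nN.
by rewrite -ball_normE /=; exact: vN.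
Qed.

(** * Simple functions and existence of the integral *)

Section SimpleIntegral.
Context {R : realType} {E : completeNormedModType R}.
Local Notation mu := (@lebesgue_measure R).
Implicit Types (A D : set R) (f g : R -> E).

Lemma simple_integral_dual A g (l : dual E) : measurable A -> (mu A < +oo)%E ->
  simple_fun g -> (l (simple_integral A g) : R) = \int[mu]_(s in A) (l (g s) : R).
Proof.
move=> mA A1 [/finite_seqP[s gs] mg].
have us : uniq (undup s) by exact: undup_uniq.
have gs' : range g = [set` undup s].
  by rewrite gs; apply/seteqP; split => x /=; rewrite mem_undup.
have ing t : g t \in undup s.
  by have : range g (g t) by []; rewrite gs'.
rewrite /simple_integral gs' -fsbig_seq//.
have -> : (l (\sum_(y <- undup s) fine (mu (A `&` g @^-1` [set y])) *: y) : R) =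
   \sum_(y <- undup s) fine (mu (A `&` g @^-1` [set y])) * (l y : R).
  elim: (undup s) => [|y r IH]; first by rewrite !big_nil blin0.
  by rewrite !big_cons blinD blinZ -IH.
have indI y : mu.-integrable A (fun t => (\1_(g @^-1` [set y]) t)%:E).
  have mgy : measurable (g @^-1` [set y]) by exact: mg.
  apply/integrableP; split; first by apply/measurable_EFinP; apply: measurable_indic; exact: mg.
  under eq_integral do rewrite gee0_abs ?lee_fin//.
  rewrite integral_indic//; apply: le_lt_trans A1; apply: le_measure.
  - by rewrite inE; apply: measurableI => //; exact: mg.
  - by rewrite inE.
  - by move=> t [].
have -> : \int[mu]_(t in A) (l (g t) : R) = fine (\int[mu]_(t in A)
    (\sum_(y <- undup s) ((l y : R)%:E * (\1_(g @^-1` [set y]) t)%:E))%E)%E.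
  congr fine; apply: eq_integral => t _.
  rewrite (bigD1_seq (g t))//= big1 => [|y yg]; last first.
    by rewrite indicE memNset ?mule0//= => gy; rewrite gy eqxx in yg.
  by rewrite indicE mem_set// mule1 adde0.
rewrite integral_sum//; last by move=> y; exact: integrableZl.
have -> : (\sum_(y <- undup s) \int[mu]_(t in A) ((l y : R)%:E * (\1_(g @^-1` [set y]) t)%:E) =
   \sum_(y <- undup s) (fine (mu (A `&` g @^-1` [set y])) * (l y : R))%:E)%E.
  apply: eq_bigr => y _; have mgy : measurable (g @^-1` [set y]) by exact: mg.
  rewrite integralZl// integral_indic//.
  rewrite EFinM fineK 1?[in RHS]muleC 1?[in RHS]setIC// ge0_fin_numE//.
  apply: le_lt_trans A1; apply: le_measure.
  - by rewrite inE; apply: measurableI.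
  - by rewrite inE.
  - by move=> t [].
by rewrite sumEFin.
Qed.

Section Cut.
Variables (D A : set R).
Hypotheses (mD : measurable D) (mA : measurable A) (AD : A `<=` D).
Hypothesis Dfin : (mu D < +oo)%E.

(** Extension by zero: integrals over the varying intervals [[0, t]] become integrals over one
    domain and can be subtracted. *)
Definition cut f := fun s => if s \in A then f s else 0.

Lemma smeas_cut f : smeas f -> smeas (cut f).
Proof. by move=> sf; apply: smeas_if => //; exact: smeas_cst. Qed.

Lemma L1_cut f : L1 D (cut f) = L1 A f.
Proof.
rewrite /L1 -(setIidr AD) integral_mkcondr; apply: eq_integral => s _.
by rewrite patchE /cut; case: ifPn => //; rewrite normr0.
Qed.

Lemma simple_L1_fin g : simple_fun g -> (L1 D g < +oo)%E.
Proof.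
move=> sg; have [/finite_seqP[s gs] _] := sg.
pose M := \sum_(y <- s) `|y|.
have gM t : `|g t| <= M.
  have : g t \in s by have : range g (g t) by []; rewrite gs.
  move=> gts; rewrite /M (big_rem _ gts)/= lerDl; exact: sumr_ge0.
apply: (@le_lt_trans _ _ (L1 D (fun=> M : R^o))).
  apply: le_L1 => //; [exact: simple_smeas|exact: smeas_cst|].
  by apply: aeW => t _ /=; rewrite (le_trans (gM t))// ler_norm.
by rewrite /L1 integral_cst//; exact: lte_mul_pinfty.
Qed.

Lemma simple_bint g : simple_fun g -> bint D (cut g) (simple_integral A g).
Proof.
move=> sg; have sgs := simple_smeas sg; split; first exact: smeas_cut.
  apply: le_lt_trans (simple_L1_fin sg); apply: le_L1 => //; first exact: smeas_cut.
  by apply: aeW => t _; rewrite /cut; case: ifPn => //; rewrite normr0.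
move=> l; rewrite simple_integral_dual//; last first.
  by apply: le_lt_trans Dfin; apply: le_measure; rewrite ?inE.
rewrite -[in LHS](setIidr AD) Rintegral_mkcondr; apply: eq_Rintegral => s _.
by rewrite patchE /cut; case: ifPn => // _; rewrite blin0.
Qed.

End Cut.

Section Exists.
Variables (D : set R) (mD : measurable D) (Dfin : (mu D < +oo)%E).

Lemma simple_bint_full g : simple_fun g -> bint D g (simple_integral D g).
Proof.
move=> sg; apply: bint_ae (simple_bint mD mD (fun s h => h) Dfin sg) _ _ => //.
  exact: simple_smeas.
by apply: aeW => s Ds; rewrite /cut mem_set.
Qed.

Lemma approx_L1 f : smeas f -> (L1 D f < +oo)%E -> exists g : nat -> R -> E,
  [/\ forall n, simple_fun (g n), forall t, g n t @[n --> \oo] --> f t &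
    (L1 D (fun s => f s - g n s)%R @[n --> \oo] --> 0)%E].
Proof.
move=> sf f1; have [g [sg gf fg]] := smeas_approx sf; exists g; split => //.
have ig : mu.-integrable D (EFin \o (fun s => `|f s|)).
  apply: (L1_integrable (smeas_normr sf)); apply: le_lt_trans f1.
  by apply: le_L1 => //; [exact: smeas_normr|apply: aeW => s _; rewrite normr_id].
apply: (L1_dct mD _ sf ig).
- by move=> n; exact: simple_smeas.
- by apply: aeW => s _; exact: gf.
- by apply: aeW => s n _; exact: fg.
Qed.

Lemma bint_exists f : smeas f -> (L1 D f < +oo)%E -> exists v, bint D f v.
Proof.
move=> sf f1; have [g [sg gf fg]] := approx_L1 sf f1.
pose v n := simple_integral D (g n).
have bv n : bint D (g n) (v n) by exact: simple_bint_full.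
have cvv : cvgn v.
  apply: cauchy_cvgn => e e0; have e2 : 0 < e / 2 by rewrite divr_gt0.
  move/fine_cvgP : (fg) => [[N1 _ h1] /cvgrPdist_lt/(_ _ e2)[N2 _ h2]].
  have h n : (maxn N1 N2 <= n)%N -> (L1 D (fun s => f s - g n s)%R < (e / 2)%:E)%E.
    move=> nN; have n1 : (N1 <= n)%N by apply: leq_trans nN; exact: leq_maxl.
    have n2 : (N2 <= n)%N by apply: leq_trans nN; exact: leq_maxr.
    have /= := h2 n n2; rewrite sub0r normrN => h3.
    rewrite -(fineK (h1 n n1)) lte_fin; apply: le_lt_trans h3; exact: ler_norm.
  exists (maxn N1 N2) => n m nN mN; rewrite -lte_fin.
  apply: le_lt_trans (bint_dist mD (bv n) (bv m)) _.
  have sB k : smeas (fun s => f s - g k s) by apply: smeasB => //; exact: simple_smeas.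
  apply: (@le_lt_trans _ _ (L1 D (fun s => (f s - g m s) - (f s - g n s))%R)).
    apply: le_L1 => //; [|exact: smeasB|].
      by apply: smeasB; exact: simple_smeas.
    apply: aeW => s _; rewrite (_ : f s - g m s - (f s - g n s) = g n s - g m s)//.
    by rewrite opprB addrC addrA subrK.
  apply: le_lt_trans (L1B mD (sB m) (sB n)) _.
  by rewrite [e]splitr EFinD lteD// h.
exists (limn v); exact: (bint_lim mD bv sf f1 fg cvv).
Qed.

End Exists.

End SimpleIntegral.

(** * Comparison with the Bochner integral *)

Section BochnerPettis.
Context {R : realType} {E : completeNormedModType R}.
Local Notation mu := (@lebesgue_measure R).
Variables (D A : set R).
Hypotheses (mD : measurable D) (mA : measurable A) (AD : A `<=` D).
Hypothesis Dfin : (mu D < +oo)%E.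
Variables (f f' : R -> E) (v : E).
Hypotheses (sf : smeas f') (ff : \forall s \ae mu, A s -> f s = f' s).

(** f is controlled only up to a null set, so it is replaced by its representative through
    [ge0_integral_ae_eq], which holds for arbitrary nonnegative functions. *)
Let dist_cut (g : R -> E) : simple_fun g ->
  (\int[mu]_(t in A) (`|f t - g t|%:E))%E =
  L1 D (fun s => cut A f' s - cut A g s).
Proof.
move=> sg; rewrite (@ge0_integral_ae_eq _ _ _ (fun t => (`|f' t - g t|)%:E)).
- rewrite -[LHS](L1_cut AD) /L1; apply: eq_integral => s _.
  by rewrite /cut; case: ifPn => // _; rewrite subrr.
- by move=> s; rewrite lee_fin.
- by move=> s; rewrite lee_fin.
- by apply: ae_imp ff => s h /h ->.
Qed.

Lemma bochner_bint : bochner_integral A f v -> bint D (cut A f') v.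
Proof.
move=> [g [sg gf fg gv]].
have bg n : bint D (cut A (g n)) (simple_integral A (g n)) by exact: simple_bint.
have fc : (L1 D (fun s => cut A f' s - cut A (g n) s)%R @[n --> \oo] --> 0)%E.
  by move: fg; under eq_fun do rewrite dist_cut//.
have sc : smeas (cut A f') by exact: smeas_cut.
have scg n : smeas (cut A (g n)) by apply: smeas_cut => //; exact: simple_smeas.
apply: (bint_lim mD bg sc _ fc gv).
move/fine_cvgP : fc => [[N _ /(_ N (leqnn N)) h] _].
apply: (@le_lt_trans _ _ (L1 D (fun s => (cut A f' s - cut A (g N) s) + cut A (g N) s)%R)).
  apply: le_L1 => //; first by apply: smeasD => //; exact: smeasB.
  by apply: aeW => s _; rewrite subrK.
apply: le_lt_trans (L1D mD (smeasB sc (scg N)) (scg N)) _.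
have [_ g1 _] := bg N.
by apply: lte_add_pinfty => //; rewrite -ge0_fin_numE// L1_ge0.
Qed.

Lemma bint_bochner : bint D (cut A f') v -> bochner_integral A f v.
Proof.
move=> bf; have [sc c1 _] := bf; have [g [sg gf fg]] := approx_L1 mD sc c1.
have bg n : bint D (cut A (g n)) (simple_integral A (g n)) by exact: simple_bint.
have scg n : smeas (cut A (g n)) by apply: smeas_cut => //; exact: simple_smeas.
have fc : (L1 D (fun s => cut A f' s - cut A (g n) s)%R @[n --> \oo] --> 0)%E.
  apply: (squeeze_cvge _ (cvg_cst _) fg); apply: nearW => n; rewrite L1_ge0/=.
  apply: le_L1 => //; [exact: smeasB|by apply: smeasB => //; exact: simple_smeas|].
  by apply: aeW => s _; rewrite /cut; case: ifPn => // _; rewrite subrr normr0.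
exists g; split => //.
- by apply: ae_imp ff => s h As; rewrite (h As); have := gf s; rewrite /cut mem_set.
- by under eq_fun do rewrite dist_cut//.
- apply/cvgrPdist_lt => e e0.
  move/fine_cvgP : fc => [[N1 _ h1] /cvgrPdist_lt/(_ _ e0)[N2 _ h2]].
  exists (maxn N1 N2) => // n /= nN.
  have n1 : (N1 <= n)%N by apply: leq_trans nN; exact: leq_maxl.
  have n2 : (N2 <= n)%N by apply: leq_trans nN; exact: leq_maxr.
  have /= := h2 n n2; rewrite sub0r normrN => h3.
  rewrite -lte_fin; apply: le_lt_trans (bint_dist mD bf (bg n)) _.
  rewrite -(fineK (h1 n n1)) lte_fin; apply: le_lt_trans h3; exact: ler_norm.
Qed.

End BochnerPettis.

(** * Measures of noncompactness under the integral *)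

Section ConvexHull.
Context {R : realType}.

(** As an intersection of convex sets: a property passes to the hull once it is shown to define a
    convex set containing A, which is the main way the hull is used. *)
Definition hull (V : lmodType R) (A : set V) : set V :=
  [set x | forall C : set V, convex_set C -> A `<=` C -> C x].

Lemma hull_min (V : lmodType R) (A C : set V) :
  convex_set C -> A `<=` C -> hull A `<=` C.
Proof. by move=> cC AC x; exact. Qed.

Lemma sub_hull (V : lmodType R) (A : set V) : A `<=` hull A.
Proof. by move=> x Ax C _; exact. Qed.

Lemma hull_convex (V : lmodType R) (A : set V) : convex_set (hull A).
Proof.
move=> x y t /set_mem Ax /set_mem Ay; apply/mem_set => C cC AC; apply/set_mem.
by apply: (cC); apply/mem_set; [apply: Ax|apply: Ay].
Qed.

Lemma hullS (V : lmodType R) (A B : set V) : A `<=` B -> hull A `<=` hull B.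
Proof. by move=> AB x Ax C cC BC; apply: Ax => // y /AB; exact: BC. Qed.

Lemma hull_id (V : lmodType R) (A : set V) : convex_set A -> hull A = A.
Proof.
by move=> cA; apply/seteqP; split; [exact: hull_min|exact: sub_hull].
Qed.

(** Points of weight 0 are unrestricted, as happens with partitions of unity. The induction runs
    over arbitrary positive total weights s, normalized by [s^-1]. *)
Lemma hull_sum (V : lmodType R) (A : set V) (I : eqType) (r : seq I) (a : I -> R)
    (x : I -> V) : (forall i, 0 <= a i) -> \sum_(i <- r) a i = 1 ->
  (forall i, 0 < a i -> hull A (x i)) -> hull A (\sum_(i <- r) a i *: x i).
Proof.
move=> a0 a1 ax.
suff : forall s : R, 0 < s -> \sum_(i <- r) a i = s ->
    hull A (s^-1 *: \sum_(i <- r) a i *: x i).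
  by move=> /(_ 1 ltr01 a1); rewrite invr1 scale1r.
elim: r {a1} => [|i r IH] s s0; first by rewrite big_nil => s00; rewrite s00 ltxx in s0.
rewrite !big_cons => as_.
have r0 : 0 <= \sum_(j <- r) a j by apply: sumr_ge0.
have [ai0|ai0] := eqVneq (a i) 0.
  by rewrite ai0 scale0r add0r; apply: IH => //; rewrite -as_ ai0 add0r.
have aip : 0 < a i by rewrite lt_neqAle eq_sym ai0 a0.
have [sr|sr] := eqVneq (\sum_(j <- r) a j) 0.
  have ais : a i = s by rewrite -as_ sr addr0.
  rewrite big1_seq ?addr0 ?scalerA ?ais ?mulVf ?gt_eqF// ?scale1r; first exact: ax.
  move=> j /= jr; have : a j = 0; last by move=> ->; rewrite scale0r.
  have := sr => /eqP; rewrite psumr_eq0// => /allP/(_ _ jr)/=.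
  by move=> /eqP.
have srp : 0 < \sum_(j <- r) a j by rewrite lt_neqAle eq_sym sr.
have -> : s^-1 *: (a i *: x i + \sum_(j <- r) a j *: x j) =
    (a i / s) *: x i + (1 - a i / s) *:
      ((\sum_(j <- r) a j)^-1 *: \sum_(j <- r) a j *: x j).
  rewrite scalerDr !scalerA [s^-1 * _]mulrC; congr (_ + _ *: _).
  have -> : 1 - a i / s = (\sum_(j <- r) a j) / s.
    by rewrite -{1}(@divff _ s) ?gt_eqF// -mulrBl -{1}as_ addrC addKr.
  by rewrite mulrAC divff// mul1r.
apply: convex_setE; [exact: hull_convex|exact: ax|exact: IH| |].
  by rewrite divr_ge0// ltW.
by rewrite ler_pdivrMr// mul1r -as_ lerDl.
Qed.

End ConvexHull.

Section Box.
Context {R : realType} {W : normedModType R}.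
Implicit Types (A B : set W) (s : seq W) (c e : R).

(** Combinations of s with coefficients in [[0, c]]. For c = 1 this is a convex totally bounded set
    containing s; for c the measure of D it contains the integrals of functions with values in s or
    0. *)
Fixpoint box c s : set W := if s is y :: s' then
  [set x | exists a z, [/\ 0 <= a, a <= c, box c s' z & x = a *: y + z]] else [set 0].

Lemma box0 c s : 0 <= c -> box c s 0.
Proof.
move=> c0; elim: s => //= y s IH; exists 0, 0.
by split=> //; rewrite scale0r addr0.
Qed.

Lemma mem_box c s y : 1 <= c -> y \in s -> box c s y.
Proof.
move=> c1; have c0 : 0 <= c by apply: le_trans c1.
elim: s => //= z s IH; rewrite inE => /predU1P[->|/IH ys].
  by exists 1, 0; split=> //; [exact: box0|rewrite scale1r addr0].
by exists 0, y; split=> //; rewrite scale0r add0r.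
Qed.

Lemma box_convex c s : convex_set (box c s).
Proof.
elim: s => [|y s IH] /=; first exact: convex_set1.
apply: convex_setP => _ _ t /= [a [z [a0 ac bz ->]]] [b [u [b0 bc bu ->]]] t0 t1.
have t1' : 0 <= 1 - t by rewrite subr_ge0.
exists (t * a + (1 - t) * b), (t *: z + (1 - t) *: u); split.
- by rewrite addr_ge0// mulr_ge0.
- have := ler_wpM2l t0 ac; have := ler_wpM2l t1' bc; lra.
- exact: convex_setE.
- by rewrite !scalerDr (scalerDl y (t * a)) !scalerA addrACA.
Qed.

Lemma box_tbd c s : tbd (box c s).
Proof.
elim: s => [|y s IH] e e0 /=.
  by exists [:: 0] => x /= ->; exists 0; rewrite ?mem_head// subrr normr0.
have e2 : 0 < e / 2 by rewrite divr_gt0.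
have [s' hs'] := IH _ e2.
have d0 : 0 < e / 2 / (`|y| + 1) by rewrite divr_gt0// ltr_wpDl.
have [r hr] := compact_tbd (@segment_compact R 0 c : compact (_ : set R^o)) d0.
exists [seq a *: y + z | a <- r, z <- s'] => x [a [z [a0 ac bz ->]]].
have [|b br ab] := hr a; first by rewrite /= in_itv/= a0.
have [z' z's zz'] := hs' z bz; exists (b *: y + z'); first exact: allpairs_f.
rewrite opprD addrACA -scalerBl (le_lt_trans (ler_normD _ _))// [e]splitr ler_ltD//.
rewrite normrZ (@le_trans _ _ (`|a - b| * (`|y| + 1)))// ?ler_wpM2l ?lerDl//.
by rewrite -ler_pdivlMr ?ltr_wpDl// ltW.
Qed.

(** The e-neighbourhood of [box 1 s] is convex and contains A, hence also its hull; a d-net of the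
    box then gives the centres. Passing to hulls thus costs an arbitrarily small radius. *)
Lemma fcov_hull e d A : fcov e A -> 0 < d -> fcov (e + d) (hull A).
Proof.
move=> [s sA] d0; pose C := [set x : W | exists2 b, box 1 s b & `|x - b| < e].
have cC : convex_set C.
  apply: convex_setP => x y t [b sb xb] [b' sb' yb'] t0 t1.
  have t1' : 0 <= 1 - t by rewrite subr_ge0.
  exists (t *: b + (1 - t) *: b'); first by apply: convex_setE => //; exact: box_convex.
  rewrite opprD addrACA -!scalerBr (le_lt_trans (ler_normD _ _))// !normrZ.
  rewrite (ger0_norm t0) (ger0_norm t1').
  have [->|tp] := eqVneq t 0; first by rewrite mul0r add0r subr0 mul1r.
  have t0' : 0 < t by rewrite lt_neqAle eq_sym tp.
  have h1 : t * `|x - b| < t * e by rewrite ltr_pM2l.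
  have h2 := ler_wpM2l t1' (ltW yb').
  lra.
have AC : A `<=` C.
  by move=> x /sA[c cs xc]; exists c => //; exact: mem_box.
have [r hr] := box_tbd 1 s d0.
exists r => x /(_ C cC AC)[b sb xb]; have [z zr bz] := hr b sb; exists z => //.
by rewrite -(subrK b x) -addrA (le_lt_trans (ler_normD _ _))// ltrD.
Qed.

End Box.

Section IntegralNoncompactness.
Context {R : realType} {E : completeNormedModType R}.
Local Notation mu := (@lebesgue_measure R).
Variables (D : set R) (mD : measurable D) (Dfin : (mu D < +oo)%E).

Lemma bint_indicator (B : set R) (y : E) : measurable B ->
  bint D (fun t => if t \in B then y else 0) (fine (mu (D `&` B)) *: y).
Proof.
move=> mB; have sB : smeas (fun t => if t \in B then y else 0).
  by apply: smeas_if => //; exact: smeas_cst.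
split=> //.
  apply: (@le_lt_trans _ _ (L1 D (fun=> y))).
    apply: le_L1 => //; first exact: smeas_cst.
    by apply: aeW => t _; case: ifPn => //; rewrite normr0.
  by rewrite /L1 integral_cst//; exact: lte_mul_pinfty.
move=> l; rewrite blinZ.
have -> : \int[mu]_(t in D) (l (if t \in B then y else 0) : R) =
    \int[mu]_(t in D) ((fun=> (l y : R)) \_ B) t.
  by apply: eq_Rintegral => t _; rewrite patchE; case: ifPn => //; rewrite blin0.
rewrite -Rintegral_mkcondr Rintegral_cst; last exact: measurableI.
by rewrite mulrC.
Qed.

Lemma bint0 : bint D (fun=> 0 : E) 0.
Proof.
by have := bint_indicator 0 measurable0; rewrite scaler0 (_ : (fun _ => _) = fun=> 0)//;
  apply/funext => t; case: ifPn.
Qed.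

Lemma bint_finite_range (u : R -> E) (w : E) (s : seq E) : bint D u w ->
  (forall t, u t = 0 \/ u t \in s) -> box (fine (mu D)) s w.
Proof.
elim: s u w => [|y s IH] u w bu us /=.
  apply: (bint_unique mD bu bint0); apply: aeW => t _.
  by have [] := us t.
pose B := u @^-1` [set y].
have [su u1 _] := bu.
have mB : measurable B.
  rewrite -[X in measurable X]setCK; apply: measurableC.
  apply: (su.2 (~` [set y])).
  by rewrite openC; apply: compact_closed; [exact: norm_hausdorff|exact: compact_set1].
have bi := bint_indicator y mB; set m := fine _ in bi.
exists m, (w - m *: y); split; last by rewrite addrC subrK.
- exact: fine_ge0.
- apply: fine_le; last by apply: le_measure; rewrite ?inE//; exact: measurableI.
    rewrite ge0_fin_numE//; apply: le_lt_trans Dfin.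
    by apply: le_measure; rewrite ?inE//; exact: measurableI.
  by rewrite ge0_fin_numE.
- apply: (IH _ _ (bintB mD bu bi)) => t; case: ifPn => [/set_mem ->|yt].
    by left; rewrite subrr.
  rewrite subr0; have [->|] := us t; first by left.
  rewrite inE => /predU1P[uty|]; last by right.
  by rewrite (mem_set (uty : B t)) in yt.
Qed.

(* On a large set of s the functions z n are, up to 2 rho, equal to functions
   with values in one finite set, whose integrals are totally bounded. *)
Lemma heinz (z : nat -> R -> E) (v : nat -> E) (G rho : R -> R^o) :
  (forall n, bint D (z n) (v n)) ->
  smeas G -> (L1 D G < +oo)%E ->
  (\forall s \ae mu, D s -> forall n, `|z n s| <= G s) ->
  smeas rho -> (L1 D rho < +oo)%E ->
  (\forall s \ae mu, D s -> 0 <= (rho s : R) /\ forall e, (rho s : R) < e ->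
     fcov e (range (fun n => z n s))) ->
  forall e : R, (2%:E * L1 D rho < e%:E)%E -> fcov e (range v).
Proof.
move=> bz sG G1 zG sr r1 zr e er.
have sz n : smeas (z n) by case: (bz n).
have [y0 hy0] := choice (fun n => (sz n).1).
pose y k := if unpickle k is Some (n, j) then y0 n j else 0.
have hy n t d : 0 < d -> exists j, `|z n t - y j| < d.
  move=> d0; have [j zj] := hy0 n t d d0.
  by exists (pickle (n, j)); rewrite /y pickleK.
pose g K n := nearest y (z n) K.
have sg K n : smeas (g K n) by exact: smeas_nearest.
have gin K n t : g K n t = 0 \/ g K n t \in mkseq y K by exact: nearest_in.
have gz K n t : `|z n t - g K n t| <= `|z n t| by exact: nearest_le.
have gy K j n t : (j < K)%N -> `|z n t - g K n t| <= `|z n t - y j|.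
  exact: nearest_lt.
(* Truncating by [|G|] keeps the supremum over n finite at every t; almost everywhere on D it
   changes nothing. *)
pose h K n t : R := Num.min `|z n t - g K n t| `|G t|.
have hub K t : has_ubound (range (fun n => h K n t)).
  by exists `|G t| => _ [n _ <-]; rewrite /h ge_min lexx orbT.
pose phi K t : R := sups (fun n => h K n t) 0.
have phi_ub K n t : h K n t <= phi K t.
  by apply: ub_le_sup; [exact/has_ubound_sdrop|exists n].
have phi_le K t a : (forall n, h K n t <= a) -> phi K t <= a.
  move=> H; apply: ge_sup; first by exists (h K 0%N t), 0%N.
  by move=> _ [n _ <-].
have sphi K : smeas (phi K : R -> R^o).
  apply: measurable_smeas; apply: measurable_fun_sups => [t _|n]; first exact: hub.
  apply: measurable_minr; apply: smeas_measurable; apply: smeas_normr => //.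
  exact: smeasB.
(* The part of the uniform error exceeding 2 rho: it tends to 0 almost everywhere, dominated by
   [|G|], hence in mean. *)
pose u K t : R := Num.max (phi K t - 2 * rho t) 0.
have su K : smeas (u K : R -> R^o).
  apply: measurable_smeas; apply: measurable_maxr => //.
  apply: (@smeas_measurable R (fun t => phi K t - 2 * rho t)); apply: smeasB => //.
  exact: (@smeasZl R R^o).
have uG : \forall s \ae mu, D s -> forall K, `|0 - u K s : R^o| <= `|G s|.
  apply: ae_imp zr => s H Ds K; have [r0 _] := H Ds.
  rewrite sub0r normrN ger0_norm ?le_max ?lexx ?orbT//.
  rewrite ge_max normr_ge0 andbT lerBlDr.
  apply: (@le_trans _ _ `|G s|); last by rewrite lerDl mulr_ge0.
  by apply: phi_le => n; rewrite /h ge_min lexx orbT.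
have u0 : \forall s \ae mu, D s -> (u K s : R^o) @[K --> \oo] --> (0 : R^o).
  apply: ae_imp zr => s H Ds; have [r0 {}H] := H Ds.
  apply/cvgrPdist_le => /= d d0.
  have d4 : 0 < d / 4 by rewrite divr_gt0.
  (* The factor 2 arises here: the candidates y approximate only points of the ranges, so the
     centres must be moved into the set of values. *)
  have [|l [lz zl]] := @fcov_in _ _ (2 * rho s + d / 2) (range (fun n => z n s)).
    by apply: H; lra.
  have [J0 hJ0] : exists J0, forall c, c \in l -> exists2 j, (j < J0)%N & `|c - y j| < d / 2.
    elim: l lz {zl} => [|c l IH] lz; first by exists 0%N.
    have [|J1 hJ1] := IH; first by move=> x xl; apply: lz; rewrite inE xl orbT.
    have [n _ zc] := lz c (mem_head _ _).
    have d2 : 0 < d / 2 by rewrite divr_gt0.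
    have [j zj] := hy n s _ d2.
    exists (maxn J1 j.+1) => x; rewrite inE => /predU1P[->|/hJ1[i iJ xi]].
      by exists j; rewrite ?leq_max ?ltnSn ?orbT// -zc.
    by exists i => //; rewrite leq_max iJ.
  exists J0 => // K /= JK; rewrite sub0r normrN ger0_norm ?le_max ?lexx ?orbT//.
  rewrite ge_max (ltW d0) andbT lerBlDr; apply: phi_le => n.
  rewrite /h ge_min; apply/orP; left.
  have [|c cl zc] := zl (z n s); first by exists n.
  have [j jJ cj] := hJ0 c cl.
  apply: le_trans (gy K j n s (leq_trans jJ JK)) _.
  rewrite -(subrK c (z n s)) -addrA (le_trans (ler_normD _ _))//; lra.
have iG : mu.-integrable D (EFin \o (fun s => `|G s|)).
  apply: (L1_integrable (smeas_normr sG)); apply: le_lt_trans G1.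
  by apply: le_L1 => //; [exact: smeas_normr|apply: aeW => s _; rewrite normr_id].
have s0 : smeas (fun=> 0 : R^o) by exact: smeas_cst.
have Lu : (L1 D (fun s => 0 - u K s : R^o)%R @[K --> \oo] --> 0)%E.
  apply: (L1_dct mD su s0 iG u0).
  by apply: ae_imp uG => s H n Ds; exact: H.
have [gap gap0 gape] : exists2 gap : R, 0 < gap & (2%:E * L1 D rho + gap%:E < e%:E)%E.
  move: er; rewrite (L1_fin r1) -EFinM lte_fin => er.
  exists ((e - 2 * fine (L1 D rho)) / 2); first by lra.
  by rewrite -EFinD lte_fin; lra.
have [K uK] : exists K, (L1 D (u K : R -> R^o) < gap%:E)%E.
  move/fine_cvgP : Lu => [[N1 _ h1] /cvgrPdist_lt/(_ _ gap0)[N2 _ h2]].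
  exists (maxn N1 N2).
  have /= n1 := h1 _ (leq_maxl N1 N2); have /= := h2 _ (leq_maxr N1 N2).
  rewrite sub0r normrN => h3.
  apply: (@le_lt_trans _ _ (L1 D (fun s => 0 - u (maxn N1 N2) s : R^o))).
    apply: le_L1 => //; first exact: (smeasB s0 (su _)).
    by apply: aeW => s _; rewrite sub0r normrN.
  by rewrite -(fineK n1) lte_fin; apply: le_lt_trans h3; exact: ler_norm.
have Lg n : (L1 D (g K n) < +oo)%E.
  have [_ z1 _] := bz n.
  apply: (@le_lt_trans _ _ (L1 D (fun s => 2 *: z n s))).
    apply: le_L1 => //; first exact: smeasZl.
    apply: aeW => s _; rewrite normrZ ger0_norm//.
    rewrite -(subrK (z n s) (g K n s)) (le_trans (ler_normD _ _))//.
    by have := gz K n s; rewrite distrC; lra.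
  by rewrite L1Z// (L1_fin z1) -EFinM ltry.
have [w bw] := choice (fun n => bint_exists mD Dfin (sg K n) (Lg n)).
have vw n : (`|v n - w n|%:E <= 2%:E * L1 D rho + gap%:E)%E.
  apply: le_trans (bint_dist mD (bz n) (bw n)) _.
  apply: (@le_trans _ _ (L1 D (fun s => (2 *: rho s + u K s) : R^o))); last first.
    apply: le_trans (L1D mD (smeasZl 2 sr) (su K)) _.
    rewrite L1Z// ger0_norm// leeD2l//; exact: ltW.
  apply: le_L1 => //; [exact: smeasB|by apply: smeasD => //; exact: smeasZl|].
  apply: ae_imp (ae_and zG zr) => s [HG Hr] Ds.
  have [r0 _] := Hr Ds; have zn := HG Ds n.
  apply: (@le_trans _ _ (phi K s)); last first.
    apply: le_trans (ler_norm _); rewrite /u.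
    have : phi K s - 2 * rho s <= Num.max (phi K s - 2 * rho s) 0 by rewrite le_max lexx.
    rewrite /GRing.scale /=; lra.
  apply: le_trans (phi_ub K n s); rewrite /h le_min lexx/=.
  by apply: le_trans (gz K n s) _; apply: le_trans zn _; exact: ler_norm.
set b := fine (2%:E * L1 D rho + gap%:E)%E.
have bE : (2%:E * L1 D rho + gap%:E = b%:E)%E.
  by rewrite /b (L1_fin r1) -EFinM -EFinD.
have be : b < e by rewrite -lte_fin -bE.
have eb : 0 < e - b by rewrite subr_gt0.
have [r hr] := box_tbd (fine (mu D)) (mkseq y K) eb.
exists r => _ [n _ <-].
have [c cr wc] := hr (w n) (bint_finite_range (bw n) (gin K n)).
exists c => //; rewrite -(subrK (w n) (v n)) -addrA (le_lt_trans (ler_normD _ _))//.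
have := vw n; rewrite bE lee_fin; lra.
Qed.

End IntegralNoncompactness.

(** * Almost everywhere convergence of convex combinations *)

Section Parallelogram.
Context {R : realType} {V : lmodType R}.

(** As for projections on convex sets: the infima of Q on the sets increase to a finite S, and the
    midpoint of two late near-minimizers has Q above S - e / 2, so the parallelogram law makes Q
    small on half their difference. *)
Lemma parallelogram_cauchy (Q : V -> R) (A : nat -> set V) (B : R) :
  (forall n, convex_set (A n)) -> (forall n, A n !=set0) ->
  (forall n m, (n <= m)%N -> A m `<=` A n) ->
  (forall x, A 0%N x -> 0 <= Q x /\ Q x <= B) ->
  (forall x y, A 0%N x -> A 0%N y ->
    Q (2^-1 *: (x + y)) + Q (2^-1 *: (x - y)) = (Q x + Q y) / 2) ->
  exists z : nat -> V, (forall n, A n (z n)) /\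
    forall e : R, 0 < e -> exists N, forall n m, (N <= n)%N -> (N <= m)%N ->
      Q (2^-1 *: (z n - z m)) < e.
Proof.
move=> cA A0 decA QB QQ.
have A00 n x : A n x -> A 0%N x by apply: decA.
pose a n := inf (Q @` A n).
have hi n : has_inf (Q @` A n).
  split; first by have [x Ax] := A0 n; exists (Q x), x.
  by exists 0 => _ [x /A00/QB[? _] <-].
have ale n x : A n x -> a n <= Q x.
  by move=> Ax; apply: ge_inf; [exact: (hi n).2|exists x].
have aB n : a n <= B.
  by have [x Ax] := A0 n; apply: le_trans (ale n x Ax) _; have [] := QB x (A00 _ _ Ax).
have and_ n m : (n <= m)%N -> a n <= a m.
  move=> nm; apply: lb_le_inf; first exact: (hi m).1.
  by move=> _ [x Ax <-]; apply: ale; exact: decA Ax.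
pose S := sup (range a).
have hS : has_sup (range a).
  by split; [exists (a 0%N), 0%N|exists B => _ [n _ <-]].
have aS n : a n <= S by apply: ub_le_sup; [exact: hS.2|exists n].
have /choice[z hz] : forall n, exists x, A n x /\ Q x < a n + n.+1%:R^-1.
  move=> n; have n0 : 0 < n.+1%:R^-1 :> R by rewrite invr_gt0.
  by have [_ [x Ax <-] h] := inf_adherent n0 (hi n); exists x.
exists z; split=> [n|e e0]; first by have [] := hz n.
have e2 : 0 < e / 2 by rewrite divr_gt0.
have [_ [N1 _ <-] hN1] := sup_adherent e2 hS.
have [N2] := ltr_add_invr (y := 0) e2; rewrite add0r => hN2.
exists (maxn N1 N2) => n m nN mN.
have [An Qn] := hz n; have [Am Qm] := hz m.
have inv k : (maxn N1 N2 <= k)%N -> k.+1%:R^-1 <= N2.+1%:R^-1 :> R.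
  move=> kN; rewrite lef_pV2 ?posrE// ler_nat ltnS.
  by apply: leq_trans kN; exact: leq_maxr.
have n1 : (N1 <= n)%N by apply: leq_trans nN; exact: leq_maxl.
have m1 : (N1 <= m)%N by apply: leq_trans mN; exact: leq_maxl.
have Amid : A N1 (2^-1 *: (z n + z m)).
  have -> : 2^-1 *: (z n + z m) = 2^-1 *: z n + (1 - 2^-1) *: z m.
    by rewrite scalerDr; congr (_ + _ *: _); lra.
  by apply: convex_setE; [by []|exact: decA An|exact: decA Am|lra|lra].
have := QQ _ _ (A00 _ _ An) (A00 _ _ Am).
have := ale _ _ Amid; have := aS n; have := aS m.
have := inv n nN; have := inv m mN; rewrite -/S in hN1 *.
set x1 := Q (2^-1 *: (z n + z m)); set x2 := Q (2^-1 *: (z n - z m)).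
set y1 := n.+1%:R^-1 in Qn *; set y2 := m.+1%:R^-1 in Qm *; set y3 := N2.+1%:R^-1 in hN2 *.
by lra.
Qed.

End Parallelogram.

Section ForwardConvex.
Context {R : realType}.
Local Notation mu := (@lebesgue_measure R).
Variables (D : set R) (mD : measurable D) (Dfin : (mu D < +oo)%E).

Lemma amgm (h a : R) : h * (2 * `|a|) <= h * h + a ^+ 2.
Proof.
have := sqr_ge0 (h - `|a|); rewrite sqrrB real_normK ?num_real// expr2 mulr2n.
by lra.
Qed.

Lemma half_geometric_le n : \sum_(0 <= k < n) (2^-1 : R) ^+ k <= 2.
Proof.
have -> : \sum_(0 <= k < n) (2^-1 : R) ^+ k = 2 - 2 * 2^-1 ^+ n.
  elim: n => [|n IH]; first by rewrite big_nil expr0; lra.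
  by rewrite big_nat_recr//= IH exprS; lra.
by rewrite gerBl mulr_ge0// exprn_ge0.
Qed.

(** By monotone convergence the sum of the series has integral at most 2 b, so it is finite almost
    everywhere. *)
Lemma ae_cvg_series (u : nat -> R -> R^o) (b : R) :
  (forall k, smeas (u k)) -> (forall k s, 0 <= (u k s : R)) ->
  (forall k, (L1 D (u k) <= (2^-1 ^+ k * b)%:E)%E) -> 0 <= b ->
  \forall s \ae mu, D s -> cvgn (series (fun k => u k s : R)).
Proof.
move=> su u0 ub b0.
have mu_ k : measurable_fun D (fun s => (u k s : R)%:E).
  by apply/measurable_EFinP/measurable_funTS; exact: (smeas_measurable (su k)).
have IE k : (\int[mu]_(s in D) (u k s : R)%:E = L1 D (u k))%E.
  by apply: eq_integral => s _; rewrite ger0_norm.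
have int1 : (\int[mu]_(s in D) (\sum_(k <oo) (u k s : R)%:E) <= (2 * b)%:E)%E.
  rewrite (@integral_nneseries _ _ _ mu D mD _ mu_); last by move=> k s _; rewrite lee_fin.
  apply: lime_le.
    by apply: is_cvg_nneseries => k _ _; apply: integral_ge0 => s _; rewrite lee_fin.
  apply: nearW => n; apply: (@le_trans _ _ (\sum_(0 <= k < n) (2^-1 ^+ k * b)%:E)%E).
    by apply: lee_sum => k _; rewrite IE.
  rewrite sumEFin lee_fin -mulr_suml ler_wpM2r//; exact: half_geometric_le.
have ii : mu.-integrable D (fun s => \sum_(k <oo) (u k s : R)%:E)%E.
  apply/integrableP; split.
    apply: (ge0_emeasurable_sum (h := fun k s => (u k s : R)%:E) (P := predT)) => [k s _ _|k _].
      by rewrite lee_fin.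
    exact: mu_.
  apply: le_lt_trans (ltry (2 * b)); apply: le_trans int1.
  rewrite le_eqVlt; apply/orP; left; apply/eqP; apply: eq_integral => s _.
  by rewrite gee0_abs//; apply: nneseries_ge0 => k _ _; rewrite lee_fin.
apply: ae_imp (@integrable_ae _ _ _ mu D mD _ ii) => s H /H{}H.
apply: nondecreasing_is_cvgn.
  by apply/nondecreasing_seqP => n; rewrite /series/= big_nat_recr//= lerDl.
exists (fine (\sum_(k <oo) (u k s : R)%:E)%E) => _ [n _ <-].
rewrite -lee_fin (fineK H) /series/= -sumEFin.
by apply: nneseries_lim_ge => k _ _; rewrite lee_fin.
Qed.

Definition goodfam (a : nat -> R -> R^o) :=
  forall i, smeas (a i) /\ forall s, `|a i s| <= 1.

Definition sqint (a : R -> R^o) : R := \int[mu]_(s in D) ((a s : R) ^+ 2).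

Lemma bounded_integrable (a : R -> R^o) : smeas a -> (forall s, `|a s| <= 1) ->
  mu.-integrable D (fun s => (a s : R)%:E).
Proof.
move=> sa a1; apply: L1_integrable => //; apply: (@le_lt_trans _ _ (L1 D (fun=> 1 : R^o))).
  apply: le_L1 => //; first exact: smeas_cst.
  by apply: aeW => s _; rewrite normr1.
by rewrite /L1 integral_cst//; exact: lte_mul_pinfty.
Qed.

Lemma sq_integrable (a : R -> R^o) : smeas a -> (forall s, `|a s| <= 1) ->
  mu.-integrable D (fun s => ((a s : R) ^+ 2)%:E).
Proof.
move=> sa a1; apply: (@bounded_integrable (fun s => (a s : R) ^+ 2)).
  exact: (@smeasZ R R^o a a).
by move=> s; rewrite normrX exprn_ile1.
Qed.

Lemma sqint_ge0 a : 0 <= sqint a.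
Proof. by apply: Rintegral_ge0 => s _; rewrite sqr_ge0. Qed.

Lemma sqint_le (a : R -> R^o) : smeas a -> (forall s, `|a s| <= 1) ->
  sqint a <= fine (mu D).
Proof.
move=> sa a1; rewrite -[leRHS]mul1r -(@Rintegral_cst _ _ _ mu D mD 1).
apply: le_Rintegral => //; [exact: sq_integrable| |].
- by apply: (@bounded_integrable (fun=> 1)) => [|s]; [exact: smeas_cst|rewrite normr1].
- by move=> s _; rewrite -real_normK ?num_real// exprn_ile1.
Qed.

Lemma sqint_parallelogram (a b : R -> R^o) : smeas a -> (forall s, `|a s| <= 1) ->
  smeas b -> (forall s, `|b s| <= 1) ->
  sqint (fun s => 2^-1 *: (a s + b s)) + sqint (fun s => 2^-1 *: (a s - b s)) =
  (sqint a + sqint b) / 2.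
Proof.
move=> sa a1 sb b1.
have half : `|2^-1 : R| = 2^-1 by rewrite ger0_norm.
have mid1 s : `|2^-1 *: (a s + b s)| <= 1.
  rewrite normrZ half; have := ler_normD (a s) (b s).
  have := a1 s; have := b1 s; lra.
have mid2 s : `|2^-1 *: (a s - b s)| <= 1.
  rewrite normrZ half; have := ler_normB (a s) (b s).
  have := a1 s; have := b1 s; lra.
have s1 : smeas (fun s => 2^-1 *: (a s + b s)) by apply: smeasZl; exact: smeasD.
have s2 : smeas (fun s => 2^-1 *: (a s - b s)) by apply: smeasZl; exact: smeasB.
rewrite /sqint -RintegralD//; [|exact: sq_integrable..].
rewrite -RintegralD//; [|exact: sq_integrable..].
rewrite mulrC -RintegralZl//; last first.
  exact: (@integrableD _ _ _ mu D mD _ _ (sq_integrable sa a1) (sq_integrable sb b1)).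
by apply: eq_Rintegral => s _; rewrite /GRing.scale/=; field.
Qed.

Section Combos.
Variable X : lmodType R.
Variables (lam : nat -> nat -> R -> R^o) (x : nat -> X).
Hypotheses (slam : forall n i, smeas (lam n i)).
Hypothesis lam1 : forall n i s, `|lam n i s| <= 1.
Local Notation W := ((nat -> R -> R^o) * X)%type.

(** Convex combinations are taken in the product, so that whatever is placed in X undergoes the same
    combination as the coefficient functions. *)
Definition tail (n : nat) : set W := hull [set p | exists2 k, (n <= k)%N & p = (lam k, x k)].

Lemma goodfam_convex : convex_set [set p : W | goodfam p.1].
Proof.
apply: convex_setP => p q t /= gp gq t0 t1 i; split=> [|s].
  have [sp _] := gp i; have [sq _] := gq i.
  by apply: smeasD; exact: smeasZl.
have [_ /(_ s) hp] := gp i; have [_ /(_ s) hq] := gq i.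
have t1' : 0 <= 1 - t by rewrite subr_ge0.
apply: (@le_trans _ _ (t * `|p.1 i s| + (1 - t) * `|q.1 i s|)).
  by apply: le_trans (ler_normD _ _) _; rewrite !normrZ (ger0_norm t0) (ger0_norm t1').
have := ler_wpM2l t0 hp; have := ler_wpM2l t1' hq; lra.
Qed.

Lemma tail_good n p : tail n p -> goodfam p.1.
Proof.
move=> /(_ _ goodfam_convex); apply=> _ [k _ ->] i.
by split=> [|s]; [exact: slam|exact: lam1].
Qed.

Let Qn (p : W) n : R := series (fun i => 2^-1 ^+ i * sqint (p.1 i)) n.
Let Q (p : W) : R := limn (Qn p).

Let Qn_nd p : nondecreasing_seq (Qn p).
Proof.
apply/nondecreasing_seqP => n; rewrite /Qn /series/= big_nat_recr//= lerDl.
by rewrite mulr_ge0// ?sqint_ge0// exprn_ge0.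
Qed.

Let Qn_le p n : goodfam p.1 -> Qn p n <= 2 * fine (mu D).
Proof.
move=> gp; rewrite /Qn /series/=.
apply: (@le_trans _ _ (\sum_(0 <= i < n) 2^-1 ^+ i * fine (mu D))).
  apply: ler_sum => i _; rewrite ler_wpM2l ?exprn_ge0//.
  by have [? ?] := gp i; exact: sqint_le.
by rewrite -mulr_suml ler_wpM2r ?fine_ge0// half_geometric_le.
Qed.

Let Qn_cvg p : goodfam p.1 -> Qn p @ \oo --> Q p.
Proof.
move=> gp; apply: nondecreasing_is_cvgn; first exact: Qn_nd.
by exists (2 * fine (mu D)) => _ [n _ <-]; exact: Qn_le.
Qed.

Let Q_ge p i : goodfam p.1 -> 2^-1 ^+ i * sqint (p.1 i) <= Q p.
Proof.
move=> gp; apply: le_trans (nondecreasing_cvgn_le (Qn_nd p) (Qn_cvg gp) i.+1).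
rewrite /Qn /series/= big_nat_recr//= lerDr.
by apply: sumr_ge0 => j _; rewrite mulr_ge0// ?sqint_ge0// exprn_ge0.
Qed.

Let half_good (p q : W) : goodfam p.1 -> goodfam q.1 ->
  goodfam (2^-1 *: (p + q)).1 /\ goodfam (2^-1 *: (p - q)).1.
Proof.
have half : `|2^-1 : R| = 2^-1 by rewrite ger0_norm.
move=> gp gq; split=> i; have [sp p1] := gp i; have [sq q1] := gq i; split.
- change (smeas (fun s => 2^-1 *: (p.1 i s + q.1 i s))).
  by apply: smeasZl; exact: smeasD.
- move=> s; change (`|2^-1 *: (p.1 i s + q.1 i s)| <= 1).
  rewrite normrZ half; have := ler_normD (p.1 i s) (q.1 i s).
  have := p1 s; have := q1 s; lra.
- change (smeas (fun s => 2^-1 *: (p.1 i s - q.1 i s))).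
  by apply: smeasZl; exact: smeasB.
- move=> s; change (`|2^-1 *: (p.1 i s - q.1 i s)| <= 1).
  rewrite normrZ half; have := ler_normB (p.1 i s) (q.1 i s).
  have := p1 s; have := q1 s; lra.
Qed.

Let Q_parallelogram p q : goodfam p.1 -> goodfam q.1 ->
  Q (2^-1 *: (p + q)) + Q (2^-1 *: (p - q)) = (Q p + Q q) / 2.
Proof.
move=> gp gq; have [g1 g2] := half_good gp gq.
have c1 : (fun n => Qn (2^-1 *: (p + q)) n + Qn (2^-1 *: (p - q)) n) @ \oo -->
    Q (2^-1 *: (p + q)) + Q (2^-1 *: (p - q)).
  by apply: cvgD; exact: Qn_cvg.
have c2 : (fun n => (Qn p n + Qn q n) * 2^-1) @ \oo --> (Q p + Q q) / 2.
  by apply: cvgM; [apply: cvgD; exact: Qn_cvg|exact: cvg_cst].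
suff fE : (fun n => Qn (2^-1 *: (p + q)) n + Qn (2^-1 *: (p - q)) n) =
    (fun n => (Qn p n + Qn q n) * 2^-1).
  by rewrite fE in c1; exact: (cvg_unique _ c1 c2).
apply/funext => n; rewrite /Qn /series/= -!big_split/= mulr_suml.
apply: eq_bigr => i _; have [sp p1] := gp i; have [sq q1] := gq i.
have := sqint_parallelogram sp p1 sq q1; rewrite -!mulrDr -mulrA => <-.
by rewrite mulrDr.
Qed.

(* Q is a weighted sum of squared L^2 norms; convex combinations of the tails
   that nearly minimize Q are Cauchy by the parallelogram law. *)
Lemma forward_convex_ae : exists z : nat -> W, (forall n, tail n (z n)) /\
  \forall s \ae mu, D s -> forall i, cvgn (fun n => (z n).1 i s : R^o).
Proof.
have [||||| z0 [z0t z0c]] := @parallelogram_cauchy R W Q tail (2 * fine (mu D)).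
- by move=> n; exact: hull_convex.
- by move=> n; exists (lam n, x n); apply: sub_hull; exists n.
- by move=> n m nm; apply: hullS => _ [k mk ->]; exists k => //; exact: leq_trans mk.
- move=> p /tail_good gp; split.
    apply: le_trans (Q_ge 0 gp); rewrite mulr_ge0 ?sqint_ge0 ?exprn_ge0//.
  by apply: limr_le; [apply: (cvgP _ (Qn_cvg gp))|apply: nearW => n; exact: Qn_le].
- by move=> p q /tail_good gp /tail_good gq; exact: Q_parallelogram.
(* A square of [2^-k] is asked for because [amgm] with weight [2^-k] turns it into a bound of order
   [2^-k] for the mean of the k-th increment. *)
have /choice[N hN] : forall k : nat, exists N, forall n m, (N <= n)%N -> (N <= m)%N ->
    Q (2^-1 *: (z0 n - z0 m)) < 2^-1 ^+ k * 2^-1 ^+ k.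
  by move=> k; apply: z0c; rewrite mulr_gt0 ?exprn_gt0.
pose nn k := (\sum_(j < k.+1) N j + k)%N.
have nnN k : (N k <= nn k)%N by rewrite /nn big_ord_recr/= -addnA addnCA leq_addr.
have nnS k : (nn k <= nn k.+1)%N.
  by rewrite /nn [in leqRHS]big_ord_recr/= leq_add// leq_addr.
exists (fun k => z0 (nn k)); split=> [k|].
  apply: (hullS _ (z0t (nn k))) => _ [j nj ->]; exists j => //.
  by apply: leq_trans nj; rewrite /nn leq_addl.
have gz k : goodfam (z0 (nn k)).1 by exact: tail_good (z0t _).
suff H i : \forall s \ae mu, D s -> cvgn (fun n => (z0 (nn n)).1 i s : R^o).
  by apply: ae_imp (ae_all H) => s h Ds i; exact: h.
pose u k s : R^o := `|(z0 (nn k.+1)).1 i s - (z0 (nn k)).1 i s|.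
have su k : smeas (u k).
  apply: smeas_normr; apply: smeasB.
    by have [] := gz k.+1 i.
  by have [] := gz k i.
have c0 : 0 <= fine (mu D) by exact: fine_ge0.
have ub k : (L1 D (u k) <= (2^-1 ^+ k * (fine (mu D) + 2 ^+ i))%:E)%E.
  pose dl s : R^o := (2^-1 *: (z0 (nn k.+1) - z0 (nn k))).1 i s.
  have [_ /(_ i)[sdl dl1]] := half_good (gz k.+1) (gz k).
  have Qd : 2^-1 ^+ i * sqint dl <= 2^-1 ^+ k * 2^-1 ^+ k.
    apply: ltW; apply: le_lt_trans (hN k _ _ (leq_trans (nnN k) (nnS k)) (nnN k)).
    by have [_ g2] := half_good (gz k.+1) (gz k); exact: (Q_ge i g2).
  have h0 : 0 < 2^-1 ^+ k :> R by rewrite exprn_gt0.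
  have uE s : u k s = 2 * `|dl s|.
    rewrite /dl; change (u k s = 2 * `|2^-1 *: ((z0 (nn k.+1)).1 i s - (z0 (nn k)).1 i s)|).
    by rewrite normrZ ger0_norm// mulrA divff// mul1r.
  set h := 2^-1 ^+ k in Qd h0 *.
  have hV : 0 < h^-1 by rewrite invr_gt0.
  (* With weight h = [2^-k], twice [|dl|] is at most h + dl^2 / h; the last term integrates to at
     most 2^i h, since the squared norm of dl is at most 2^i h^2. The increments are therefore
     summable. *)
  pose v s : R^o := h + h^-1 * (dl s : R) ^+ 2.
  have uv s : u k s <= v s.
    rewrite uE /v -(ler_pM2l h0) mulrDr mulVKf ?gt_eqF//.
    exact: amgm.
  have v0 s : 0 <= v s by apply: le_trans (uv s); rewrite normr_ge0.
  have iq := sq_integrable sdl dl1.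
  have iq' : mu.-integrable D (fun s => (h^-1 * (dl s : R) ^+ 2)%:E).
    rewrite (_ : (fun _ => _) = (fun s => (h^-1)%:E * ((dl s : R) ^+ 2)%:E)%E)//.
    exact: integrableZl.
  have ic : mu.-integrable D (fun=> h%:E).
    apply: (L1_integrable (smeas_cst (h : R^o))).
    by rewrite /L1 integral_cst//; exact: lte_mul_pinfty.
  have sv : smeas v.
    apply: (smeasD (smeas_cst (h : R^o))).
    exact: (@smeasZl R R^o h^-1 _ (@smeasZ R R^o dl dl sdl sdl)).
  have iv := @integrableD _ _ _ mu D mD _ _ ic iq'.
  have L1v : L1 D v = (\int[mu]_(s in D) (h + h^-1 * (dl s : R) ^+ 2))%:E.
    rewrite /Rintegral fineK; last exact: (@integrable_fin_num _ _ _ mu D mD _ iv).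
    by apply: eq_integral => s _; rewrite ger0_norm ?v0.
  apply: (@le_trans _ _ (L1 D v)).
    apply: le_L1 => //; apply: aeW => s _.
    have us : `|u k s| = u k s by exact: normr_id.
    by rewrite us; apply: le_trans (uv s) (ler_norm _).
  rewrite L1v lee_fin RintegralD// RintegralZl// Rintegral_cst// -/(sqint dl).
  have i0 : 0 < 2 ^+ i :> R by rewrite exprn_gt0.
  have : sqint dl <= 2 ^+ i * (h * h) by rewrite -ler_pdivrMl// -exprVn.
  move=> /(ler_wpM2l (ltW hV)); rewrite [h^-1 * (_ * _)]mulrCA mulKf ?gt_eqF//.
  by rewrite mulrDr [h * _ ^+ i]mulrC; lra.
have := ae_cvg_series su _ ub _ => /(_ (fun k s => normr_ge0 _)).
rewrite addr_ge0// ?exprn_ge0// => /(_ isT); apply: ae_imp => s H Ds.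
pose y n : R^o := (z0 (nn n)).1 i s.
have : cvgn (series (telescope y)).
  by apply: normed_cvg; have := H Ds; congr (cvgn _).
rewrite telescopeK => cy; rewrite (_ : (fun n => _) = (fun n => (y n - y 0%N) + y 0%N)).
  by apply: is_cvgD => //; exact: is_cvg_cst.
by apply/funext => n; rewrite subrK.
Qed.

End Combos.

End ForwardConvex.

Section ForwardConvexVector.
Context {R : realType} {E : completeNormedModType R}.
Local Notation mu := (@lebesgue_measure R).
Variables (D : set R) (mD : measurable D) (Dfin : (mu D < +oo)%E).
Variable X : lmodType R.
Variables (w : nat -> R -> E) (x : nat -> X).
Hypothesis sw : forall n, smeas (w n).
Hypothesis tw : \forall s \ae mu, D s -> tbd (range (fun n => w n s)).

(** Reduction to scalar coefficients: the function of index (m, j) in [lam n] is the indicator of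
    the set where y j is the first point within 1/(m+1) of w n. At almost every s of D finitely many
    j suffice for all n, so w n s is that close to a finite combination of the y j with these
    coefficients; the estimate survives convex combinations, and the coefficients converge. *)
Lemma forward_convex_vector : exists (z : nat -> (R -> E) * X) (u : R -> E),
  [/\ forall n, hull [set p | exists2 k, (n <= k)%N & p = (w k, x k)] (z n),
      smeas u & \forall s \ae mu, D s -> (z n).1 s @[n --> \oo] --> u s].
Proof.
have [y0 hy0] := choice (fun n => (sw n).1).
pose y k := if unpickle k is Some (n, j) then y0 n j else 0.
have hy n t d : 0 < d -> exists j, `|w n t - y j| < d.
  move=> d0; have [j zj] := hy0 n t d d0.
  by exists (pickle (n, j)); rewrite /y pickleK.
pose S n m j := w n @^-1` ball (y j) (m.+1%:R^-1 : R).
have mS n m j : measurable (S n m j).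
  by apply: (sw n).2; apply: ball_open; rewrite invr_gt0.
pose A n m j := seqDU (S n m) j.
have mA n m j : measurable (A n m j).
  apply: measurableD; first exact: mS.
  by apply: bigsetU_measurable => i _; exact: mS.
pose lam n i s : R^o := if unpickle i is Some (m, j) then
  (if s \in A n m j then 1 else 0) else 0.
have slam n i : smeas (lam n i).
  rewrite /lam; case: (unpickle i) => [[m j]|]; last exact: smeas_cst.
  by apply: smeas_if; [exact: mA|exact: smeas_cst..].
have lam1 n i s : `|lam n i s| <= 1.
  rewrite /lam; case: (unpickle i) => [[m j]|]; last by rewrite normr0.
  by case: ifPn; rewrite ?normr1 ?normr0.
have [z [zt zc]] := forward_convex_ae mD Dfin (fun n => (w n, x n)) slam lam1.
have zh n : hull [set p | exists2 k, (n <= k)%N & p = (w k, x k)] (z n).2.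
  have := zt n [set p | hull [set p | exists2 k, (n <= k)%N & p = (w k, x k)] p.2].
  apply; last by move=> _ [k nk ->]; apply: sub_hull; exists k.
  apply: convex_setP => p q t hp hq t0 t1.
  exact: (convex_setE (@hull_convex R _ _) hp hq t0 t1).
have sz n : smeas (z n).2.1.
  have := zh n [set p | smeas p.1]; apply; last by move=> _ [k _ ->]; exact: sw.
  apply: convex_setP => p q t hp hq t0 t1.
  change (smeas (fun s => t *: p.1 s + (1 - t) *: q.1 s)).
  by apply: smeasD; exact: smeasZl.
have cz : \forall s \ae mu, D s -> cvgn (fun n => (z n).2.1 s).
  apply: ae_imp (ae_and tw zc) => s [ts cs] Ds.
  have {}ts := ts Ds; have {}cs := cs Ds.
  apply: cauchy_cvgn => e e0.
  have e4 : 0 < e / 4 by rewrite divr_gt0.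
  have [m] := ltr_add_invr (y := 0) e4; rewrite add0r => me.
  have m0 : 0 < m.+1%:R^-1 :> R by rewrite invr_gt0.
  have m2 : 0 < m.+1%:R^-1 / 2 :> R by rewrite divr_gt0.
  have [l [lw wl]] := tbd_in ts m2.
  have [J hJ] : exists J, forall c, c \in l -> exists2 j, (j < J)%N &
      `|c - y j| < m.+1%:R^-1 / 2.
    elim: l lw {wl} => [|c l IH] lw; first by exists 0%N.
    have [|J1 hJ1] := IH; first by move=> b bl; apply: lw; rewrite inE bl orbT.
    have [n _ zc'] := lw c (mem_head _ _).
    have [j zj] := hy n s _ m2.
    exists (maxn J1 j.+1) => b; rewrite inE => /predU1P[->|/hJ1[i iJ bi]].
      by exists j; rewrite ?leq_max ?ltnSn ?orbT// -zc'.
    by exists i => //; rewrite leq_max iJ.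
  have SJ n : exists2 j, (j < J)%N & S n m j s.
    have [|c cl wc] := wl (w n s); first by exists n.
    have [j jJ cj] := hJ c cl; exists j => //.
    rewrite /S /= -ball_normE /= distrC -(subrK c (w n s)) -addrA.
    by rewrite (le_lt_trans (ler_normD _ _))// [ltRHS]splitr ltrD.
  pose q (a : nat -> R -> R^o) : E := \sum_(j < J) a (pickle (m, j : nat)) s *: y j.
  have wq n : `|w n s - q (lam n)| <= m.+1%:R^-1.
    have [|j0 Sj0 jmin] := @ex_minnP (fun j => `[< S n m j s >]).
      by have [j _ Sj] := SJ n; exists j; apply/asboolP.
    have j0J : (j0 < J)%N.
      by have [j jJ Sj] := SJ n; apply: leq_ltn_trans jJ; apply: jmin; apply/asboolP.
    have lamE j : lam n (pickle (m, j)) s = (j == j0)%:R.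
      rewrite /lam pickleK /A; case: ifPn => [/set_mem[Sj nSj]|nA].
        case: ltngtP => // jj.
          by exfalso; have := jmin j; rewrite asboolT// leqNgt jj => /(_ isT).
        exfalso; apply: nSj; rewrite -bigcup_mkord; exists j0 => //.
        exact/asboolP.
      case: eqVneq => // jj; exfalso; move/negP: nA; apply; apply/mem_set.
      rewrite jj; split; first exact/asboolP.
      rewrite -bigcup_mkord => -[i /= ij Si]; have := jmin i.
      by rewrite asboolT// leqNgt ij => /(_ isT).
    rewrite /q (bigD1 (Ordinal j0J))//= lamE eqxx scale1r big1 ?addr0.
      by move/asboolP : Sj0; rewrite /S /= -ball_normE /= distrC => /ltW.
    by move=> j jj0; rewrite lamE (_ : _ == _ = false) ?scale0r//; apply: negbTE.
  have zq n : `|(z n).2.1 s - q (z n).1| <= m.+1%:R^-1.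
    have := zt n [set p | `|p.2.1 s - q p.1| <= m.+1%:R^-1].
    apply; last by move=> _ [k _ ->]; exact: wq.
    apply: convex_setP => p p' t hp hp' t0 t1.
    have t1' : 0 <= 1 - t by rewrite subr_ge0.
    have qE : q (t *: p + (1 - t) *: p').1 = t *: q p.1 + (1 - t) *: q p'.1.
      rewrite /q !scaler_sumr -big_split/=; apply: eq_bigr => j _.
      by rewrite !scalerA -scalerDl.
    change (`|(t *: p.2.1 s + (1 - t) *: p'.2.1 s) - q (t *: p + (1 - t) *: p').1|
      <= m.+1%:R^-1).
    rewrite qE opprD addrACA -!scalerBr (le_trans (ler_normD _ _))// !normrZ.
    rewrite (ger0_norm t0) (ger0_norm t1').
    have h1 : t * `|p.2.1 s - q p.1| <= t * m.+1%:R^-1 := ler_wpM2l t0 hp.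
    have h2 : (1 - t) * `|p'.2.1 s - q p'.1| <= (1 - t) * m.+1%:R^-1 := ler_wpM2l t1' hp'.
    by move: h1 h2; set r := m.+1%:R^-1; move: r => r h1 h2; lra.
  have cq : cvgn (fun n => q (z n).1).
    rewrite /q; elim: (J) => [|K IH].
      by under eq_fun do rewrite big_ord0; exact: is_cvg_cst.
    under eq_fun do rewrite big_ord_recr/=; apply: is_cvgD => //.
    by apply: is_cvgZr_tmp; exact: cs.
  have e8 : 0 < e / 8 by rewrite divr_gt0.
  have /cvgrPdist_lt/(_ _ e4)[N _ hN] := cq.
  exists N => n k nN kN.
  set L := limn _ in hN.
  have h1 : `|q (z n).1 - L| < e / 4 by rewrite distrC; exact: hN.
  have h2 : `|L - q (z k).1| < e / 4 := hN k kN.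
  have h3 := zq n; have h4 : `|q (z k).1 - (z k).2.1 s| <= m.+1%:R^-1.
    by rewrite distrC; exact: zq.
  have -> : (z n).2.1 s - (z k).2.1 s = ((z n).2.1 s - q (z n).1) +
     (q (z n).1 - L) + (L - q (z k).1) + (q (z k).1 - (z k).2.1 s).
    by rewrite !addrA !subrK.
  apply: le_lt_trans (ler_normD _ _) _.
  apply: (@le_lt_trans _ _ (m.+1%:R^-1 + `|q (z n).1 - L| + `|L - q (z k).1| + m.+1%:R^-1)).
    apply: lerD => //; apply: le_trans (ler_normD _ _) _; apply: lerD => //.
    by apply: le_trans (ler_normD _ _) _; apply: lerD.
  move: h1 h2 me; set r := m.+1%:R^-1; move: r => r; lra.
have [N [mN N0 cN]] := cz.
pose u s := limn (fun n => if s \in D `\` N then (z n).2.1 s else 0).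
have cu s : (if s \in D `\` N then (z n).2.1 s else 0) @[n --> \oo] --> u s.
  rewrite /u; case: (boolP (s \in D `\` N)) => [/set_mem[Ds Ns]|_]; last exact: is_cvg_cst.
  by move: Ns; apply: contra_notP => h; apply: cN => /= /(_ Ds).
exists (fun n => (z n).2), u; split=> //.
  apply: (@smeas_lim _ _ (fun n s => if s \in D `\` N then (z n).2.1 s else 0)) => // n.
  by apply: smeas_if; [exact: measurableD|exact: sz|exact: smeas_cst].
exists N; split=> // s /= h; apply: contrapT => Ns; apply: h => Ds.
by have := cu s; rewrite mem_set.
Qed.

End ForwardConvexVector.

(** * The Volterra operator *)

Section ContinuousMapSpace.
Context {R : realType} {E : completeNormedModType R} (T : R).
Hypothesis T0 : 0 <= T.
Local Notation C := (cmap T E).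

Lemma tint0 : tint T 0.
Proof. by rewrite /tint /= in_itv/= lexx. Qed.

Lemma tintP s : tint T s <-> 0 <= s /\ s <= T.
Proof. by rewrite /tint /= in_itv/=; split=> [/andP|/andP]. Qed.

(* s viewed as a point of [0, T], with a junk value when s is outside *)
Definition tpt (s : R) : tint T :=
  if pselect (tint T s) is left h then SigSub (mem_set h)
  else SigSub (mem_set tint0).

Lemma tptK s : tint T s -> set_val (tpt s) = s.
Proof. by rewrite /tpt; case: pselect. Qed.

Lemma tval_tpt (t : tint T) s : set_val t = s -> t = tpt s.
Proof.
by move=> ts; apply/val_inj; rewrite -[RHS]/(set_val (tpt s)) tptK// -ts; exact: set_valP.
Qed.

Lemma cmap_le (x : C) t : `|x t| <= `|x|.
Proof. exact: (supnorm_ub (cmap_bounded x)). Qed.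

Lemma cmap_norm_le (x : C) M : 0 <= M -> (forall t, `|x t| <= M) -> `|x| <= M.
Proof. by move=> M0 xM; apply: supnorm_le. Qed.

Lemma cmapD (x y : C) t : (x + y) t = x t + y t. Proof. by []. Qed.
Lemma cmapB (x y : C) t : (x - y) t = x t - y t. Proof. by []. Qed.
Lemma cmapZ a (x : C) t : (a *: x) t = a *: x t. Proof. by []. Qed.

Lemma cmap_uc (x : C) (e : R) : 0 < e -> exists2 d : R, 0 < d &
  forall t t' : tint T, `|set_val t - set_val t'| < d -> `|x t - x t'| < e.
Proof.
move=> e0; have /asboolP cx := cmapP x.
have /compact_near_coveringP cS := @segment_compact R 0 T.
pose P (d s : R) := forall t t' : tint T, `|set_val t - s| < d ->
  `|set_val t' - s| < d -> `|x t - x t'| < e.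
have e2 : 0 < e / 2 by rewrite divr_gt0.
have := cS R (0 : R)^'+ P _; case=> [s Ds|d /= d0 dP].
  have /nbhs_ballP[r /= r0 hr] := cx (tpt s) _ (nbhsx_ballx _ _ e2).
  have r20 : 0 < r / 2 by rewrite divr_gt0.
  exists (ball s (r / 2), [set d | 0 < d < r / 2]) => /=.
    split; first exact: nbhsx_ballx.
    apply/nbhs_ballP; exists (r / 2) => //= t; rewrite -ball_normE /= sub0r normrN.
    by move=> tr t0; rewrite t0 (le_lt_trans (ler_norm t)).
  move=> [s' d] /= []; rewrite -ball_normE /= => ss' /andP[_ dr] t t' ts ts'.
  have near_s (u : tint T) : `|set_val u - s'| < d -> `|x (tpt s) - x u| < e / 2.
    move=> us; suff : ball (x (tpt s)) (e / 2) (x u) by rewrite -ball_normE.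
    apply: hr; change (ball (set_val (tpt s)) r (set_val u)).
    rewrite tptK// -ball_normE /= -(subrK s' s) -addrA (le_lt_trans (ler_normD _ _))//.
    by rewrite [r]splitr ltrD// distrC; exact: lt_trans dr.
  rewrite -(subrK (x (tpt s)) (x t)) -addrA (le_lt_trans (ler_normD _ _))//.
  by rewrite [e]splitr ltrD ?near_s// distrC near_s.
exists (d / 2); first by rewrite divr_gt0.
move=> t t' tt'; have d20 : 0 < d / 2 by rewrite divr_gt0.
apply: (dP (d / 2) _ d20 (set_val t)) => //.
- by rewrite /= sub0r normrN gtr0_norm// ltr_pdivrMr// ltr_pMr// ltr1n.
- exact: set_valP.
- by rewrite subrr normr0.
- by rewrite distrC.
Qed.

Lemma cmap_build (f : tint T -> E) : (forall e : R, 0 < e -> exists2 d : R, 0 < d &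
  forall t t' : tint T, set_val t <= set_val t' -> set_val t' - set_val t < d ->
   `|f t - f t'| < e) -> exists x : C, forall t, x t = f t.
Proof.
move=> uf; have fC : f \in @cmap_pred R T E.
  apply/asboolP => t U /nbhs_ballP[e e0 eU]; have [d d0 df] := uf e e0.
  rewrite /= nbhsE; exists (set_val @^-1` ball (set_val t) d); first split.
  - by exists (ball (set_val t) d) => //; exact: ball_open.
  - exact: ballxx.
  move=> t' /=; rewrite -ball_normE /= => tt'; apply: eU; rewrite -ball_normE /=.
  have [le|/ltW le] := leP (set_val t) (set_val t').
    by apply: df => //; rewrite (le_lt_trans (ler_norm _))// distrC.
  by rewrite distrC; apply: df => //; rewrite (le_lt_trans (ler_norm _)).
by exists (CMap fC).
Qed.

Lemma cmap_cauchy_cvg (x : nat -> C) :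
  (forall e : R, 0 < e -> exists N, forall n m, (N <= n)%N -> (N <= m)%N ->
    `|x n - x m| < e) -> exists xl : C, x n @[n --> \oo] --> xl.
Proof.
move=> cx; pose f t := limn (fun n => x n t).
have cf t : (fun n => x n t) @ \oo --> f t.
  apply: cauchy_cvgn => e e0; have [N xN] := cx e e0; exists N => n m nN mN.
  by apply: le_lt_trans (xN n m nN mN); rewrite -cmapB cmap_le.
have uf e : 0 < e -> exists N, forall n t, (N <= n)%N -> `|f t - x n t| <= e.
  move=> e0; have [N xN] := cx e e0; exists N => n t nN.
  have cl : (fun m => `|x m t - x n t|) @ \oo --> `|f t - x n t|.
    by apply: cvg_norm; apply: cvgB => //; exact: cvg_cst.
  rewrite -(cvg_lim _ cl)//; apply: limr_le; first exact: cvgP cl.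
  exists N => // m /= mN; apply: ltW.
  by apply: le_lt_trans (xN m n mN nN); rewrite -cmapB cmap_le.
have [xl xlf] : exists xl : C, forall t, xl t = f t.
  apply: cmap_build => e e0; have e3 : 0 < e / 3 by rewrite divr_gt0.
  have [N fN] := uf _ e3; have [d d0 hd] := cmap_uc (x N) e3.
  exists d => // t t' tt' ttd.
  have := hd t t'; rewrite distrC ger0_norm ?subr_ge0// => /(_ ttd) h.
  have h1 := fN N t (leqnn N); have h2 := fN N t' (leqnn N).
  rewrite (_ : f t - f t' = (f t - x N t) + (x N t - x N t') + (x N t' - f t')).
    apply: le_lt_trans (ler_normD _ _) _; rewrite (distrC (x N t')) .
    have := ler_normD (f t - x N t) (x N t - x N t'); lra.
  by rewrite !addrA !subrK.
exists xl; apply/cvgrPdist_lt => e e0; have e2 : 0 < e / 2 by rewrite divr_gt0.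
have [N fN] := uf _ e2; exists N => // n /= nN.
apply: (@le_lt_trans _ _ (e / 2)); last by lra.
by apply: cmap_norm_le => [|t]; [exact: ltW|rewrite cmapB xlf fN].
Qed.

Lemma cmap_equicont (M : set C) (e : R) : tbd M -> 0 < e -> exists2 d : R, 0 < d &
  forall h (t t' : tint T), M h -> `|set_val t - set_val t'| < d -> `|h t - h t'| < e.
Proof.
move=> tM e0; have e3 : 0 < e / 3 by rewrite divr_gt0.
have [s Ms] := tM _ e3.
have [d d0 hd] : exists2 d : R, 0 < d & forall c, c \in s -> forall t t' : tint T,
    `|set_val t - set_val t'| < d -> `|c t - c t'| < e / 3.
  elim: s {Ms} => [|c s [d d0 IH]]; first by exists 1.
  have [d' d'0 h'] := cmap_uc c e3; exists (Num.min d d'); first by rewrite lt_min d0.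
  move=> x; rewrite inE => /predU1P[->|xs] t t'; rewrite lt_min => /andP[h1 h2].
    exact: h'.
  exact: IH.
exists d => // h t t' Mh tt'; have [c cs hc] := Ms h Mh.
have h1 := le_lt_trans (cmap_le (h - c) t) hc.
have h2 := le_lt_trans (cmap_le (h - c) t') hc.
have h3 := hd c cs t t' tt'; rewrite cmapB in h1; rewrite cmapB in h2.
rewrite (_ : h t - h t' = (h t - c t) + (c t - c t') + (c t' - h t')).
  apply: le_lt_trans (ler_normD _ _) _; rewrite (distrC (c t')) .
  have := ler_normD (h t - c t) (c t - c t'); lra.
by rewrite !addrA !subrK.
Qed.

End ContinuousMapSpace.

Lemma small_invS (R : realType) (e : R) : 0 < e -> exists j : nat, j.+1%:R^-1 < e.
Proof.
move=> e0; have := @near_infty_natSinv_lt R (PosNum e0).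
by case=> N _ hN; exists N; exact: (hN N (leqnn N)).
Qed.

(** * Integrals over short subintervals *)

Section IntegralPieces.
Context {R : realType} (T : R).
Local Notation mu := (@lebesgue_measure R).
Local Notation D := (tint T).

Lemma measurable_tint : measurable (D : set R).
Proof. exact: measurable_itv. Qed.

Lemma tint_fin : (mu D < +oo)%E.
Proof. by rewrite /tint lebesgue_measure_itv/=; case: ifP => _; rewrite ?ltry// -EFinD ltry. Qed.

Lemma sub_tint a b : 0 <= a -> b <= T -> [set` `[a, b]] `<=` D.
Proof.
move=> a0 bT s; rewrite /tint /= !in_itv/= => /andP[sa sb].
by rewrite (le_trans a0 sa) (le_trans sb bT).
Qed.

(** Continuation along [[0, T]] in steps of length at most d, used where an integral over short
    intervals is small enough to close an estimate. *)
Lemma tint_ind (P : R -> Prop) (d : R) : 0 <= T -> 0 < d -> P 0 ->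
  (forall a b, 0 <= a -> a <= b -> b <= T -> b - a <= d -> P a -> P b) -> P T.
Proof.
move=> T0 d0 P0 Pab.
have Pn n : P (Num.min T (n%:R * d)).
  elim: n => [|n IH]; first by rewrite mul0r minElt ltNge T0.
  have nd : 0 <= n%:R * d by rewrite mulr_ge0// ltW.
  apply: (Pab (Num.min T (n%:R * d))) => //.
  - by rewrite le_min T0.
  - rewrite le_min ge_min lexx/= ge_min; apply/orP; right.
    by rewrite ler_wpM2r// ?ltW// ltr_nat.
  - by rewrite ge_min lexx.
  rewrite -[n.+1]addn1 natrD mulrDl mul1r; move: (n%:R * d) => x.
  by case: (leP T (x + d)) => ?; case: (leP T x) => ?; lra.
have [n Tn] : exists n : nat, T <= n%:R * d.
  exists (Num.bound (T / d)); rewrite -ler_pdivrMr//.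
  by apply: ltW; apply: archi_boundP; rewrite divr_ge0// ltW.
by have := Pn n; case: leP => // ?; lra.
Qed.

Lemma L1_sub (W : normedModType R) (A B : set R) (g : R -> W) : measurable A ->
  measurable B -> A `<=` B -> smeas g -> (L1 A g <= L1 B g)%E.
Proof. by move=> mA mB AB sg; apply: ge0_subset_integral => //; exact: smeas_norm_EFin. Qed.

Variable g : R -> R^o.
Hypotheses (sg : smeas g) (g1 : (L1 D g < +oo)%E).

Definition pint a b : R := fine (L1 [set` `[a, b]] g).

Lemma pint_ge0 a b : 0 <= pint a b.
Proof. by apply: fine_ge0; exact: L1_ge0. Qed.

Lemma pintE a b : 0 <= a -> b <= T -> L1 [set` `[a, b]] g = (pint a b)%:E.
Proof.
move=> a0 bT; apply: L1_fin; apply: le_lt_trans g1.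
by apply: L1_sub => //; [exact: measurable_tint|exact: sub_tint].
Qed.

Lemma pint_sub a b c d : 0 <= a -> a <= c -> d <= b -> b <= T -> pint c d <= pint a b.
Proof.
move=> a0 ac db bT; have c0 := le_trans a0 ac; have dT := le_trans db bT.
rewrite -lee_fin -!pintE//.
apply: L1_sub => // s /=; rewrite !in_itv/= => /andP[cs sd].
by rewrite (le_trans ac cs) (le_trans sd db).
Qed.

Lemma pint_small (e : R) : 0 < e -> exists2 d : R, 0 < d &
  forall a b, 0 <= a -> a <= b -> b <= T -> b - a <= d -> pint a b < e.
Proof.
move=> e0; pose h := cut D g.
have sh : smeas h by exact: (smeas_cut measurable_tint).
have ih : mu.-integrable setT (EFin \o (h : R -> R)).
  apply: L1_integrable => //; apply: le_lt_trans g1.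
  rewrite /h -(L1_cut (D := setT) (A := D))//.
have [d [d0 hd]] := integral_normr_continuous ih e0.
exists (d / 2); first by rewrite divr_gt0.
move=> a b a0 ab bT bad.
have lt : (lebesgue_measure [set` `[a, b]] < d%:E)%E.
  rewrite lebesgue_measure_itv /=; case: ifP => _; rewrite ?lte_fin//.
  by apply: le_lt_trans bad _; rewrite ltr_pdivrMr// ltr_pMr// ltr1n.
have := hd [set` `[a, b]] (measurable_itv _) lt; apply: le_lt_trans.
rewrite le_eqVlt; apply/orP; left; apply/eqP.
rewrite /pint /L1 /Rintegral; congr fine; apply: eq_integral => s.
by move=> /set_mem /(sub_tint a0 bT) Ds; rewrite /h /cut mem_set.
Qed.

End IntegralPieces.

Section VolterraOperator.
Context {R : realType} {E : completeNormedModType R} (T : R).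
Hypothesis T0 : 0 <= T.
Local Notation mu := (@lebesgue_measure R).
Local Notation D := (tint T).
Local Notation C := (cmap T E).
Variables (k : R -> R -> blin E E) (m : R -> R^o).

(** The form in which the kernel is used: one function m bounds both [k t s] and its Lipschitz
    constant in t, off a null set of s that is the same for all t. *)
Definition volterra_kernel := [/\ smeas m, (forall s, 0 <= (m s : R)),
  (\forall s \ae mu, forall t, 0 <= s -> s <= t -> t <= T -> `|k t s| <= m s),
  (\forall s \ae mu, forall t t', 0 <= s -> s <= t -> t <= t' -> t' <= T ->
    `|k t' s - k t s| <= (m s : R) * (t' - t)) &
  forall t (u : R -> E), D t -> smeas u ->
    smeas (cut [set` `[0, t]] (fun s => k t s (u s)))].

Hypothesis kK : volterra_kernel.

Let mD : measurable (D : set R). Proof. exact: measurable_tint. Qed.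
Let sm : smeas m. Proof. by case: kK. Qed.
Let m0 s : 0 <= (m s : R). Proof. by case: kK. Qed.
Let tD (t : D) : 0 <= set_val t /\ set_val t <= T.
Proof. by apply/tintP; exact: set_valP. Qed.

Definition wnorm (u : R -> E) : \bar R := L1 D (fun s => m s *: u s).

(* v is the function t |-> \int_0^t k(t,s) u(s) ds *)
Definition isV (u : R -> E) (v : C) := smeas u /\ forall t : D,
  bint D (cut [set` `[0, set_val t]] (fun s => k (set_val t) s (u s))) (v t).

Lemma smeas_wnorm (u : R -> E) : smeas u -> smeas (fun s => m s *: u s).
Proof. by move=> su; exact: (smeasZ sm su). Qed.

Lemma isVD a u1 v1 u2 v2 : isV u1 v1 -> isV u2 v2 ->
  isV (fun s => a *: u1 s + u2 s) (a *: v1 + v2).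
Proof.
move=> [s1 b1] [s2 b2]; split=> [|t].
  by apply: (smeasD (f := fun s => a *: u1 s)) => //; exact: smeasZl.
rewrite cmapD cmapZ; have := bintD mD a (b1 t) (b2 t); congr (bint D _ _).
by apply/funext => s; rewrite /cut; case: ifP; rewrite ?scaler0 ?addr0// blinD blinZ.
Qed.

Lemma isV0 : isV (fun=> 0) 0.
Proof.
split=> [|t]; first exact: smeas_cst.
rewrite (_ : cut _ _ = (fun=> 0)); first exact: (bint0 mD (tint_fin T)).
by apply/funext => s; rewrite /cut blin0; case: ifP.
Qed.

Lemma isVB u1 v1 u2 v2 : isV u1 v1 -> isV u2 v2 ->
  isV (fun s => u1 s - u2 s) (v1 - v2).
Proof.
move=> V1 V2; have := isVD (-1) V2 V1; rewrite scaleN1r addrC.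
by congr (isV _ _); apply/funext => s; rewrite scaleN1r addrC.
Qed.

Lemma isV_sum (I : eqType) (r : seq I) (a : I -> R) (u : I -> R -> E) (v : I -> C) :
  (forall i, i \in r -> isV (u i) (v i)) ->
  isV (fun s => \sum_(i <- r) a i *: u i s) (\sum_(i <- r) a i *: v i).
Proof.
elim: r => [|i r IH] uv.
  rewrite big_nil; have := isV0; congr (isV _ _).
  by apply/funext => s; rewrite big_nil.
have IHr : isV (fun s => \sum_(i <- r) a i *: u i s) (\sum_(i <- r) a i *: v i).
  by apply: IH => j jr; apply: uv; rewrite inE jr orbT.
rewrite big_cons; have := isVD (a i) (uv i (mem_head _ _)) IHr; congr (isV _ _).
by apply/funext => s; rewrite big_cons.
Qed.

Lemma isV_le u v (g : R -> R^o) t : isV u v -> smeas g -> (L1 D g < +oo)%E ->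
  (\forall s \ae mu, D s -> s <= set_val t -> (m s : R) * `|u s| <= `|g s|) ->
  `|v t| <= pint g 0 (set_val t).
Proof.
move=> [su uv] sg g1 ug; have [t0 tT] := tD t.
rewrite -lee_fin -(pintE sg g1)// -(L1_cut (sub_tint _ tT))//.
apply: le_trans (bint_norm mD (uv t)) _; have [sk _ _] := uv t.
apply: (le_L1 mD sk); first by apply: smeas_cut.
have [_ _ kle _ _] := kK; have := ae_and kle ug; apply: ae_imp => s [ks us] Ds.
rewrite /cut; case: ifPn => [/set_mem/=|_]; last by rewrite !normr0.
rewrite in_itv/= => /andP[s0 st].
apply: le_trans (us Ds st); apply: le_trans (blin_le _ _) _.
by rewrite ler_wpM2r//; exact: ks.
Qed.

Lemma isV_norm u v : isV u v -> (`|v|%:E <= wnorm u)%E.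
Proof.
move=> uv; have [N1|] := ltP (wnorm u) +oo%E; last by rewrite leye_eq => /eqP ->; rewrite leey.
have su : smeas u by case: uv.
pose g s := `|m s *: u s| : R^o.
have sg : smeas g by apply: smeas_normr; exact: smeas_wnorm.
have gE : L1 D g = wnorm u by rewrite /L1; apply: eq_integral => s _; rewrite normr_id.
have g1 : (L1 D g < +oo)%E by rewrite gE.
rewrite -gE (L1_fin g1) lee_fin; apply: cmap_norm_le => [|t].
  by apply: fine_ge0; exact: L1_ge0.
apply: (le_trans (isV_le uv sg g1 _)).
  by apply: aeW => s _ _; rewrite normr_id normrZ ger0_norm.
by have [t0 tT] := tD t; exact: (@pint_sub _ T g).
Qed.

(** Two contributions: the new interval [[t, t']], and on [[0, t]] the change of the kernel, of norm
    at most [m s] times t' - t. *)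
Lemma kernel_dist (u : R -> E) (g : R -> R^o) t t' : smeas u -> smeas g -> (L1 D g < +oo)%E ->
  0 <= t -> t <= t' -> t' <= T ->
  (\forall s \ae mu, D s -> (m s : R) * `|u s| <= `|g s|) ->
  (L1 D (fun s => cut [set` `[0, t']] (fun s => k t' s (u s)) s -
    cut [set` `[0, t]] (fun s => k t s (u s)) s)%R <=
    (pint g t t' + (t' - t) * pint g 0 T)%:E)%E.
Proof.
move=> su sg g1 t0 tt tT ug; have [_ _ kle klip sk] := kK.
have Dt' : D t' by apply/tintP; split=> //; exact: le_trans tt.
have Dt : D t by apply/tintP; split=> //; exact: le_trans tT.
rewrite EFinD EFinM -!(pintE sg g1)// -(L1_cut (sub_tint t0 tT)).
pose g1' := fun s => `|cut [set` `[t, t']] g s| : R^o.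
pose g2 := fun s => (t' - t) *: (`|g s| : R^o).
have scg : smeas (cut [set` `[t, t']] g) by exact: smeas_cut.
have s1 : smeas g1' by exact: smeas_normr.
have s2 : smeas g2 by apply: smeasZl; exact: smeas_normr.
have -> : L1 D (cut [set` `[t, t']] g) = L1 D g1'.
  by rewrite /L1; apply: eq_integral => s _; rewrite /g1' normr_id.
have -> : ((t' - t)%:E * L1 [set` `[0%R, T]] g = L1 D g2)%E.
  rewrite (L1Z mD)//; last exact: smeas_normr.
  rewrite ger0_norm ?subr_ge0//; congr (_ * _)%E.
  by rewrite /L1; apply: eq_integral => s _; rewrite normr_id.
apply: le_trans (L1D mD s1 s2); apply: (le_L1 mD).
- by apply: smeasB; exact: sk.
- exact: smeasD.
have := ae_and (ae_and kle klip) ug; apply: ae_imp => s [[ks ls] us] Ds.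
have /tintP[s0 sT] := Ds; have {}us := us Ds.
have gs0 : 0 <= g1' s by rewrite /g1'.
have gs2 : 0 <= g2 s by rewrite /g2 mulr_ge0 ?subr_ge0.
rewrite [leRHS]ger0_norm; last by apply: addr_ge0.
rewrite /cut; have [st|ts] := leP s t.
  rewrite mem_set; last by rewrite /= in_itv/= s0 (le_trans st tt).
  rewrite mem_set; last by rewrite /= in_itv/= s0 st.
  apply: (@le_trans _ _ (g2 s)); last by rewrite lerDr.
  have := blin_le (k t' s - k t s) (u s).
  rewrite (_ : (k t' s - k t s) (u s) = k t' s (u s) - k t s (u s))// => /le_trans; apply.
  apply: (@le_trans _ _ ((m s : R) * (t' - t) * `|u s|)).
    by rewrite ler_wpM2r//; exact: ls.
  by rewrite mulrAC mulrC /g2 ler_wpM2l ?subr_ge0.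
rewrite [s \in [set` `[0, t]]]memNset; last by rewrite /= in_itv/= s0/= leNgt ts.
rewrite subr0; have [st'|ts'] := leP s t'.
  rewrite mem_set; last by rewrite /= in_itv/= s0 st'.
  apply: (@le_trans _ _ (g1' s)); last by rewrite lerDl.
  rewrite /g1' /cut mem_set; last by rewrite /= in_itv/= (ltW ts) st'.
  apply: le_trans us; apply: le_trans (blin_le _ _) _.
  by rewrite ler_wpM2r//; exact: ks.
rewrite memNset; last by rewrite /= in_itv/= s0/= leNgt ts'.
by rewrite normr0; apply: addr_ge0.
Qed.

Lemma isV_osc u v (g : R -> R^o) (t t' : D) : isV u v -> smeas g -> (L1 D g < +oo)%E ->
  (\forall s \ae mu, D s -> (m s : R) * `|u s| <= `|g s|) -> set_val t <= set_val t' ->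
  `|v t - v t'| <= pint g (set_val t) (set_val t') + (set_val t' - set_val t) * pint g 0 T.
Proof.
move=> [su uv] sg g1 ug tt; have [t0 tT] := tD t; have [t0' tT'] := tD t'.
rewrite distrC -lee_fin; apply: le_trans (bint_dist mD (uv t') (uv t)) _.
exact: kernel_dist.
Qed.

Lemma isV_exists (u : R -> E) : smeas u -> (wnorm u < +oo)%E -> exists v, isV u v.
Proof.
move=> su N1; have [_ _ kle _ sk] := kK.
pose g s := `|m s *: u s| : R^o.
have sg : smeas g by apply: smeas_normr; exact: smeas_wnorm.
have gE : L1 D g = wnorm u by rewrite /L1; apply: eq_integral => s _; rewrite normr_id.
have g1 : (L1 D g < +oo)%E by rewrite gE.
have ug s : (m s : R) * `|u s| = `|g s| by rewrite normr_id normrZ ger0_norm.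
have /choice[f hf] : forall t : D, exists v : E,
    bint D (cut [set` `[0, set_val t]] (fun s => k (set_val t) s (u s))) v.
  move=> t; have [t0 tT] := tD t; have st := sk (set_val t) u (set_valP t) su.
  apply: (bint_exists mD (tint_fin T)) => //; apply: le_lt_trans g1.
  apply: (le_L1 mD) => //; apply: ae_imp kle => s ks Ds.
  rewrite /cut -ug; case: ifPn => [/set_mem/=|_]; last by rewrite normr0 mulr_ge0.
  rewrite in_itv/= => /andP[s0 st']; apply: le_trans (blin_le _ _) _.
  by rewrite ler_wpM2r//; exact: ks.
have [v vf] : exists v : C, forall t, v t = f t.
  apply: cmap_build => e e0; have e2 : 0 < e / 2 by rewrite divr_gt0.
  have [d d0 hd] := pint_small sg g1 e2.
  have I0 : 0 <= pint g 0 T by exact: pint_ge0.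
  exists (Num.min d (e / 2 / (pint g 0 T + 1))).
    by rewrite lt_min d0 !divr_gt0// ltr_wpDl.
  move=> t t' tt; rewrite lt_min => /andP[td te].
  have [t0 tT] := tD t; have [t0' tT'] := tD t'.
  have h1 := hd _ _ t0 tt tT' (ltW td).
  have h2 : (set_val t' - set_val t) * pint g 0 T <= e / 2.
    apply: (@le_trans _ _ ((set_val t' - set_val t) * (pint g 0 T + 1))).
      by rewrite ler_wpM2l ?subr_ge0// lerDl.
    by rewrite -ler_pdivlMr ?ltr_wpDl// ltW.
  have h3 := bint_dist mD (hf t') (hf t).
  have h4 : `|f t' - f t| <= pint g (set_val t) (set_val t') +
      (set_val t' - set_val t) * pint g 0 T.
    rewrite -lee_fin; apply: le_trans h3 _; apply: kernel_dist => //.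
    by apply: aeW => s _; rewrite ug.
  rewrite distrC; apply: le_lt_trans h4 _; rewrite [e]splitr; exact: ltr_leD.
by exists v; split=> // t; rewrite vf.
Qed.

(** Causality of the Volterra operator; it permits changing a control after a given time without
    altering the past trajectory. *)
Lemma isV_causal u1 v1 u2 v2 t : isV u1 v1 -> isV u2 v2 ->
  (\forall s \ae mu, D s -> s <= set_val t -> u1 s = u2 s) -> v1 t = v2 t.
Proof.
move=> V1 V2 u12; apply/eqP; rewrite -subr_eq0 -normr_le0.
pose g (s : R) := 0 : R^o.
have g1 : L1 D g = 0%E by rewrite /L1; apply: integral0_eq => s _; rewrite normr0.
have := isV_le (isVB V1 V2) (smeas_cst _ : smeas g); rewrite g1 => h.
have {h} := h t (ltry 0) _; rewrite cmapB.
have -> : pint g 0 (set_val t) = 0.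
  by rewrite /pint /L1 integral0_eq// => s _; rewrite normr0.
apply; apply: ae_imp u12 => s h Ds st.
by rewrite h// subrr normr0 mulr0 normr0.
Qed.

Lemma isV_unique u v v' : isV u v -> isV u v' -> v = v'.
Proof.
move=> V1 V2; apply/val_inj/funext => t /=.
by apply: (isV_causal V1 V2); apply: aeW.
Qed.

Lemma isV_lim (u_ : nat -> R -> E) v_ u (v : C) (g : R -> R^o) :
  (forall n, isV (u_ n) (v_ n)) -> smeas u -> smeas g -> (L1 D g < +oo)%E ->
  (\forall s \ae mu, D s -> forall n, (m s : R) * `|u_ n s| <= g s) ->
  (\forall s \ae mu, D s -> u_ n s @[n --> \oo] --> u s) ->
  (forall t, v_ n t @[n --> \oo] --> v t) -> isV u v.
Proof.
move=> uv su sg g1 ug ucv vcv; have [_ _ kle _ sk] := kK; split=> // t.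
have st := sk _ _ (set_valP t).
have sc n : smeas (cut [set` `[0, set_val t]] (fun s => k (set_val t) s (u_ n s))).
  by apply: st; case: (uv n).
have [t0 tT] := tD t.
have cvk : \forall s \ae mu, D s -> cut [set` `[0, set_val t]]
    (fun s => k (set_val t) s (u_ n s)) s @[n --> \oo] -->
    cut [set` `[0, set_val t]] (fun s => k (set_val t) s (u s)) s.
  apply: ae_imp ucv => s h /h {}h; rewrite /cut; case: ifP => _; last exact: cvg_cst.
  exact: (continuous_cvg _ (@blin_continuous _ _ _ (k (set_val t) s) (u s)) h).
have ug' : \forall s \ae mu, D s -> (forall n, `|cut [set` `[0, set_val t]]
    (fun s => k (set_val t) s (u_ n s)) s| <= g s).
  have := ae_and kle ug; apply: ae_imp => s [ks us] Ds n.
  have := us Ds n; rewrite /cut; case: ifPn => [/set_mem/=|_].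
    rewrite in_itv/= => /andP[s0 st']; apply: le_trans; apply: le_trans (blin_le _ _) _.
    by rewrite ler_wpM2r//; exact: ks.
  by rewrite normr0; apply: le_trans; rewrite mulr_ge0.
have ulim : \forall s \ae mu, D s ->
    `|cut [set` `[0, set_val t]] (fun s => k (set_val t) s (u s)) s| <= g s.
  have := ae_and cvk ug'; apply: ae_imp => s [cs us] Ds.
  have /cvg_norm {}cs := cs Ds.
  rewrite -(cvg_lim _ cs)//; apply: limr_le; first exact: cvgP cs.
  by apply: nearW => n; exact: us.
apply: (bint_lim mD (fun n => (uv n).2 t) _ _ _ (vcv t)); first exact: st.
  apply: le_lt_trans g1; apply: (le_L1 mD) => //; first exact: st.
  by apply: ae_imp ulim => s h /h {}h; apply: le_trans h (ler_norm _).
have ig : mu.-integrable D (EFin \o (fun s => 2 * (g s : R))).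
  have i0 := L1_integrable sg g1.
  have := @integrableZl _ _ _ mu D mD (2 : R) _ i0.
  by apply: eq_integrable => // s _; rewrite /= EFinM.
apply: (L1_dct mD sc (st _ su) ig) => //.
have := ae_and ulim ug'; apply: ae_imp => s [h1 h2] n Ds.
apply: le_trans (ler_normB _ _) _; rewrite mulr_natl mulr2n.
by apply: lerD; [exact: h1|exact: h2].
Qed.

End VolterraOperator.

(** * Compactness of the solution set *)

Section CoveringNumbers.
Context {R : realType} {W : normedModType R}.

Lemma fcovD e1 e2 (f g : nat -> W) : fcov e1 (range f) -> fcov e2 (range g) ->
  fcov (e1 + e2) (range (fun n => f n + g n)).
Proof.
move=> [s1 h1] [s2 h2]; exists [seq a + b | a <- s1, b <- s2] => _ [n _ <-].
have [a as1 fa] := h1 _ (imageP f (I : setT n)).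
have [b bs2 gb] := h2 _ (imageP g (I : setT n)).
exists (a + b); first by apply/allpairsP; exists (a, b).
rewrite opprD addrACA; apply: le_lt_trans (ler_normD _ _) _; exact: ltrD.
Qed.

Lemma fcov_blin e e' mu (f : nat -> W) (l : blin W W) : `|l| <= mu -> mu * e < e' ->
  fcov e (range f) -> fcov e' (range (fun n => l (f n))).
Proof.
move=> lmu mue [s sf]; exists [seq l c | c <- s] => _ [n _ <-].
have [c cs fc] := sf _ (imageP f (I : setT n)).
exists (l c); first exact: map_f.
rewrite -blinB; apply: le_lt_trans (blin_le _ _) _; apply: le_lt_trans mue.
by apply: ler_pM => //; exact: ltW.
Qed.

Lemma fcov_const e (c : W) (A : set W) : 0 < e -> (forall x, A x -> x = c) -> fcov e A.
Proof.
move=> e0 Ac; exists [:: c] => x /Ac ->; exists c; rewrite ?inE ?eqxx//.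
by rewrite subrr normr0.
Qed.

Lemma fcov_tail e (f : nat -> W) N : 0 < e ->
  fcov e [set f n | n in [set n | (N <= n)%N]] -> fcov e (range f).
Proof.
move=> e0 [s sf]; exists (mkseq f N ++ s) => _ [n _ <-].
have [nN|Nn] := ltnP n N.
  exists (f n); last by rewrite subrr normr0.
  by rewrite mem_cat; apply/orP; left; apply/mapP; exists n; rewrite ?mem_iota.
have [c cs fc] := sf (f n) (imageP f Nn).
by exists c => //; rewrite mem_cat cs orbT.
Qed.

End CoveringNumbers.

Section Estimates.
Context {R : realType} {E : completeNormedModType R} (T : R).
Hypothesis T0 : 0 <= T.
Local Notation mu := (@lebesgue_measure R).
Local Notation D := (tint T).
Local Notation C := (cmap T E).
Variables (k : R -> R -> blin E E) (m c : R -> R^o).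
Hypothesis kK : volterra_kernel T k m.
Hypotheses (sc : smeas c) (c0 : forall s, 0 <= (c s : R)).
Local Notation mc := (fun s => m s *: c s : R^o).
Hypothesis mc1 : (L1 D mc < +oo)%E.

Let mD : measurable (D : set R). Proof. exact: measurable_tint. Qed.
Let sm : smeas m. Proof. by case: kK. Qed.
Let m0 s : 0 <= (m s : R). Proof. by case: kK. Qed.
Let tD (t : D) : 0 <= set_val t /\ set_val t <= T.
Proof. by apply/tintP; exact: set_valP. Qed.
Let smc : smeas mc. Proof. exact: smeasZ. Qed.

(** Meant for [al] a bound already known and [be] an unknown one on a short interval, where its
    coefficient is small. *)
Lemma isV_le_pieces (u : R -> E) (v : C) (t : D) (al be a b : R) :
  isV k u v -> 0 <= al -> 0 <= be -> 0 <= a -> b <= T ->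
  (\forall s \ae mu, D s -> s <= set_val t ->
    `|u s| <= (c s : R) * (al + (if s \in [set` `[a, b]] then be else 0))) ->
  `|v t| <= al * pint mc 0 T + be * pint mc a b.
Proof.
move=> uv al0 be0 a0 bT us; have [t0 tT] := tD t.
pose g1 := fun s => al *: mc s; pose g2 := fun s => be *: cut [set` `[a, b]] mc s.
have s1 : smeas g1 by exact: (smeasZl al smc).
have scc : smeas (cut [set` `[a, b]] mc) by exact: smeas_cut.
have s2 : smeas g2 by exact: (smeasZl be scc).
pose g s := g1 s + g2 s : R^o.
have sg : smeas g by exact: (smeasD s1 s2).
have E1 : L1 D g1 = (al * pint mc 0 T)%:E.
  by rewrite (L1Z mD al smc) ger0_norm// EFinM -(pintE smc mc1).
have E2 : L1 D g2 = (be * pint mc a b)%:E.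
  by rewrite (L1Z mD be scc) ger0_norm// EFinM -(pintE smc mc1)// (L1_cut (sub_tint a0 bT)).
have gle : (L1 D g <= (al * pint mc 0 T + be * pint mc a b)%:E)%E.
  by rewrite EFinD -E1 -E2; exact: (L1D mD s1 s2).
have gfin : (L1 D g < +oo)%E by apply: le_lt_trans gle (ltry _).
apply: (le_trans (isV_le kK uv sg gfin _)).
  apply: ae_imp us => s h Ds st; apply: le_trans (ler_norm _).
  apply: (le_trans (ler_wpM2l (m0 s) (h Ds st))).
  rewrite /g /g1 /g2 /cut /= mulrA mulrDr.
  apply: lerD; first by rewrite [leLHS]mulrC.
  by case: ifP => _; [rewrite [leLHS]mulrC|rewrite mulr0 scaler0].
rewrite -lee_fin -(pintE sg gfin)//; apply: le_trans gle.
apply: L1_sub => //; exact: sub_tint.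
Qed.

Lemma apriori (H K : R) : 0 <= H -> 0 <= K -> exists B : R, 0 <= B /\
  forall (h x : C) w, isV k w (x - h) -> `|h| <= H ->
  (\forall s \ae mu, D s -> forall b, (forall t : D, set_val t <= s -> `|x t| <= b) ->
    `|w s| <= (c s : R) * (K + b)) -> `|x| <= B.
Proof.
move=> H0 K0; have e2 : 0 < 2^-1 :> R by rewrite invr_gt0.
have [d d0 hd] := pint_small smc mc1 e2.
pose cond (h x : C) w := [/\ isV k w (x - h), `|h| <= H &
  (\forall s \ae mu, D s -> forall b, (forall t : D, set_val t <= s -> `|x t| <= b) ->
    `|w s| <= (c s : R) * (K + b))].
pose Q b := exists B : R, 0 <= B /\ forall h x w, cond h x w ->
  forall t : D, set_val t <= b -> `|x t| <= B.
pose P0 := pint mc 0 T; have P00 : 0 <= P0 by exact: pint_ge0.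
have step a b B : 0 <= B -> 0 <= a -> a <= b -> b <= T -> b - a <= d ->
    (forall h x w, cond h x w -> forall t : D, set_val t < a -> `|x t| <= B) -> Q b.
  move=> B0 a0 ab bT bad QB.
  (* Obtained by solving X <= H + (K + B) P0 + (K + X) / 2 for X. *)
  exists (2 * H + 2 * P0 * (K + B) + K); split.
    by rewrite !addr_ge0// !mulr_ge0// addr_ge0.
  move=> h x w hxw; have [Vw hH wx] := hxw.
  pose A := [set t : D | set_val t <= b]; pose X := supnorm A x.
  have bX : bounded_over A x by have [N hN] := cmap_bounded x; exists N => t _; exact: hN.
  have X0 : 0 <= X by exact: supnorm_ge0.
  have XA (t : D) : set_val t <= b -> `|x t| <= X by exact: (supnorm_ub bX).
  have xt (t : D) : set_val t <= b -> `|x t| <= H + ((K + B) * P0 + (K + X) * 2^-1).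
    move=> tb; rewrite -(subrK (h t) (x t)) addrC; apply: le_trans (ler_normD _ _) _.
    apply: lerD; first by apply: le_trans hH; exact: cmap_le.
    have := @isV_le_pieces w (x - h) t (K + B) (K + X) a b Vw.
    rewrite !addr_ge0// => /(_ isT isT a0 bT) h1.
    apply: le_trans (h1 _) _; last first.
      by rewrite lerD2l ler_wpM2l ?addr_ge0// ltW// hd.
    apply: ae_imp wx => s ws Ds st; have /tintP[s0 sT] := Ds.
    have [sa|sa] := ltP s a.
      apply: (le_trans (ws Ds B _)) => [t' ts|].
        by apply: QB hxw _ _; exact: le_lt_trans ts sa.
      by rewrite ler_wpM2l// lerDl; case: ifP => // _; rewrite addr_ge0.
    rewrite mem_set; last by rewrite /= in_itv/= sa (le_trans st tb).
    apply: (le_trans (ws Ds X _)) => [t' ts|].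
      by apply: XA; apply: le_trans ts (le_trans st tb).
    by rewrite ler_wpM2l// lerDr addr_ge0.
  have XB : X <= H + ((K + B) * P0 + (K + X) * 2^-1).
    apply: supnorm_le => [|t tb]; last exact: xt.
    by rewrite !addr_ge0// mulr_ge0// addr_ge0.
  move=> t tb; apply: le_trans (XA t tb) _; move: XB.
  rewrite (mulrC (K + B)) -(mulrA 2 P0); move: (P0 * (K + B)) => Z; lra.
have QT : Q T.
  apply: (tint_ind T0 d0); first by apply: (step 0 0 0) => //; rewrite ?subrr ?ltW//;
    move=> h x w _ t; rewrite ltNge; case: (tD t) => ->.
  move=> a b a0 ab bT bad [B [B0 hB]]; apply: (step a b B) => // h x w hc t ta.
  exact: (hB h x w hc t (ltW ta)).
have [B [B0 hB]] := QT; exists B; split=> // h x w V1 V2 V3.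
apply: cmap_norm_le => // t; apply: (hB h x w) => //; by case: (tD t).
Qed.

Lemma isV_equicont (K e : R) : 0 <= K -> 0 < e -> exists2 d : R, 0 < d &
  forall w v, isV k w v -> (\forall s \ae mu, D s -> `|w s| <= (c s : R) * K) ->
    forall t t' : D, `|set_val t - set_val t'| < d -> `|v t - v t'| < e.
Proof.
move=> K0 e0; pose g s := K *: mc s : R^o.
have sg : smeas g by exact: (smeasZl K smc).
have g1 : (L1 D g < +oo)%E by rewrite (L1Z mD K smc) lte_mul_pinfty// lee_fin.
have e2 : 0 < e / 2 by rewrite divr_gt0.
have [d d0 hd] := pint_small sg g1 e2.
have I0 : 0 <= pint g 0 T by exact: pint_ge0.
exists (Num.min d (e / 2 / (pint g 0 T + 1))).
  by rewrite lt_min d0 !divr_gt0// ltr_wpDl.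
move=> w v Vw wK.
have key (t t' : D) : set_val t <= set_val t' ->
    set_val t' - set_val t < Num.min d (e / 2 / (pint g 0 T + 1)) ->
    `|v t - v t'| < e.
  move=> tt; rewrite lt_min => /andP[td te].
  have [t0 tT] := tD t; have [t0' tT'] := tD t'.
  have h1 := hd _ _ t0 tt tT' (ltW td).
  have h2 : (set_val t' - set_val t) * pint g 0 T <= e / 2.
    apply: (@le_trans _ _ ((set_val t' - set_val t) * (pint g 0 T + 1))).
      by rewrite ler_wpM2l ?subr_ge0// lerDl.
    by rewrite -ler_pdivlMr ?ltr_wpDl// ltW.
  apply: (@le_lt_trans _ _ (pint g (set_val t) (set_val t') +
      (set_val t' - set_val t) * pint g 0 T)); last by rewrite [e]splitr; exact: ltr_leD.
  apply: (isV_osc kK Vw sg g1) => //.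
  apply: ae_imp wK => s ws Ds; apply: le_trans (ler_norm _).
  apply: (@le_trans _ _ ((m s : R) * ((c s : R) * K))); first by rewrite ler_wpM2l ?ws.
  by rewrite mulrA [leLHS]mulrC.
move=> t t' tt'; have [le|/ltW le] := leP (set_val t) (set_val t').
  by apply: key => //; rewrite (le_lt_trans (ler_norm _))// distrC.
by rewrite distrC; apply: key => //; rewrite (le_lt_trans (ler_norm _)).
Qed.

End Estimates.

(** * Approximate solutions and their uniform bounds *)

Section Inclusion.
Context {R : realType} {E : completeNormedModType R} (T : R).
Hypothesis T0 : 0 <= T.
Local Notation mu := (@lebesgue_measure R).
Local Notation D := (tint T).
Local Notation C := (cmap T E).
Local Notation pt := (tpt T0).
Variables (k : R -> R -> blin E E) (m c eta : R -> R^o) (F : R -> E -> set E).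
Variable M : set C.

(* the hypotheses on the data, with Borel measurable majorants and with F5
   expressed through coverings *)
Record inclusion_data : Prop := InclusionData {
  id_kernel : volterra_kernel T k m;
  id_sc : smeas c;
  id_c0 : forall s, 0 <= (c s : R);
  id_mc : (L1 D (fun s => m s *: c s : R^o) < +oo)%E;
  id_seta : smeas eta;
  id_eta0 : forall s, 0 <= (eta s : R);
  id_meta : (L1 D (fun s => m s *: eta s : R^o) < +oo)%E;
  id_F1 : forall t x, D t ->
    [/\ F t x !=set0, closed (F t x) & convex_set (F t x)];
  id_F2 : forall x, exists2 w : R -> E, smeas w &
    \forall s \ae mu, D s -> F s x (w s);
  id_F3 : \forall t \ae mu, D t -> upper_hemicontinuous (F t);
  id_F4 : \forall s \ae mu, D s -> forall x y, F s x y ->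
    `|y| <= (c s : R) * (1 + `|x|);
  id_F5 : forall Om : set E, bounded_set Om -> \forall s \ae mu, D s ->
    forall e e', fcov e Om -> (eta s : R) * e < e' ->
      fcov e' (\bigcup_(x in Om) F s x);
  id_M0 : M !=set0;
  id_Mc : compact M;
  id_Mv : convex_set M }.

Hypothesis dat : inclusion_data.

Definition Fhull r s y := hull (\bigcup_(z in [set z | `|z - y| <= r]) F s z).

Definition witness r (x h : C) w := [/\ M h, isV k w (x - h) &
  \forall s \ae mu, D s -> Fhull r s (x (pt s)) (w s)].

Definition sol r := [set x | exists h w, witness r x h w].

Let kK := id_kernel dat.

Lemma FhullS r r' s y : r <= r' -> Fhull r s y `<=` Fhull r' s y.
Proof.
move=> rr; apply: hullS => v [z /= zr Fv]; exists z => //=; exact: le_trans rr.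
Qed.

Lemma solS r r' : r <= r' -> sol r `<=` sol r'.
Proof.
move=> rr x [h [w [Mh Vw ws]]]; exists h, w; split=> //.
by apply: ae_imp ws => s h' /h'; exact: FhullS.
Qed.

Lemma Fhull_norm : \forall s \ae mu, D s -> forall r y v, Fhull r s y v ->
  `|v| <= (c s : R) * (1 + r + `|y|).
Proof.
apply: ae_imp (id_F4 dat) => s F4 Ds r y.
apply: hull_min; first exact: ball_convex.
move=> v [z /= zr Fv]; apply: le_trans (F4 Ds _ _ Fv) _.
rewrite ler_wpM2l ?(id_c0 dat)// -addrA lerD2l -(subrK y z).
by apply: le_trans (ler_normD _ _) _; rewrite lerD2r.
Qed.

Lemma M_bounded : exists2 H : R, 0 <= H & forall h, M h -> `|h| <= H.
Proof.
have /compact_bounded[N [_ hN]] := id_Mc dat; exists (`|N| + 1).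
  by rewrite addr_ge0.
by move=> h Mh; apply: (hN (`|N| + 1)) => //; rewrite ltr_pwDr// ler_norm.
Qed.

Lemma witness_bounded : exists2 B : R, 0 <= B & forall r x h w, r <= 1 ->
  witness r x h w -> `|x| <= B /\
  \forall s \ae mu, D s -> `|w s| <= (c s : R) * (2 + B).
Proof.
have [H H0 MH] := M_bounded.
(* The constant K is 2 because [Fhull_norm] gives 1 + r, which is at most 2. *)
have [B [B0 hB]] := apriori T0 kK (id_sc dat) (id_c0 dat) (id_mc dat) H0 (ler0n R 2).
exists B => // r x h w r1 [Mh Vw ws].
have wle : \forall s \ae mu, D s -> `|w s| <= (c s : R) * (2 + `|x (pt s)|).
  have := ae_and ws Fhull_norm; apply: ae_imp => s [h1 h2] Ds.
  apply: le_trans (h2 Ds r _ _ (h1 Ds)) _.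
  by rewrite ler_wpM2l ?(id_c0 dat)// lerD2r lerD2l.
have xB : `|x| <= B.
  apply: (hB h x w) => //; first exact: MH.
  apply: ae_imp wle => s h1 Ds b xb; apply: le_trans (h1 Ds) _.
  by rewrite ler_wpM2l ?(id_c0 dat)// lerD2l xb// tptK.
split=> //; apply: ae_imp wle => s h1 Ds; apply: le_trans (h1 Ds) _.
rewrite ler_wpM2l ?(id_c0 dat)// lerD2l; apply: le_trans xB; exact: cmap_le.
Qed.

Lemma witness_equicont e : 0 < e -> exists2 d : R, 0 < d &
  forall r x h w, r <= 1 -> witness r x h w ->
    forall t t' : D, `|set_val t - set_val t'| < d -> `|x t - x t'| < e.
Proof.
move=> e0; have e2 : 0 < e / 2 by rewrite divr_gt0.
have [B B0 hB] := witness_bounded.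
have B2 : 0 <= 2 + B by rewrite addr_ge0.
have [d d0 hd] := isV_equicont kK (id_sc dat) (id_mc dat) B2 e2.
have [d' d'0 hd'] := cmap_equicont T0 (compact_tbd (id_Mc dat)) e2.
exists (Num.min d d'); first by rewrite lt_min d0.
move=> r x h w r1 W t t'; rewrite lt_min => /andP[td td'].
have [xB wB] := hB r x h w r1 W; have [Mh Vw _] := W.
have h1 := hd w _ Vw wB t t' td; have h2 := hd' h t t' Mh td'.
rewrite (_ : x t - x t' = ((x - h) t - (x - h) t') + (h t - h t')).
  by apply: le_lt_trans (ler_normD _ _) _; rewrite [e]splitr ltrD.
by rewrite -[LHS](subrK (h t - h t')) !cmapB; congr (_ + _); rewrite !opprD addrACA.
Qed.

Section Sequence.
Variables (x h : nat -> C) (w : nat -> R -> E).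
Hypothesis W : forall n, witness n.+1%:R^-1 (x n) (h n) (w n).

Let r1 n : n.+1%:R^-1 <= 1 :> R. Proof. by rewrite invf_le1// ler1n. Qed.

(* F5 is applied to countably many sets, so that its exceptional null sets
   can be collected *)
Lemma selection_fcov : \forall s \ae mu, D s -> forall e e', 0 <= e ->
  fcov e (range (fun n => x n (pt s))) -> (eta s : R) * e < e' ->
  fcov e' (range (fun n => w n s)).
Proof.
have [B B0 hB] := witness_bounded.
(* Neighbourhoods of radius 1/(j+1) of the states x n, n >= j, at times near i/(j+1). For s near
   that time and n >= j, every value of F entering w n s is taken at a point of this set. *)
pose Om j i := [set y : E | exists n, (j <= n)%N /\ exists t : D,
  `|set_val t - i%:R * j.+1%:R^-1| <= j.+1%:R^-1 /\ `|y - x n t| <= j.+1%:R^-1].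
have bOm j i : bounded_set (Om j i).
  exists (B + 1); split; first exact: num_real.
  move=> b Bb y [n [_ [t [_ yx]]]]; apply: le_trans (ltW Bb).
  rewrite -(subrK (x n t) y) addrC; apply: le_trans (ler_normD _ _) _.
  apply: lerD; last by apply: le_trans yx _.
  by apply: le_trans (cmap_le _ _) _; have [] := hB _ _ _ _ (r1 n) (W n).
have F5 : \forall s \ae mu, forall j i, D s -> forall e e', fcov e (Om j i) ->
    (eta s : R) * e < e' -> fcov e' (\bigcup_(z in Om j i) F s z).
  by apply: ae_all => j; apply: ae_all => i; exact: (id_F5 dat).
have WW : \forall s \ae mu, forall n, D s -> Fhull n.+1%:R^-1 s (x n (pt s)) (w n s).
  by apply: ae_all => n; have [_ _] := W n.
have := ae_and F5 WW; apply: ae_imp => s [{}F5 {}WW] Ds e e' e0 xe ee'.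
have eta0 := id_eta0 dat s; have /tintP[s0 sT] := Ds.
pose g := e' - (eta s : R) * e; have g0 : 0 < g by rewrite subr_gt0.
(* Enlarging e by e1 then uses at most a quarter of the gap g, and g / 2 remains reserved for the
   convex hull. *)
pose e1 := g / 4 / ((eta s : R) + 1).
have ep : 0 < (eta s : R) + 1 by rewrite ltr_wpDl.
have e10 : 0 < e1 by rewrite /e1 !divr_gt0.
have ee1 : (eta s : R) * (e + e1) < e' - g / 2.
  have : (eta s : R) * e1 <= g / 4.
    rewrite /e1 [_ * (_ / _)]mulrA ler_pdivrMr// mulrC.
    by rewrite ler_wpM2l ?divr_ge0 ?(ltW g0)// lerDl.
  by rewrite mulrDr; move: (_ * e1) g0; rewrite /g; move: (_ * e) => Z Y; lra.
have [d d0 hd] : exists2 d : R, 0 < d & forall n (t t' : D),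
    `|set_val t - set_val t'| < d -> `|x n t - x n t'| < e1 / 2.
  have e12 : 0 < e1 / 2 by rewrite divr_gt0.
  have [d d0 hd] := witness_equicont e12; exists d => // n.
  exact: (hd _ _ _ _ (r1 n) (W n)).
have [j jd] : exists j : nat, j.+1%:R^-1 < Num.min (d / 2) (e1 / 2) :> R.
  have p0 : 0 < Num.min (d / 2) (e1 / 2) by rewrite lt_min !divr_gt0.
  exact: small_invS p0.
move: jd; rewrite lt_min => /andP[jd je].
have jp : 0 < j.+1%:R :> R by rewrite ltr0n.
pose i := Num.truncn (s * j.+1%:R).
have si : `|s - i%:R * j.+1%:R^-1| <= j.+1%:R^-1.
  have := Num.Theory.truncn_itv (mulr_ge0 s0 (ltW jp)); rewrite -/i => /andP[i1 i2].
  have h1 : i%:R * j.+1%:R^-1 <= s by rewrite ler_pdivrMr.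
  have h2 : s < i%:R * j.+1%:R^-1 + j.+1%:R^-1.
    by rewrite -[X in _ + X]mul1r -mulrDl natr1 ltr_pdivlMr.
  by rewrite ger0_norm ?subr_ge0// lerBlDl ltW.
have cOm : fcov (e + e1) (Om j i).
  have [l hl] := xe; exists l => y [n [jn [t [ti yx]]]].
  have [a al xa] := hl _ (imageP (fun n => x n (pt s)) (I : setT n)).
  exists a => //.
  have h1 : `|x n t - x n (pt s)| < e1 / 2.
    apply: hd; rewrite tptK//.
    rewrite -(subrK (i%:R * j.+1%:R^-1) (set_val t)) -addrA.
    apply: le_lt_trans (ler_normD _ _) _; rewrite [`|_ - s|]distrC.
    by apply: le_lt_trans (lerD ti si) _; rewrite [d]splitr ltrD.
  rewrite (_ : y - a = (y - x n t) + (x n t - x n (pt s)) + (x n (pt s) - a)).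
    rewrite addrC; apply: le_lt_trans (ler_normD _ _) _; apply: ltr_leD => //.
    apply: le_trans (ler_normD _ _) _; rewrite [leRHS]splitr.
    by apply: lerD; [exact: le_trans yx (ltW je)|exact: ltW].
  by rewrite !addrA !subrK.
have g20 : 0 < g / 2 by rewrite divr_gt0.
have e'0 : 0 < e'.
  by apply: le_lt_trans ee'; rewrite mulr_ge0.
(* The finitely many values with index below j, which [Om j i] ignores, are added to the centres. *)
apply: (fcov_tail (N := j)) => //.
have := fcov_hull (F5 j i Ds _ _ cOm ee1) g20; rewrite subrK.
apply: fcov_sub => _ [n /= jn <-]; have := WW n Ds; apply: hullS => v [z /= zx Fv].
exists z => //; exists n; split=> //; exists (pt s); rewrite tptK//; split=> //.
apply: le_trans zx _; rewrite lef_pV2 ?posrE ?ltr0n// ler_nat; exact: jn.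
Qed.

End Sequence.

End Inclusion.

Section Subsequence.
Context {R : realType} {W : normedModType R}.

Let infinitely (P : nat -> Prop) := forall N, exists n, (N <= n)%N /\ P n.

Lemma tbd_cauchy (x : nat -> W) : tbd (range x) -> exists phi : nat -> nat,
  (forall j, (j <= phi j)%N) /\ forall e : R, 0 < e -> exists N, forall n n',
    (N <= n)%N -> (N <= n')%N -> `|x (phi n) - x (phi n')| < e.
Proof.
move=> tx.
have pigeon e (s : seq W) : forall P, infinitely P ->
    (forall n, P n -> exists2 c, c \in s & `|x n - c| < e) ->
    exists c, infinitely (fun n => P n /\ `|x n - c| < e).
  elim: s => [|c s IH] P iP hP; first by have [n [_ /hP[]]] := iP 0%N.
  have [ic|nic] := pselect (infinitely (fun n => P n /\ `|x n - c| < e)).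
    by exists c.
  have /existsNP[N0 hN0] := nic.
  have iQ : infinitely (fun n => P n /\ (N0 <= n)%N).
    by move=> N; have [n [nN Pn]] := iP (maxn N N0); exists n;
      move: nN; rewrite geq_max => /andP[].
  have [|c' ic'] := IH _ iQ.
    move=> n [Pn nN0]; have [c1] := hP n Pn; rewrite inE => /predU1P[->|c1s] xc; last by exists c1.
    by exfalso; apply: hN0; exists n.
  by exists c' => N; have [n [nN [[Pn _] xc]]] := ic' N; exists n.
have /choice[f hf] : forall Pj : (nat -> Prop) * nat, exists Q : nat -> Prop,
    infinitely Pj.1 -> [/\ infinitely Q, forall n, Q n -> Pj.1 n &
      forall n n', Q n -> Q n' -> `|x n - x n'| < Pj.2.+1%:R^-1].
  move=> [P j]; have [iP|] := pselect (infinitely P); last by exists P.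
  have e0 : 0 < j.+1%:R^-1 / 2 :> R by rewrite divr_gt0 ?invr_gt0 ?ltr0n.
  have [s hs] := tx _ e0.
  have [|c ic] := pigeon (j.+1%:R^-1 / 2) s P iP.
    by move=> n _; apply: hs; exists n.
  exists (fun n => P n /\ `|x n - c| < j.+1%:R^-1 / 2) => /= _; split=> //.
    by move=> n [].
  move=> n n' [_ h1] [_ h2]; rewrite -(subrK c (x n)) -addrA.
  apply: le_lt_trans (ler_normD _ _) _; rewrite [X in _ < X]splitr ltrD//.
  by rewrite distrC.
pose P := fix P j := if j is j'.+1 then f (P j', j') else (fun=> True).
have iP j : infinitely (P j).
  elim: j => [|j IH]; first by move=> N; exists N.
  by have [] := hf (P j, j) IH.
have Pd j i n : P (i + j)%N n -> P j n.
  elim: i => // i IH Pn; apply: IH; rewrite addSn /= in Pn.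
  by have [_ /(_ n Pn)] := hf (P (i + j)%N, (i + j)%N) (iP _).
have /choice[phi hphi] : forall j, exists n, (j <= n)%N /\ P j n.
  by move=> j; exact: iP.
exists phi; split=> [j|e e0]; first by have [] := hphi j.
have [N hN] := small_invS e0.
exists N.+1 => n n' nN n'N; apply: lt_trans hN.
have [_ _ +] := hf (P N, N) (iP N); apply.
  by have [_] := hphi n; rewrite -(subnK nN); exact: Pd.
by have [_] := hphi n'; rewrite -(subnK n'N); exact: Pd.
Qed.

End Subsequence.

Section Compactness.
Context {R : realType} {E : completeNormedModType R} (T : R).
Hypothesis T0 : 0 <= T.
Local Notation mu := (@lebesgue_measure R).
Local Notation D := (tint T).
Local Notation C := (cmap T E).
Local Notation pt := (tpt T0).
Variables (k : R -> R -> blin E E) (m c eta : R -> R^o) (F : R -> E -> set E).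
Variable M : set C.
Hypothesis dat : inclusion_data k m c eta F M.
Local Notation witness := (witness T0 k F M).

Let mD : measurable (D : set R). Proof. exact: measurable_tint. Qed.
Let kK := id_kernel dat.
Let sm : smeas m. Proof. by case: kK. Qed.
Let m0 s : 0 <= (m s : R). Proof. by case: kK. Qed.
Let eta0 := id_eta0 dat.
Let tD (t : D) : 0 <= set_val t /\ set_val t <= T.
Proof. by apply/tintP; exact: set_valP. Qed.
Let r1 n : n.+1%:R^-1 <= 1 :> R. Proof. by rewrite invf_le1// ler1n. Qed.

Section Sequence.
Variables (x h : nat -> C) (w : nat -> R -> E).
Hypothesis W : forall n, witness n.+1%:R^-1 (x n) (h n) (w n).
Local Notation X := (fun t : D => range (fun n => x n t)).
Local Notation meta := (fun s => m s *: eta s : R^o).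

(** On each short interval the covering radius of the states is halved repeatedly, starting from the
    a priori radius B + 1; the short intervals are chained by [tint_ind]. *)
Lemma tbd_states (t : D) : tbd (X t).
Proof.
have [B B0 hB] := witness_bounded T0 dat.
have sme : smeas meta by exact: (smeasZ sm (id_seta dat)).
(* With this bound the factor 2 of [heinz] leaves a quantity below e / 8, hence the radius e / 4 for
   the integrals; the values of h, from a compact set, take another e / 4. *)
have e16 : 0 < 16^-1 :> R by rewrite invr_gt0.
have [d d0 hd] := pint_small sme (id_meta dat) e16.
pose G := fun s => (2 + B) *: (m s *: c s) : R^o.
have smc : smeas (fun s => m s *: c s : R^o) by exact: (smeasZ sm (id_sc dat)).
have sG : smeas G by exact: (smeasZl (2 + B) smc).
have G1 : (L1 D G < +oo)%E.
  by rewrite (L1Z mD (2 + B) smc) lte_mul_pinfty ?(id_mc dat)// lee_fin.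
have wG : \forall s \ae mu, forall n, D s -> (m s : R) * `|w n s| <= G s.
  apply: ae_all => n; have [_ wB] := hB _ _ _ _ (r1 n) (W n).
  apply: ae_imp wB => s h1 Ds; apply: (le_trans (ler_wpM2l (m0 s) (h1 Ds))).
  by rewrite mulrA mulrC.
have th (t' : D) : tbd (range (fun n => h n t')).
  move=> e e0; have [s hs] := compact_tbd (id_Mc dat) e0.
  exists (map (fun a : C => a t') s) => _ [n _ <-]; have [Mh _ _] := W n.
  have [a as_ ha] := hs _ Mh; exists (a t'); first exact: map_f.
  by apply: le_lt_trans ha; rewrite -cmapB; exact: cmap_le.
have [_ _ kle _ _] := kK.
have selw := selection_fcov dat W.
(* On a short interval the integral inequality for coverings halves their radius. *)
have half a b e : 0 <= a -> a <= b -> b <= T -> b - a <= d -> 0 < e ->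
    (forall t : D, set_val t < a -> tbd (X t)) ->
    (forall t : D, set_val t <= b -> fcov e (X t)) ->
    forall t : D, set_val t <= b -> fcov (e / 2) (X t).
  move=> a0 ab bT bad e0 Xa Xb t' tb.
  have [t0 tT] := tD t'.
  (* No contribution before a, where the states are already totally bounded. *)
  pose rho s := e *: cut [set` `[a, b]] meta s : R^o.
  have scm : smeas (cut [set` `[a, b]] meta) by exact: smeas_cut.
  have sr : smeas rho by exact: (smeasZl e scm).
  have rE : L1 D rho = (e * pint meta a b)%:E.
    rewrite (L1Z mD e scm) ger0_norm ?(ltW e0)// EFinM.
    by rewrite (L1_cut (sub_tint a0 bT)) (pintE sme (id_meta dat)).
  have Vn n : bint D (cut [set` `[0, set_val t']] (fun s => k (set_val t') s (w n s)))
      ((x n - h n) t') by have [_ [_ +] _] := W n; apply.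
  have cv : fcov (e / 4) (range (fun n => (x n - h n) t')).
    apply: (heinz mD (tint_fin T) Vn sG G1 _ sr).
    - have := ae_and wG kle; apply: ae_imp => s [h1 h2] Ds n; have {}h1 := h1 n Ds.
      rewrite /cut; case: ifPn => [/set_mem/=|_].
        rewrite in_itv/= => /andP[s0 st]; apply: le_trans h1.
        by apply: le_trans (blin_le _ _) _; rewrite ler_wpM2r// h2.
      by rewrite normr0; apply: le_trans h1; rewrite mulr_ge0.
    - by rewrite rE ltry.
    - have := ae_and selw kle; apply: ae_imp => s [{}selw {}kle] Ds.
      have r0 : 0 <= (rho s : R).
        rewrite /rho /cut /=; case: ifP => _; last by rewrite scaler0.
        by rewrite mulr_ge0 ?(ltW e0)// mulr_ge0.
      split=> // e' re'; have e'0 := le_lt_trans r0 re'.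
      rewrite /cut; have [sA|/negbTE sA] := boolP (s \in [set` `[0, set_val t']]); last first.
        by apply: (fcov_const (c := 0)) => // _ [n _ <-].
      have /andP[s0 st] : 0 <= s <= set_val t' by have := set_mem sA; rewrite /= in_itv.
      have key es : 0 <= es -> fcov es (X (pt s)) ->
          (m s : R) * ((eta s : R) * es) < e' ->
          fcov e' (range (fun n => k (set_val t') s (w n s))).
        move=> es0 fs ms; pose g := e' - (m s : R) * ((eta s : R) * es).
        have g0 : 0 < g by rewrite subr_gt0.
        pose z := g / ((m s : R) + 1) / 2.
        have mp : 0 < (m s : R) + 1 by rewrite ltr_wpDl.
        have z0 : 0 < z by rewrite !divr_gt0.
        apply: (@fcov_blin _ _ ((eta s : R) * es + z) _ (m s)) _ _ _ => //.
        + by apply: kle.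
        + rewrite mulrDr -ltrBrDl -/g /z.
          apply: (@le_lt_trans _ _ (g / 2)); last by rewrite ltr_pdivrMr// ltr_pMr// ltr1n.
          rewrite mulrA ler_pM2r ?invr_gt0// mulrA ler_pdivrMr// mulrC.
          by rewrite ler_wpM2l ?(ltW g0)// lerDl.
        by apply: (selw Ds es) => //; rewrite ltrDl.
      have [sa|sa] := ltP s a.
        pose q := (m s : R) * (eta s : R) + 1.
        have q0 : 0 < q by rewrite ltr_wpDl// mulr_ge0.
        apply: (key (e' / q / 2)); first by rewrite !divr_ge0// ltW.
          by apply: Xa; [rewrite tptK|rewrite !divr_gt0].
        apply: (@le_lt_trans _ _ (e' / 2)); last by rewrite ltr_pdivrMr// ltr_pMr// ltr1n.
        rewrite mulrA mulrA ler_pM2r ?invr_gt0// mulrA ler_pdivrMr// mulrC.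
        by rewrite ler_wpM2l ?(ltW e'0)// lerDl.
      apply: (key e); first exact: ltW.
        by apply: Xb; rewrite tptK// (le_trans st).
      move: re'; rewrite /rho /cut mem_set; last by rewrite /= in_itv/= sa (le_trans st).
      by rewrite /= mulrA [(m s : R) * _ * e]mulrC.
    rewrite rE -EFinM lte_fin.
    have := hd a b a0 ab bT bad.
    have : pint meta a b < 16^-1 -> 2 * (e * pint meta a b) < e / 4; last exact.
    move: (pint _ _ _) => P hP; have : e * P < e * 16^-1 by rewrite ltr_pM2l.
    by move: (e * P) => Z; lra.
  have e4 : 0 < e / 4 by rewrite divr_gt0.
  have := fcovD (th t' _ e4) cv; rewrite (_ : e / 4 + e / 4 = e / 2); last lra.
  by apply: fcov_sub => _ [n _ <-]; exists n => //; rewrite cmapB addrC subrK.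
have step a b : 0 <= a -> a <= b -> b <= T -> b - a <= d ->
    (forall t : D, set_val t < a -> tbd (X t)) ->
    forall t : D, set_val t <= b -> tbd (X t).
  move=> a0 ab bT bad Xa.
  have B1 : 0 < B + 1 by rewrite ltr_wpDl.
  have hj j : forall t : D, set_val t <= b -> fcov ((B + 1) / 2 ^+ j) (X t).
    elim: j => [|j IH] t' tb.
      rewrite expr0 divr1; exists [:: 0] => _ [n _ <-]; exists 0; rewrite ?inE//.
      rewrite subr0; apply: (@le_lt_trans _ _ B); last by rewrite ltrDl.
      apply: le_trans (cmap_le _ _) _; by have [] := hB _ _ _ _ (r1 n) (W n).
    rewrite exprSr invfM mulrA; apply: (half a b) => //.
    by rewrite divr_gt0// exprn_gt0.
  move=> t' tb e e0; have [j ej] : exists j, (B + 1) / 2 ^+ j <= e.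
    have [j hj'] := small_invS (divr_gt0 e0 B1); exists j.
    rewrite mulrC -ler_pdivlMr//; apply: le_trans (ltW hj').
    rewrite lef_pV2 ?posrE ?ltr0n ?exprn_gt0// -natrX ler_nat; exact: ltn_expl.
  exact: fcov_le ej (hj j t' tb).
have all : forall t : D, set_val t <= T -> tbd (X t).
  apply: (tint_ind (P := fun b => forall t : D, set_val t <= b -> tbd (X t)) T0 d0).
    apply: (step 0 0) => //; first by rewrite subrr ltW.
    by move=> t'; rewrite ltNge; case: (tD t') => ->.
  move=> a b a0 ab bT bad IH; apply: (step a b) => // t' ta; exact: IH (ltW ta).
by apply: all; case: (tD t).
Qed.

Lemma tbd_selections : \forall s \ae mu, D s -> tbd (range (fun n => w n s)).
Proof.
have := selection_fcov dat W; apply: ae_imp => s sel Ds e e0.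
have ep : 0 < (eta s : R) + 1 by rewrite ltr_wpDl.
apply: (sel Ds (e / ((eta s : R) + 1) / 2)).
- by rewrite !divr_ge0// ltW.
- by apply: tbd_states; rewrite !divr_gt0.
- apply: (@le_lt_trans _ _ (e / 2)); last by rewrite ltr_pdivrMr// ltr_pMr// ltr1n.
  rewrite mulrA ler_pM2r ?invr_gt0// mulrA ler_pdivrMr// mulrC.
  by rewrite ler_wpM2l ?(ltW e0)// lerDl.
Qed.

(** Arzela-Ascoli, from [tbd_states] and [witness_equicont]. *)
Lemma tbd_trajectories : tbd (range x).
Proof.
move=> e e0; have e8 : 0 < e / 8 by rewrite divr_gt0.
have [d d0 hd] := witness_equicont T0 dat e8.
have [g [gD hg]] := tbd_in (compact_tbd (@segment_compact R 0 T)) d0.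
have [L hL] : exists L : seq (R -> E), forall n, exists2 a, a \in L &
    forall r, r \in g -> `|x n (pt r) - a r| < e / 8.
  elim: g {gD hg} => [|r g [L hL]].
    by exists [:: fun=> 0] => n; exists (fun=> 0); rewrite ?inE.
  have [l hl] := tbd_states (pt r) e8.
  exists [seq (fun r' => if r' == r then b else a r') | b <- l, a <- L] => n.
  have [a aL ha] := hL n; have [b bl hb] := hl _ (imageP (fun n => x n (pt r)) (I : setT n)).
  exists (fun r' => if r' == r then b else a r'); first by apply/allpairsP; exists (b, a).
  by move=> r'; rewrite inE; case: eqP => [-> _ //|_ /=]; exact: ha.
(* The centres must be elements of C: each table a of approximate values on the grid is replaced by
   a trajectory fitting it, and four errors below e / 8 add up to at most e / 2. *)
have /choice[f hf] : forall a : R -> E, exists n, (exists n', forall r, r \in g ->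
    `|x n' (pt r) - a r| < e / 8) -> forall r, r \in g -> `|x n (pt r) - a r| < e / 8.
  by move=> a; have [[n hn]|nh] := pselect (exists n', forall r, r \in g ->
    `|x n' (pt r) - a r| < e / 8); [exists n|exists 0%N].
exists [seq x (f a) | a <- L] => _ [n _ <-].
have [a aL ha] := hL n; exists (x (f a)); first exact: map_f.
have {}hf := hf a (ex_intro _ n ha).
apply: (@le_lt_trans _ _ (e / 2)); last by rewrite ltr_pdivrMr// ltr_pMr// ltr1n.
apply: cmap_norm_le => [|t]; first by rewrite ltW// divr_gt0.
have [r rg tr] := hg (set_val t) (set_valP t).
have Dr := gD r rg; have {}ha := ha r rg; have {}hf := hf r rg.
have tr' : `|set_val t - set_val (pt r)| < d by rewrite tptK.
have h1 := hd _ _ _ _ (r1 n) (W n) _ _ tr'.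
have h2 := hd _ _ _ _ (r1 (f a)) (W (f a)) _ _ tr'.
rewrite cmapB (_ : x n t - x (f a) t = (x n t - x n (pt r)) + (x n (pt r) - a r) -
  (x (f a) (pt r) - a r) - (x (f a) t - x (f a) (pt r))).
  have n1 := ler_normB ((x n t - x n (pt r)) + (x n (pt r) - a r) -
    (x (f a) (pt r) - a r)) (x (f a) t - x (f a) (pt r)).
  have n2 := ler_normB ((x n t - x n (pt r)) + (x n (pt r) - a r)) (x (f a) (pt r) - a r).
  have n3 := ler_normD (x n t - x n (pt r)) (x n (pt r) - a r).
  by apply: le_trans n1 _; lra.
by rewrite !opprB !addrA !subrK.
Qed.

End Sequence.

End Compactness.

Section SequentialCompactness.
Context {R : realType} {W : normedModType R} (K : set W).

(** Cluster points exclude infinite e-separated sequences, which gives total boundedness, and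
    provide a uniform radius for any near-covering; a finite net then finishes. *)
Lemma sequence_compact : (forall x : nat -> W, (forall n, K (x n)) ->
    exists2 y, K y & forall (e : R) N, 0 < e -> exists2 n, (N <= n)%N & `|x n - y| < e) ->
  compact K.
Proof.
move=> hK.
have tK : tbd K.
  move=> e e0; apply: contrapT => nK.
  have /choice[f hf] : forall s : seq W, exists x, K x /\ forall c, c \in s -> e <= `|x - c|.
    move=> s; apply: contrapT => /forallNP ns; apply: nK; exists s => x Kx.
    apply: contrapT => nx; apply: (ns x); split=> // c cs; rewrite leNgt; apply/negP => xc.
    by apply: nx; exists c.
  pose g := fix g n := if n is n'.+1 then f (g n') :: g n' else [::].
  have gin i j : (i < j)%N -> f (g i) \in g j.
    elim: j => // j IH; rewrite ltnS leq_eqVlt /= inE => /predU1P[->|/IH ->].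
      by rewrite eqxx.
    by rewrite orbT.
  have [y Ky hy] := hK (fun n => f (g n)) (fun n => (hf (g n)).1).
  have e2 : 0 < e / 2 by rewrite divr_gt0.
  have [n _ h1] := hy _ 0%N e2; have [n' nn' h2] := hy _ n.+1 e2.
  have := (hf (g n')).2 _ (gin n n' nn'); rewrite leNgt => /negP; apply.
  rewrite -(subrK y (f (g n'))) -addrA; apply: le_lt_trans (ler_normD _ _) _.
  by rewrite [e]splitr ltrD// distrC.
apply/compact_near_coveringP => I G P fG hP.
have [e e0 he] : exists2 e : R, 0 < e & forall x, K x ->
    exists2 A, G A & forall x' i, `|x - x'| < e -> A i -> P i x'.
  apply: contrapT => nE.
  have /choice[x hx] : forall n, exists x, K x /\ ~ exists2 A, G A &
      forall x' i, `|x - x'| < n.+1%:R^-1 -> A i -> P i x'.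
    move=> n; apply: contrapT => /forallNP nx; apply: nE.
    exists n.+1%:R^-1; first by rewrite invr_gt0 ltr0n.
    by move=> x Kx; apply: contrapT => h; apply: (nx x).
  have [y Ky hy] := hK x (fun n => (hx n).1).
  have [[U A] /= [/nbhs_ballP[r /= r0 rU] GA] UAP] := hP y Ky.
  have r2 : 0 < r / 2 by rewrite divr_gt0.
  have [N hN] := small_invS r2; have [n nN xy] := hy _ N r2.
  apply: (hx n).2; exists A => // x' i xx' Ai; apply: (UAP (x', i)); split=> //=.
  apply: rU; rewrite -ball_normE /= -(subrK (x n) y) -addrA.
  apply: le_lt_trans (ler_normD _ _) _; rewrite [r]splitr ltrD//; first by rewrite distrC.
  apply: lt_trans xx' _; apply: le_lt_trans hN.
  by rewrite lef_pV2 ?posrE ?ltr0n// ler_nat.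
have [s [sK hs]] := tbd_in tK e0.
have [A GA hA] : exists2 A, G A & forall c, c \in s -> forall x' i, `|c - x'| < e ->
    A i -> P i x'.
  elim: s sK {hs} => [|c s IH] sK; first by exists setT => //; exact: filterT.
  have [|A GA hA] := IH; first by move=> c' c's; apply: sK; rewrite inE c's orbT.
  have [A' GA' hA'] := he c (sK c (mem_head _ _)).
  exists (A `&` A'); first exact: filterI.
  move=> c'; rewrite inE => /predU1P[->|c's] x' i cx [Ai A'i]; first exact: (hA' x' i).
  exact: (hA c').
apply: (filterS _ GA) => i Ai x Kx; have [c cs xc] := hs x Kx.
by apply: (hA c cs) => //; rewrite distrC.
Qed.

End SequentialCompactness.

(** * Limits of approximate solutions and compactness of the solution set *)

Section SolutionSet.
Context {R : realType} {E : completeNormedModType R} (T : R).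
Hypothesis T0 : 0 <= T.
Local Notation mu := (@lebesgue_measure R).
Local Notation D := (tint T).
Local Notation C := (cmap T E).
Local Notation pt := (tpt T0).
Variables (k : R -> R -> blin E E) (m c eta : R -> R^o) (F : R -> E -> set E).
Variable M : set C.
Hypothesis dat : inclusion_data k m c eta F M.
Local Notation witness := (witness T0 k F M).
Local Notation sol := (sol T0 k F M).

Definition solutions := [set x : C | exists h w, [/\ M h, isV k w (x - h) &
  \forall s \ae mu, D s -> F s (x (pt s)) (w s)]].

Let mD : measurable (D : set R). Proof. exact: measurable_tint. Qed.
Let kK := id_kernel dat.
Let sm : smeas m. Proof. by case: kK. Qed.
Let m0 s : 0 <= (m s : R). Proof. by case: kK. Qed.
Let c0 := id_c0 dat.

Lemma solutions_sol r : 0 <= r -> solutions `<=` sol r.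
Proof.
move=> r0 x [h [w [Mh Vw ws]]]; exists h, w; split=> //.
apply: ae_imp ws => s h1 Ds; apply: sub_hull; exists (x (pt s)); last exact: h1.
by rewrite /= subrr normr0.
Qed.

(* A limit of approximate selections is a selection: a functional separating it
   from F s y would, by upper hemicontinuity, separate it from F s z for z
   near y. *)
Lemma closed_graph s y (v : E) (rho : nat -> R) (w : nat -> E) : D s ->
  upper_hemicontinuous (F s) -> rho n @[n --> \oo] --> (0 : R) ->
  (forall n, Fhull F (rho n) s y (w n)) -> w n @[n --> \oo] --> v -> F s y v.
Proof.
move=> Ds usc rho0 wF wv; have [F0 Fc Fv] := id_F1 dat y Ds.
apply: contrapT => nF; have [f [a [fa af]]] := separation Fc Fv F0 nF.
pose a' := (a + f v) / 2; have aa' : a < a' by rewrite /a'; lra.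
have a'f : a' < f v by rewrite /a'; lra.
have [U /nbhs_ballP[r /= r0 rU] hU] : exists2 V, nbhs y V & forall z, V z ->
    (ereal_sup [set (f u : R)%:E | u in F s z] < a'%:E)%E.
  apply: usc; apply: (@le_lt_trans _ _ a%:E); last by rewrite lte_fin.
  by apply: ge_ereal_sup => _ [u Fu <-]; rewrite lee_fin; exact: fa.
have near_r : \forall n \near \oo, (f (w n) : R) <= a'.
  have /cvgrPdist_lt /(_ r r0) := rho0; apply: filterS => n; rewrite sub0r normrN => rn.
  have cH : convex_set [set u : E | (f u : R) <= a'].
    apply: convex_setP => u u' t /= hu hu' t0 t1.
    rewrite blinD !blinZ; have t1' : 0 <= 1 - t by rewrite subr_ge0.
    have := ler_wpM2l t0 hu; have := ler_wpM2l t1' hu'.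
    change (1 - t) with (1 - t) => h1 h2.
    have -> : a' = t * a' + (1 - t) * a' by ring.
    exact: lerD.
  apply: (hull_min cH _ (wF n)) => u [z /= zy Fu].
  have zU : U z.
    apply: rU; rewrite -ball_normE /= distrC; apply: le_lt_trans zy _.
    exact: le_lt_trans (ler_norm _) rn.
  have := hU z zU; move=> /ltW; apply: contraTT.
  rewrite -!ltNge => fu; apply: (lt_le_trans (y := (f u : R)%:E)); first by rewrite lte_fin.
  by apply: ereal_sup_ubound; exists u.
have fw : (f (w n) : R) @[n --> \oo] --> (f v : R).
  exact: (continuous_cvg _ (@blin_continuous _ _ _ f v) wv).
have : (f v : R) <= a'.
  by rewrite -(cvg_lim _ fw)//; apply: limr_le => //; exact: cvgP fw.
by rewrite leNgt a'f.
Qed.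

(** The trajectories are first made to converge to y along a subsequence; convex combinations formed
    afterwards still converge to y, and the inclusion can be tested at this fixed state. Compactness
    of M then supplies the inhomogeneity. *)
Lemma sol_cluster (x : nat -> C) : (forall n, sol n.+1%:R^-1 (x n)) ->
  exists2 y, solutions y &
    forall (e : R) N, 0 < e -> exists2 n, (N <= n)%N & `|x n - y| < e.
Proof.
move=> /choice[h0 /choice[w0 W0]].
have [phi0 [phi0j cphi0]] := tbd_cauchy (tbd_trajectories dat W0).
have [y xy] := cmap_cauchy_cvg T0 cphi0.
have /choice[phi hphi] : forall j, exists n, (j <= n)%N /\ `|x n - y| < j.+1%:R^-1.
  move=> j; have j0 : 0 < j.+1%:R^-1 :> R by rewrite invr_gt0 ltr0n.
  have /cvgrPdist_lt /(_ _ j0)[N _ hN] := xy.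
  exists (phi0 (maxn N j)); split; first by apply: leq_trans (phi0j _); exact: leq_maxr.
  by rewrite distrC; apply: hN; exact: leq_maxl.
exists y; last first.
  move=> e N e0; have [j je] := small_invS e0; have [h1 h2] := hphi (maxn N j).
  exists (phi (maxn N j)); first by apply: leq_trans h1; exact: leq_maxl.
  apply: lt_trans h2 _; apply: le_lt_trans je.
  by rewrite lef_pV2 ?posrE ?ltr0n// ler_nat ltnS; exact: leq_maxr.
have invS i j : (i <= j)%N -> j.+1%:R^-1 <= i.+1%:R^-1 :> R.
  by move=> ij; rewrite lef_pV2 ?posrE ?ltr0n// ler_nat.
pose x' j := x (phi j); pose h j := h0 (phi j); pose w j := w0 (phi j).
have Ww j : witness j.+1%:R^-1 (x' j) (h j) (w j).
  have [Mh Vw ws] := W0 (phi j); split=> //; apply: ae_imp ws => s hs Ds.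
  by apply: FhullS (hs Ds); apply: invS; case: (hphi j).
have sw j : smeas (w j) by have [_ []] := Ww j.
(* State and inhomogeneity travel with the selection, so that the combined triples still satisfy the
   integral equation. *)
have [z [u [zh su zu]]] := forward_convex_vector mD (tint_fin T) (fun j => (x' j, h j) : C * C)
  sw (tbd_selections dat Ww).
(* One term for the radius in [witness], one for the distance of the state from y. *)
pose rho n : R := n.+1%:R^-1 + n.+1%:R^-1.
pose Cn n := [set p : (R -> E) * (C * C) | [/\ isV k p.1 (p.2.1 - p.2.2), M p.2.2,
  `|p.2.1 - y| <= n.+1%:R^-1 &
  \forall s \ae mu, D s -> Fhull F (rho n) s (y (pt s)) (p.1 s)]].
have Cnc n : convex_set (Cn n).
  apply: convex_setP => -[w1 [x1 h1]] [w2 [x2 h2]] t /= [V1 M1 y1 f1] [V2 M2 y2 f2] t0 t1.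
  have t1' : 0 <= 1 - t by rewrite subr_ge0.
  split=> /=.
  - have V2' := isVD (1 - t) V2 (isV0 T k); have := isVD t V1 V2'.
    congr (isV _ _ _); last by rewrite addr0 !scalerBr opprD addrACA.
    by apply/funext => s; rewrite addr0.
  - exact: convex_setE (id_Mv dat) _ _ _ _.
  - have -> : t *: x1 + (1 - t) *: x2 - y = t *: (x1 - y) + (1 - t) *: (x2 - y).
      by rewrite !scalerBr addrACA -opprD -scalerDl [t + _]addrC subrK scale1r.
    apply: le_trans (ler_normD _ _) _; rewrite !normrZ (ger0_norm t0) (ger0_norm t1').
    have -> : n.+1%:R^-1 = t * n.+1%:R^-1 + (1 - t) * n.+1%:R^-1 :> R by ring.
    by apply: lerD; apply: ler_wpM2l.
  - have := ae_and f1 f2; apply: ae_imp => s [{}f1 {}f2] Ds.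
    exact: (convex_setE (@hull_convex _ _ _) (f1 Ds) (f2 Ds) t0 t1).
have Cz n : Cn n (z n).
  apply: (hull_min (Cnc n) _ (zh n)) => _ [j nj ->]; have [Mh Vw ws] := Ww j.
  split=> //=.
    by have [_ /ltW h1] := hphi j; apply: le_trans h1 _; exact: invS.
  apply: ae_imp ws => s hs Ds; apply: hullS (hs Ds) => v [b /= bx Fv].
  exists b => //=; rewrite -(subrK (x' j (pt s)) b) -addrA.
  apply: le_trans (ler_normD _ _) _; apply: lerD.
    by apply: le_trans bx _; exact: invS.
  have [_ /ltW h1] := hphi j; apply: le_trans (invS _ _ nj); apply: le_trans h1.
  by rewrite -cmapB; exact: cmap_le.
pose hz n := (z n).2.2; pose xz n := (z n).2.1; pose wz n := (z n).1.
have [phi1 [phi1j cphi1]] : exists phi : nat -> nat, (forall j, (j <= phi j)%N) /\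
    forall e : R, 0 < e -> exists N, forall n n', (N <= n)%N -> (N <= n')%N ->
      `|hz (phi n) - hz (phi n')| < e.
  apply: tbd_cauchy => e e0; apply: fcov_sub (compact_tbd (id_Mc dat) e0) => _ [n _ <-].
  by have [] := Cz n.
have [hl hzl] := cmap_cauchy_cvg T0 cphi1.
have phi1cvg : phi1 @ \oo --> \oo.
  by move=> A [N _ NA]; exists N => // n /= Nn; apply: NA; exact: leq_trans (phi1j n).
have Mhl : M hl.
  have Mcl : closed M by apply: compact_closed (id_Mc dat); exact: norm_hausdorff.
  have near_M : \forall n \near \oo, M (hz (phi1 n)) by apply: nearW => n; have [] := Cz (phi1 n).
  exact: (closed_cvg _ Mcl near_M _ hzl).
have rho0 : rho n @[n --> \oo] --> (0 : R).
  rewrite -[X in _ --> X](addr0 (0 : R)).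
  by apply: cvgD; exact: cvg_harmonic.
have xzl : xz (phi1 n) @[n --> \oo] --> y.
  apply/cvgrPdist_lt => e e0; have [N Ne] := small_invS e0; exists N => // n /= Nn.
  have [_ _ h1 _] := Cz (phi1 n); rewrite distrC; apply: le_lt_trans h1 _.
  by apply: le_lt_trans Ne; apply: invS; exact: leq_trans (phi1j n).
have uF : \forall s \ae mu, D s -> F s (y (pt s)) (u s).
  have fz : \forall s \ae mu, forall n, D s -> Fhull F (rho n) s (y (pt s)) (wz n s).
    by apply: ae_all => n; have [] := Cz n.
  have := ae_and (ae_and (id_F3 dat) zu) fz; apply: ae_imp => s [[usc {}zu] {}fz] Ds.
  by apply: (closed_graph Ds (usc Ds) rho0 _ (zu Ds)) => n; exact: fz.
exists hl, u; split=> //.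
(* The constant 3 bounds 1 + [rho n], as [rho n] is at most 2. *)
pose g s := (3 + `|y|) *: (m s *: c s) : R^o.
have smc : smeas (fun s => m s *: c s : R^o) by exact: (smeasZ sm (id_sc dat)).
have sg : smeas g by exact: (smeasZl (3 + `|y|) smc).
have g1 : (L1 D g < +oo)%E.
  by rewrite (L1Z mD _ smc) lte_mul_pinfty ?(id_mc dat)// lee_fin.
apply: (isV_lim kK (u_ := fun n => wz (phi1 n)) (v_ := fun n => xz (phi1 n) - hz (phi1 n))
  _ su sg g1).
- by move=> n; have [] := Cz (phi1 n).
- have fz : \forall s \ae mu, forall n, D s -> Fhull F (rho n) s (y (pt s)) (wz n s).
    by apply: ae_all => n; have [] := Cz n.
  have := ae_and fz (Fhull_norm dat); apply: ae_imp => s [{}fz fn] Ds n.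
  have h1 := fn Ds _ _ _ (fz (phi1 n) Ds); apply: (le_trans (ler_wpM2l (m0 s) h1)).
  rewrite /g /= mulrA mulrC ler_wpM2r ?mulr_ge0//.
  apply: lerD; last exact: cmap_le.
  have h2 : (phi1 n).+1%:R^-1 <= 1 :> R by rewrite invf_le1// ler1n.
  apply: (@le_trans _ _ (1 + (1 + 1) : R)); first by rewrite lerD2l; exact: lerD.
  by lra.
- apply: ae_imp zu => s h1 /h1 h2; exact: cvg_comp phi1cvg h2.
move=> t; apply/cvgrPdist_lt => e e0.
have vl : (xz (phi1 n) - hz (phi1 n)) @[n --> \oo] --> y - hl by exact: cvgB.
have /cvgrPdist_lt /(_ e e0) := vl; apply: filterS => n; apply: le_lt_trans.
by rewrite -cmapB; exact: cmap_le.
Qed.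

Lemma compact_solutions : compact solutions.
Proof.
apply: sequence_compact => x xS; apply: sol_cluster => n; exact: solutions_sol.
Qed.

Lemma sol_near_solutions (e : R) : 0 < e -> exists2 r : R, 0 < r &
  forall x, sol r x -> exists2 y, solutions y & `|x - y| < e.
Proof.
move=> e0; apply: contrapT => nE.
have /choice[x hx] : forall n, exists x, sol n.+1%:R^-1 x /\
    forall y, solutions y -> e <= `|x - y|.
  move=> n; apply: contrapT => /forallNP nx; apply: nE.
  exists n.+1%:R^-1; first by rewrite invr_gt0 ltr0n.
  move=> x sx; apply: contrapT => ny; apply: (nx x); split=> // y Sy.
  by rewrite leNgt; apply/negP => xy; apply: ny; exists y.
have [y Sy hy] := sol_cluster (fun n => (hx n).1).
have [n _ xy] := hy e 0%N e0.
by have := (hx n).2 y Sy; rewrite leNgt xy.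
Qed.

Lemma solutions_neq0 : (forall r : R, 0 < r -> sol r !=set0) -> solutions !=set0.
Proof.
move=> h; have [|r r0 hr] := @sol_near_solutions 1; first exact: ltr01.
by have [x /hr[y Sy _]] := h r r0; exists y.
Qed.

End SolutionSet.

(** * Euler polygons and acyclicity *)

Lemma max0_lip (R : realType) (a b : R) : `|Num.max 0 a - Num.max 0 b| <= `|a - b|.
Proof.
by case: (leP 0 a); case: (leP 0 b) => h1 h2; have := ler_norm (a - b);
  have := ler_norm (b - a); rewrite [`|b - a|]distrC ler_norml; lra.
Qed.

Lemma min_lip (R : realType) (t a b : R) : `|Num.min t a - Num.min t b| <= `|a - b|.
Proof.
by case: (leP t a); case: (leP t b) => h1 h2; have := ler_norm (a - b);
  have := ler_norm (b - a); rewrite [`|b - a|]distrC ler_norml; lra.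
Qed.

Section UniformContinuity.
Context {R : realType} (P : Type) (dP : P -> P -> R).

(** P is a bare parameter type with a gauge dP in the role of a distance; it will be a one-point
    type or the type of pairs of a solution and a time. *)
Definition uc (W : normedModType R) (f : P -> W) := forall e : R, 0 < e ->
  exists2 d : R, 0 < d & forall p q, dP p q < d -> `|f p - f q| < e.

Definition tbd_dist := forall d : R, 0 < d -> exists n (a : nat -> P),
  forall p, exists2 i, (i < n)%N & dP p (a i) < d.

Lemma uc_cst (W : normedModType R) (a : W) : uc (fun=> a).
Proof. by move=> e e0; exists 1 => // p q _; rewrite subrr normr0. Qed.

Lemma uc_lip (W W' : normedModType R) (f : P -> W) (g : P -> W') (L : R) : uc f -> 0 <= L ->
  (forall p q, `|g p - g q| <= L * `|f p - f q|) -> uc g.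
Proof.
move=> uf L0 gf e e0; have L1 : 0 < L + 1 by rewrite ltr_wpDl.
have [d d0 hd] := uf _ (divr_gt0 e0 L1); exists d => // p q pq.
apply: le_lt_trans (gf p q) _; apply: (@le_lt_trans _ _ ((L + 1) * `|f p - f q|)).
  by rewrite ler_wpM2r// lerDl.
by rewrite mulrC -ltr_pdivlMr//; exact: hd.
Qed.

Lemma ucD (W : normedModType R) (f g : P -> W) : uc f -> uc g ->
  uc (fun p => f p + g p).
Proof.
move=> uf ug e e0; have e2 : 0 < e / 2 by rewrite divr_gt0.
have [d d0 hd] := uf _ e2; have [d' d'0 hd'] := ug _ e2.
exists (Num.min d d'); first by rewrite lt_min d0.
move=> p q; rewrite lt_min => /andP[h1 h2]; rewrite opprD addrACA.
by apply: le_lt_trans (ler_normD _ _) _; rewrite [e]splitr ltrD// ?hd ?hd'.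
Qed.

Lemma ucZ (W : normedModType R) (a : P -> R^o) (f : P -> W) (A B : R) : uc a -> uc f ->
  (forall p, `|a p| <= A) -> (forall p, `|f p| <= B) -> uc (fun p => a p *: f p).
Proof.
move=> ua uf aA fB e e0; pose K := `|A| + `|B| + 1.
have K0 : 0 < K by rewrite ltr_wpDl// addr_ge0.
have eK : 0 < e / K / 2 by rewrite !divr_gt0.
have [d d0 hd] := ua _ eK; have [d' d'0 hd'] := uf _ eK.
exists (Num.min d d'); first by rewrite lt_min d0.
move=> p q; rewrite lt_min => /andP[h1 h2]; have {}h1 := hd _ _ h1; have {}h2 := hd' _ _ h2.
have -> : a p *: f p - a q *: f q = (a p - a q) *: f p + a q *: (f p - f q).
  by rewrite scalerBl scalerBr addrA subrK.
apply: le_lt_trans (ler_normD _ _) _; rewrite !normrZ.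
have AK : `|a q| <= K.
  by apply: le_trans (aA q) _; rewrite /K; have := ler_norm A; have := normr_ge0 B; lra.
have BK : `|f p| <= K.
  by apply: le_trans (fB p) _; rewrite /K; have := ler_norm B; have := normr_ge0 A; lra.
have -> : e = e / K / 2 * K + K * (e / K / 2).
  rewrite [K * _]mulrC -mulrDl -splitr -mulrA mulVf ?mulr1//; exact: lt0r_neq0.
apply: ler_ltD.
  by apply: ler_pM => //; exact: ltW.
apply: (@le_lt_trans _ _ (K * `|f p - f q|)); first by rewrite ler_wpM2r.
by rewrite ltr_pM2l.
Qed.

Lemma uc_sum (W : normedModType R) (I : eqType) (r : seq I) (f : I -> P -> W) :
  (forall i, i \in r -> uc (f i)) -> uc (fun p => \sum_(i <- r) f i p).
Proof.
elim: r => [|i r IH] uf.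
  rewrite (_ : (fun _ => _) = fun=> 0); first exact: uc_cst.
  by apply/funext => p; rewrite big_nil.
rewrite (_ : (fun _ => _) = fun p => f i p + \sum_(i <- r) f i p).
  by apply: ucD; [apply: uf; rewrite mem_head|apply: IH => j jr; apply: uf; rewrite inE jr orbT].
by apply/funext => p; rewrite big_cons.
Qed.

Lemma uc_tbd (W : normedModType R) (f : P -> W) : tbd_dist -> uc f -> tbd (range f).
Proof.
move=> tP uf e e0; have [d d0 hd] := uf e e0; have [n [a ha]] := tP d d0.
exists (mkseq (fun i => f (a i)) n) => _ [p _ <-]; have [i ni pi] := ha p.
exists (f (a i)); last exact: hd.
by apply/mapP; exists i => //; rewrite mem_iota.
Qed.

End UniformContinuity.

(** * Lipschitz partitions of unity *)

Section PartitionOfUnity.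
Context {R : realType} {W : normedModType R}.
Variables (zs : seq W) (r : R).
Hypothesis r0 : 0 < r.

(** Supported in the ball of radius 2 r but at least r on the ball of radius r: on covered points
    the sum of the bumps is at least r, which gives the quotients a Lipschitz constant. *)
Definition bump (z y : W) : R := Num.max 0 (2 * r - `|y - z|).
Definition bumps y : R := \sum_(z <- zs) bump z y.
Definition pu z y : R := bump z y / bumps y.

Definition covered y := exists2 z, z \in zs & `|y - z| < r.

Lemma bump_ge0 z y : 0 <= bump z y.
Proof. by rewrite le_max lexx. Qed.

Lemma bump_lip z y y' : `|bump z y - bump z y'| <= `|y - y'|.
Proof.
have h1 := ler_distD y z y'; have h2 := ler_distD y' z y.
rewrite [`|z - y|]distrC in h1 h2; rewrite [`|z - y'|]distrC in h1 h2.
rewrite [`|y' - y|]distrC in h2; rewrite /bump ler_norml.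
by case: (leP 0 (2 * r - `|y - z|)); case: (leP 0 (2 * r - `|y' - z|)); lra.
Qed.

Lemma bumps_lip y y' : `|bumps y - bumps y'| <= (size zs)%:R * `|y - y'|.
Proof.
rewrite /bumps; elim: zs => [|z s IH].
  by rewrite !big_nil subrr normr0 mul0r.
rewrite !big_cons opprD addrACA; apply: le_trans (ler_normD _ _) _.
by rewrite /= -nat1r mulrDl mul1r lerD// bump_lip.
Qed.

Lemma bumps_ge0 y : 0 <= bumps y.
Proof. by apply: sumr_ge0 => z _; exact: bump_ge0. Qed.

Lemma bump_le z y : z \in zs -> bump z y <= bumps y.
Proof.
move=> zz; rewrite /bumps (perm_big _ (perm_to_rem zz)) big_cons lerDl.
by apply: sumr_ge0 => z' _; exact: bump_ge0.
Qed.

Lemma bumps_ge y : covered y -> r <= bumps y.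
Proof.
move=> [z zz yz]; apply: le_trans (bump_le y zz).
by rewrite /bump le_max; apply/orP; right; lra.
Qed.

Lemma pu_ge0 z y : 0 <= pu z y.
Proof. by rewrite divr_ge0 ?bump_ge0 ?bumps_ge0. Qed.

Lemma pu_le1 z y : z \in zs -> pu z y <= 1.
Proof.
move=> zz; have [y0|y0] := eqVneq (bumps y) 0; first by rewrite /pu y0 invr0 mulr0.
by rewrite ler_pdivrMr ?mul1r ?bump_le// lt_neqAle eq_sym y0 bumps_ge0.
Qed.

Lemma pu_sum y : covered y -> \sum_(z <- zs) pu z y = 1.
Proof.
move=> /bumps_ge ry; rewrite /pu -mulr_suml mulfV// gt_eqF//; exact: lt_le_trans ry.
Qed.

Lemma pu_gt0 z y : 0 < pu z y -> `|y - z| < 2 * r.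
Proof.
apply: contraTT; rewrite -!leNgt => h.
by rewrite /pu /bump (max_idPl _) ?mul0r// subr_le0.
Qed.

Lemma pu_lip z y y' : z \in zs -> covered y -> covered y' ->
  `|pu z y - pu z y'| <= (1 + (size zs)%:R) / r * `|y - y'|.
Proof.
move=> zz /bumps_ge cy /bumps_ge cy'.
have b0 : 0 < bumps y by exact: lt_le_trans cy.
have b0' : 0 < bumps y' by exact: lt_le_trans cy'.
have -> : pu z y - pu z y' =
    (bump z y - bump z y' + pu z y' * (bumps y' - bumps y)) / bumps y.
  by rewrite /pu; field; rewrite !gt_eqF.
rewrite normrM normfV (gtr0_norm b0) ler_pdivrMr//.
have h1 := bump_lip z y y'; have := bumps_lip y' y; rewrite [`|y' - y|]distrC => h2.
apply: (@le_trans _ _ ((1 + (size zs)%:R) * `|y - y'|)).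
  apply: le_trans (ler_normD _ _) _; rewrite mulrDl mul1r lerD// normrM.
  apply: le_trans h2; rewrite ler_piMl// ger0_norm ?pu_ge0//; exact: pu_le1.
rewrite -!mulrA ler_wpM2l ?addr_ge0// mulrCA ler_peMr//.
by rewrite mulrC ler_pdivlMr// mul1r.
Qed.

Lemma hull_pu (V : lmodType R) (A : set V) (f : W -> V) y : covered y ->
  (forall z, z \in zs -> `|y - z| < 2 * r -> A (f z)) ->
  hull A (\sum_(z <- zs) pu z y *: f z).
Proof.
move=> cy Af; pose a z := if z \in zs then pu z y else 0.
have -> : \sum_(z <- zs) pu z y *: f z = \sum_(z <- zs) a z *: f z.
  by rewrite !big_seq; apply: eq_bigr => z zz; rewrite /a zz.
apply: hull_sum => [z||z].
- by rewrite /a; case: ifP => // _; exact: pu_ge0.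
- by rewrite -[RHS](pu_sum cy) !big_seq; apply: eq_bigr => z zz; rewrite /a zz.
rewrite /a; case: ifPn => [zz az|_]; last by rewrite ltxx.
by apply: sub_hull; apply: Af => //; exact: pu_gt0.
Qed.

End PartitionOfUnity.

(** * Mean value inequality and bounds for the kernel *)

Section MeanValue.
Context {R : realType} {W : normedModType R}.

Lemma derivative_within_near (f : R -> W) (A : set R) t l (K : R) : derivative_within f A t l ->
  `|l| < K -> exists2 d : R, 0 < d & forall u, A u -> `|u - t| < d ->
    `|f u - f t| <= K * `|u - t|.
Proof.
move=> df lK; have e0 : 0 < K - `|l| by rewrite subr_gt0.
have K0 : 0 <= K by apply: le_trans (ltW lK).
have /cvgrPdist_lt /(_ _ e0) near := df.
have {near} : \forall u \near t, u != t -> A u ->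
    `|l - (u - t)^-1 *: (f u - f t)| < K - `|l| by exact: near.
move=> /nbhs_ballP[d /= d0 hd]; exists d => // u Au ut.
have [->|tu] := eqVneq u t; first by rewrite !subrr !normr0 mulr0.
have h : `|l - (u - t)^-1 *: (f u - f t)| < K - `|l|.
  by apply: hd => //; rewrite -ball_normE /= distrC.
have ut0 : 0 < `|u - t| by rewrite normr_gt0 subr_eq0.
rewrite -ler_pdivrMr// mulrC -[X in X * _]normfV -normrZ.
rewrite -[X in `|X|](subrK l) addrC; apply: le_trans (ler_normD _ _) _.
by rewrite -lerBrDl distrC ltW.
Qed.

(** The derivative may be discontinuous, so the inequality is propagated with a slightly larger
    constant K' up to a supremum s, and past s by differentiability there unless s = b. *)
Lemma mean_value (f : R -> W) (a b c K : R) (l : R -> W) : c <= a -> a <= b ->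
  (forall t, a <= t -> t <= b -> derivative_within f [set` `[c, b]] t (l t)) ->
  (forall t, a <= t -> t <= b -> `|l t| <= K) ->
  `|f b - f a| <= K * (b - a).
Proof.
move=> ca ab df lK; apply/ler_addgt0Pr => e e0.
have [->|ltab] := eqVneq a b; first by rewrite !subrr normr0 mulr0 add0r ltW.
have {ltab}ab' : a < b by rewrite lt_neqAle ltab.
pose K' := K + e / (b - a); have ba0 : 0 < b - a by rewrite subr_gt0.
have KK' : K < K' by rewrite ltrDl divr_gt0.
have -> : K * (b - a) + e = K' * (b - a) by rewrite mulrDl divfK// gt_eqF.
pose good t := a <= t /\ t <= b /\ forall r, a <= r -> r <= t -> `|f r - f a| <= K' * (r - a).
have ga : good a.
  split=> //; split=> // r ar ra; have -> : r = a by apply/eqP; rewrite eq_le ra ar.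
  by rewrite !subrr normr0 mulr0.
have hs : has_sup good by split; [exists a|exists b => t [_ []]].
pose s := sup good.
have sa : a <= s by apply: ub_le_sup ga; case: hs.
have sb : s <= b by apply: ge_sup; [exists a|move=> t [_ []]].
have [d d0 hd] := derivative_within_near (df s sa sb) (le_lt_trans (lK s sa sb) KK').
have below r : a <= r -> r < s -> `|f r - f a| <= K' * (r - a).
  move=> ar rs; have sr0 : 0 < s - r by rewrite subr_gt0.
  have [t [_ [_ gt]] rt] := sup_adherent sr0 hs.
  by apply: gt => //; rewrite subKr in rt; exact: ltW.
have gs : `|f s - f a| <= K' * (s - a).
  have [->|as_] := eqVneq s a; first by rewrite !subrr normr0 mulr0.
  have {}as_ : a < s by rewrite lt_neqAle eq_sym as_.
  pose r := Num.max a (s - d / 2).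
  have rs : r < s by rewrite gt_max as_/= ltrBlDr ltrDl divr_gt0.
  have ar : a <= r by rewrite le_max lexx.
  have h1 := below r ar rs.
  have h2 : `|f r - f s| <= K' * `|r - s|.
    apply: hd; first by rewrite /= in_itv/= (le_trans ca ar) (le_trans (ltW rs) sb).
    rewrite distrC gtr0_norm ?subr_gt0// ltrBlDr -ltrBlDl.
    by rewrite lt_max; apply/orP; right; rewrite ltrD2l ltrN2 ltr_pdivrMr// ltr_pMr// ltr1n.
  rewrite -(subrK (f r) (f s)) -addrA; apply: le_trans (ler_normD _ _) _.
  rewrite distrC in h2; apply: le_trans (lerD h2 h1) _.
  by rewrite distrC gtr0_norm ?subr_gt0// -mulrDr addrA subrK.
have ext u : s <= u -> u <= b -> u - s < d -> `|f u - f a| <= K' * (u - a).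
  move=> su ub us; have h2 : `|f u - f s| <= K' * `|u - s|.
    apply: hd; first by rewrite /= in_itv/= ub (le_trans ca (le_trans sa su)).
    by rewrite ger0_norm ?subr_ge0.
  rewrite -(subrK (f s) (f u)) -addrA; apply: le_trans (ler_normD _ _) _.
  apply: le_trans (lerD h2 gs) _.
  by rewrite ger0_norm ?subr_ge0// -mulrDr addrA subrK.
have [bs|sb'] := leP b s; first by have -> : b = s by [apply/eqP; rewrite eq_le bs sb].
have su1 : s < Num.min b (s + d / 2) by rewrite lt_min sb' ltrDl divr_gt0.
have gu : good (Num.min b (s + d / 2)).
  split; first exact: le_trans sa (ltW su1).
  split; first by rewrite ge_min lexx.
  move=> r ar ru; have [rs|sr] := ltP r s; first exact: below.
  move: ru; rewrite le_min => /andP[rb rd]; apply: ext => //.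
  rewrite ltrBlDl; apply: le_lt_trans rd _.
  by rewrite ltrD2l ltr_pdivrMr// ltr_pMr// ltr1n.
have : Num.min b (s + d / 2) <= s by apply: ub_le_sup gu; case: hs.
by rewrite leNgt su1.
Qed.

End MeanValue.

Lemma continuous_smeas (R : realType) (W : normedModType R) (f : R -> W) : continuous f -> smeas f.
Proof.
move=> cf; have /smeas_comp : continuous (f : R^o -> W) by [].
apply; exact: (measurable_smeas (f := id)).
Qed.

Section KernelBounds.
Context {R : realType} {E : completeNormedModType R} (T : R).
Hypothesis T0 : 0 <= T.
Local Notation mu := (@lebesgue_measure R).
Local Notation D := (tint T).
Variables (k dk : R -> R -> blin E E) (nu : R -> R) (nu' : R -> R^o).
Hypothesis k1 : forall t s, 0 <= s -> s <= t -> t <= T ->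
  derivative_within (k^~ s) [set` `[s, T]] t (dk t s).
Hypothesis k2 : forall t, D t -> {within [set` `[0, t]], continuous (k t)}.
Hypothesis k3 : {within D, continuous (fun t => k t t)}.
Hypothesis k4 : forall t s, 0 <= s -> s <= t -> t <= T -> `|dk t s| <= nu s.
Hypotheses (snu : smeas nu') (nuE : \forall s \ae mu, D s -> nu s = nu' s).

Lemma kernel_lip s t t' : 0 <= s -> s <= t -> t <= t' -> t' <= T ->
  `|k t' s - k t s| <= nu s * (t' - t).
Proof.
move=> s0 st tt tT.
apply: (@mean_value _ _ (k^~ s) t t' s (nu s) (dk^~ s)) => // r tr rt.
  have df := k1 s0 (le_trans st tr) (le_trans rt tT).
  apply: cvg_trans df; apply: cvg_app => U /= hU.
  have {}hU : \forall u \near r, u != r -> [set` `[s, T]] u -> U u by exact: hU.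
  have : \forall u \near r, u != r -> [set` `[s, t']] u -> U u; last exact.
  apply: filterS hU => u hu ur Au; apply: hu => //.
  by move: Au; rewrite /= !in_itv/= => /andP[-> /le_trans ->].
by apply: k4 => //; [exact: le_trans tr|exact: le_trans tT].
Qed.

(** The norm of [k t s] is at most that of [k s s] plus t - s times the Lipschitz constant. C bounds
    the diagonal by k3, and T + 1 dominates both T and 1, the factors of nu in the two estimates. *)
Lemma volterra_kernel_exists : exists C : R, 0 <= C /\
  volterra_kernel T k (fun s => C + (T + 1) * `|nu' s| : R^o).
Proof.
have [C C0 hC] : exists2 C : R, 0 <= C & forall s, D s -> `|k s s| <= C.
  have := continuous_compact k3 (@segment_compact R 0 T).
  move=> /compact_bounded[N [_ hN]]; exists (`|N| + 1); first by rewrite addr_ge0.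
  move=> s Ds; apply: (hN (`|N| + 1)); first by rewrite ltr_pwDr// ler_norm.
  by exists s.
have T1 : 1 <= T + 1 by rewrite lerDr.
have T10 : 0 <= T + 1 by exact: le_trans T1.
exists C; split=> //; split.
- apply: (smeasD (f := fun=> C : R^o)); first exact: smeas_cst.
  by apply: (smeasZl (T + 1) (smeas_normr snu)).
- by move=> s; rewrite addr_ge0// mulr_ge0.
- apply: ae_imp nuE => s nus t s0 st tT.
  have sT := le_trans st tT; have Ds : D s by apply/tintP.
  rewrite -(subrK (k s s) (k t s)) addrC; apply: le_trans (ler_normD _ _) _.
  apply: lerD; first exact: hC.
  apply: le_trans (kernel_lip s0 (lexx s) st tT) _; rewrite nus// mulrC.
  have ts0 : 0 <= t - s by rewrite subr_ge0.
  apply: (@le_trans _ _ ((t - s) * `|nu' s|)); first by rewrite ler_wpM2l// ler_norm.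
  by rewrite ler_wpM2r// lerBlDr -addrA; apply: le_trans tT _; rewrite lerDl addr_ge0.
- apply: ae_imp nuE => s nus t t' s0 st tt tT.
  have Ds : D s by apply/tintP; split=> //; exact: le_trans st (le_trans tt tT).
  apply: le_trans (kernel_lip s0 st tt tT) _; rewrite ler_wpM2r ?subr_ge0// nus//.
  apply: le_trans (ler_norm _) _; rewrite -[leLHS]add0r lerD// ler_peMl//.
move=> t u Dt su; have /tintP[t0 tT] := Dt.
(* Retraction onto [[0, t]], turning continuity within the interval into continuity on the line. *)
pose cla s := Num.min t (Num.max 0 s).
have claA s : [set` `[0, t]] (cla s) by rewrite /= in_itv/= le_min t0 le_max lexx ge_min lexx.
have ccla : continuous cla.
  move=> s; apply/cvgrPdist_lt => e e0; apply/nbhs_ballP; exists e => // s' ss.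
  have {}ss : `|s - s'| < e by exact: ss.
  apply: le_lt_trans ss; rewrite /cla.
  by apply: le_trans (min_lip _ _ _) _; exact: max0_lip.
have ckc : continuous (fun s => k t (cla s)).
  move=> s; have /subspace_continuousP /(_ _ (claA s)) h := k2 Dt.
  move=> U hU; have {}hU : \forall r \near cla s, [set` `[0, t]] r -> U (k t r) by exact: h U hU.
  have : \forall s' \near s, [set` `[0, t]] (cla s') -> U (k t (cla s')) by exact: ccla s _ hU.
  by apply: filterS => s'; apply; exact: claA.
have skc := continuous_smeas ckc.
have sku : smeas (fun s => k t (cla s) (u s)).
  exact: (smeas_bin (phi := fun x : blin E E * E => x.1 x.2) (@blin_eval_continuous R E E) skc su).
rewrite (_ : cut _ _ = cut [set` `[0, t]] (fun s => k t (cla s) (u s))).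
  by apply: smeas_cut.
apply/funext => s; rewrite /cut; case: ifPn => // /set_mem/=.
by rewrite in_itv/= => /andP[s0 st]; rewrite /cla (max_idPr s0) (min_idPr st).
Qed.

End KernelBounds.

(** * Integrability from conjugate exponents *)

Section LpBounds.
Context {R : realType} (T : R).
Local Notation mu := (@lebesgue_measure R).
Local Notation D := (tint T).
Let mD : measurable (D : set R). Proof. exact: measurable_tint. Qed.

Lemma in_Lp_powR (W : normedModType R) (p : R) (f : R -> W) (f' : R -> W) : 0 < p ->
  in_Lp D p%:E f -> smeas f' -> (\forall s \ae mu, D s -> f s = f' s) ->
  smeas (fun s => powR `|f' s| p : R^o) /\ (L1 D (fun s => powR `|f' s| p : R^o) < +oo)%E.
Proof.
move=> p0 [_ fp] sf ff; split.
  apply: (measurable_smeas (f := (@powR R ^~ p) \o (fun s => `|f' s|))).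
  have h := smeas_measurable (smeas_normr sf).
  have mp := @measurable_powR R p.
  exact: (measurableT_comp mp h).
move: fp; rewrite unlock => /lty_poweRy; rewrite invr_neq0 ?gt_eqF// => /(_ isT).
apply: le_lt_trans; rewrite le_eqVlt; apply/orP; left; apply/eqP.
rewrite /L1 [LHS]integral_mkcond; apply: ge0_integral_ae_eq => [s|s|].
- by rewrite patchE; case: ifP => //; rewrite lee_fin.
- exact: poweR_ge0.
apply: ae_imp ff => s fs _; rewrite !patchE; case: ifPn => [/set_mem Ds|_].
  by rewrite (fs Ds) /= normr_id ger0_norm ?powR_ge0.
by rewrite abse0 poweR0r// gt_eqF.
Qed.

Lemma in_Linfty (W : normedModType R) (f f' : R -> W) :
  in_Lp D +oo%E f -> (\forall s \ae mu, D s -> f s = f' s) ->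
  exists2 K : R, 0 <= K & \forall s \ae mu, D s -> `|f' s| <= K.
Proof.
move=> [_]; rewrite unlock; case: ifPn => [_|]; last first.
  rewrite -leNgt => muT _ _; exists 0 => //; exists setT; split => //.
  by apply/eqP; rewrite eq_le muT measure_ge0.
set g := (_ \o _) => gy ff; have := ess_sup_ge mu g => gge.
exists (Num.max 0 (fine (ess_sup mu g))); first by rewrite le_max lexx.
have := ae_and gge ff; apply: ae_imp => s [h1 h2] Ds.
rewrite -h2// le_max; apply/orP; right.
have gs : g s = (`|f s|)%:E by rewrite /g /= patchE mem_set//= normr_id.
rewrite gs in h1; rewrite -lee_fin fineK// fin_numElt gy andbT.
by apply: lt_le_trans h1; rewrite ltNyr.
Qed.

(** Young's inequality bounds the product by the powers r and p, and the first power by 1 plus the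
    p-th power on a finite interval; for q infinite the essential bound of nu' is used. *)
Lemma L1_weight (p : R) (q : \bar R) (f f' nu nu' : R -> R^o) (A B : R) :
  1 <= p -> (1 < q)%E -> (p%:E^-1 + q^-1 = 1)%E -> 0 <= A -> 0 <= B ->
  in_Lp D p%:E f -> smeas f' -> (\forall s \ae mu, D s -> f s = f' s) ->
  in_Lp D q nu -> smeas nu' -> (\forall s \ae mu, D s -> nu s = nu' s) ->
  (L1 D (fun s => ((A + B * `|nu' s|) *: (`|f' s| : R^o))%R) < +oo)%E.
Proof.
move=> p1 q1 pq A0 B0 fp sf ff nq snu nn.
have p0 : 0 < p by exact: lt_le_trans p1.
have [sfp fpy] := in_Lp_powR p0 fp sf ff.
have x_le (x : R) : 0 <= x -> x <= 1 + powR x p.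
  move=> x0; have [x1|x1] := leP x 1; first by apply: le_trans x1 _; rewrite lerDl powR_ge0.
  apply: (@le_trans _ _ (powR x p)); last by rewrite lerDr.
  by rewrite -[leLHS](powRr1 x0) ler_powR// ltW.
have s1 : smeas (fun=> 1 : R^o) by exact: smeas_cst.
have L1cst : (L1 D (fun=> (1%R : R^o)) < +oo)%E.
  rewrite /L1 (eq_integral (cst 1%:E)); last by move=> s _; rewrite normr1.
  by rewrite integral_cst// mul1e; exact: tint_fin.
have slhs : smeas (fun s => (A + B * `|nu' s|) *: (`|f' s| : R^o)).
  apply: (smeasZ (a := fun s => A + B * `|nu' s| : R^o)); last exact: smeas_normr.
  by apply: (smeasD (f := fun=> A : R^o) (smeas_cst _) (smeasZl B (smeas_normr snu))).
have dominated (g : R -> R^o) : smeas g -> (L1 D g < +oo)%E ->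
    (\forall s \ae mu, D s -> (A + B * `|nu' s|) * `|f' s| <= (g s : R)) ->
    (L1 D (fun s => ((A + B * `|nu' s|) *: (`|f' s| : R^o))%R) < +oo)%E.
  move=> sg g1 hg; apply: le_lt_trans g1; apply: (le_L1 mD slhs sg).
  apply: ae_imp hg => s h Ds; apply: le_trans (ler_norm _); apply: le_trans (h Ds).
  by rewrite ger0_norm// mulr_ge0// addr_ge0// mulr_ge0.
pose fp' s := powR `|f' s| p : R^o.
case: q q1 pq nq => [r| |] // r1 pq nq; last first.
  have [K K0 nK] := in_Linfty nq nn.
  pose g s := (A + B * K) *: (1 + fp' s) : R^o.
  have s1p : smeas (fun s => (1 : R^o) + fp' s) by exact: (smeasD s1 sfp).
  apply: (dominated g); first exact: (smeasZl (A + B * K) s1p).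
    rewrite (L1Z mD (A + B * K) s1p) lte_mul_pinfty ?lee_fin//.
    by apply: le_lt_trans (L1D mD s1 sfp) _; exact: lte_add_pinfty.
  apply: ae_imp nK => s nK Ds; rewrite /g /=; apply: ler_pM => //.
  - by rewrite addr_ge0// mulr_ge0.
  - by rewrite lerD2l ler_wpM2l// nK.
  - exact: x_le.
rewrite lte_fin in r1; have r0 : 0 < r by exact: lt_trans r1.
have {}pq : p^-1 + r^-1 = 1.
  by move: pq; rewrite !inver !gt_eqF// -EFinD => -[].
have [snr nry] := in_Lp_powR r0 nq snu nn.
pose nr s := powR `|nu' s| r : R^o.
pose g s := A *: ((1 : R^o) + fp' s) + B *: (nr s + fp' s) : R^o.
have s1p : smeas (fun s => (1 : R^o) + fp' s) by exact: (smeasD s1 sfp).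
have snp : smeas (fun s => nr s + fp' s) by exact: (smeasD snr sfp).
have g1 := smeasZl A s1p; have g2 := smeasZl B snp.
apply: (dominated g); first exact: (smeasD g1 g2).
  apply: le_lt_trans (L1D mD g1 g2) _; apply: lte_add_pinfty.
    rewrite (L1Z mD A s1p) lte_mul_pinfty ?lee_fin//.
    by apply: le_lt_trans (L1D mD s1 sfp) _; exact: lte_add_pinfty.
  rewrite (L1Z mD B snp) lte_mul_pinfty ?lee_fin//.
  by apply: le_lt_trans (L1D mD snr sfp) _; exact: lte_add_pinfty.
apply: aeW => s Ds; rewrite /g mulrDl; apply: lerD; first by rewrite ler_wpM2l// x_le.
rewrite -mulrA ler_wpM2l//.
have := conjugate_powR (normr_ge0 (nu' s)) (normr_ge0 (f' s)) r0 p0.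
rewrite addrC pq => /(_ erefl) /le_trans; apply; apply: lerD.
  by rewrite ler_pdivrMr// ler_peMr ?powR_ge0// ltW.
by rewrite ler_pdivrMr// ler_peMr ?powR_ge0.
Qed.

End LpBounds.

(** * Families of controls depending on a parameter *)

Section Controls.
Context {R : realType} {E : completeNormedModType R} (T : R).
Hypothesis T0 : 0 <= T.
Local Notation mu := (@lebesgue_measure R).
Local Notation D := (tint T).
Local Notation C := (cmap T E).
Variables (k : R -> R -> blin E E) (m c eta : R -> R^o) (F : R -> E -> set E).
Variable M : set C.
Hypothesis dat : inclusion_data k m c eta F M.
Variables (P : Type) (dP : P -> P -> R).

Let mD : measurable (D : set R). Proof. exact: measurable_tint. Qed.
Let kK := id_kernel dat.
Let sm : smeas m. Proof. by case: kK. Qed.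
Let m0 s : 0 <= (m s : R). Proof. by case: kK. Qed.
Let c0 := id_c0 dat.
Let sc := id_sc dat.
Local Notation mc := (fun s => m s *: c s : R^o).
Let smc : smeas mc. Proof. exact: smeasZ. Qed.
Let mc1 : (L1 D mc < +oo)%E := id_mc dat.

(** Continuity in the parameter is required in the weighted norm, which dominates the maximum norm
    of the trajectory by [isV_norm] and tolerates jumps of the control at a moving time. *)
Definition ctrl (u : P -> R -> E) := [/\ forall p, smeas (u p),
  exists2 K : R, 0 <= K & forall p, \forall s \ae mu, D s -> `|u p s| <= (c s : R) * K &
  forall e : R, 0 < e -> exists2 d : R, 0 < d & forall p q, dP p q < d ->
    (wnorm T m (fun s => u p s - u q s)%R <= e%:E)%E].

Lemma wnorm_le (u : R -> E) (K : R) : smeas u -> 0 <= K ->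
  (\forall s \ae mu, D s -> `|u s| <= (c s : R) * K) ->
  (wnorm T m u <= K%:E * L1 D mc)%E.
Proof.
move=> su K0 uK; rewrite -[X in (X%:E * _)%E]ger0_norm// -(L1Z mD K smc).
apply: (le_L1 mD); [exact: smeasZ|exact: (smeasZl K smc)|].
apply: ae_imp uK => s h Ds; rewrite normrZ ger0_norm//.
apply: le_trans (ler_norm _); apply: (le_trans (ler_wpM2l (m0 s) (h Ds))).
by rewrite mulrA mulrC.
Qed.

Lemma wnorm_fin (u : R -> E) (K : R) : smeas u -> 0 <= K ->
  (\forall s \ae mu, D s -> `|u s| <= (c s : R) * K) -> (wnorm T m u < +oo)%E.
Proof.
move=> su K0 uK; apply: le_lt_trans (wnorm_le su K0 uK) _.
by rewrite lte_mul_pinfty// lee_fin.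
Qed.

Lemma wnormD (u v : R -> E) : smeas u -> smeas v ->
  (wnorm T m (fun s => u s + v s)%R <= wnorm T m u + wnorm T m v)%E.
Proof.
move=> su sv; apply: le_trans (L1D mD (smeasZ sm su) (smeasZ sm sv)).
rewrite le_eqVlt; apply/orP; left; apply/eqP.
by apply: eq_integral => s _; rewrite scalerDr.
Qed.

Lemma wnormZ (a : R) (u : R -> E) : smeas u ->
  wnorm T m (fun s => a *: u s) = (`|a|%:E * wnorm T m u)%E.
Proof.
move=> su; rewrite /wnorm -(L1Z mD a (smeasZ sm su)).
by apply: eq_integral => s _; rewrite !scalerA mulrC.
Qed.

Lemma ctrl_isV u : ctrl u -> exists2 v : P -> C, forall p, isV k (u p) (v p) & uc dP v.
Proof.
move=> [su [K K0 uK] uu].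
have /choice[v hv] : forall p, exists v : C, isV k (u p) v.
  by move=> p; apply: (isV_exists kK (su p)); exact: wnorm_fin (su p) K0 (uK p).
exists v => // e e0; have e2 : 0 < e / 2 by rewrite divr_gt0.
have [d d0 hd] := uu _ e2; exists d => // p q pq; rewrite -lte_fin.
apply: le_lt_trans (isV_norm kK (isVB (hv p) (hv q))) _.
by apply: le_lt_trans (hd p q pq) _; rewrite lte_fin ltr_pdivrMr// ltr_pMr// ltr1n.
Qed.

Lemma ctrl0 : ctrl (fun _ _ => 0).
Proof.
split=> [p||e e0]; first exact: smeas_cst.
  by exists 0 => // p; apply: aeW => s _; rewrite normr0 mulr0.
exists 1 => // p q _; apply: (@le_trans _ _ 0%E); last by rewrite lee_fin ltW.
by rewrite /wnorm /L1 integral0_eq// => s _; rewrite subrr scaler0 normr0.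
Qed.

Lemma ctrlD u v : ctrl u -> ctrl v -> ctrl (fun p s => u p s + v p s).
Proof.
move=> [su [K K0 uK] uu] [sv [K' K'0 vK] uv]; split=> [p||e e0].
- by apply: smeasD.
- exists (K + K'); first exact: addr_ge0.
  move=> p; have := ae_and (uK p) (vK p); apply: ae_imp => s [h1 h2] Ds.
  by apply: le_trans (ler_normD _ _) _; rewrite mulrDr lerD ?h1 ?h2.
have e2 : 0 < e / 2 by rewrite divr_gt0.
have [d d0 hd] := uu _ e2; have [d' d'0 hd'] := uv _ e2.
exists (Num.min d d'); first by rewrite lt_min d0.
move=> p q; rewrite lt_min => /andP[h1 h2].
rewrite (_ : (fun s => _) = (fun s => (u p s - u q s) + (v p s - v q s))).
  apply: le_trans (wnormD _ _) _; [exact: smeasB|exact: smeasB|].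
  by rewrite [e]splitr EFinD leeD ?hd ?hd'.
by apply/funext => s; rewrite opprD addrACA.
Qed.

Lemma ctrlN u : ctrl u -> ctrl (fun p s => - u p s).
Proof.
move=> [su [K K0 uK] uu]; split=> [p||e e0].
- by apply: smeasN.
- by exists K => // p; apply: ae_imp (uK p) => s h Ds; rewrite normrN h.
have [d d0 hd] := uu e e0; exists d => // p q pq.
rewrite (_ : (fun s => _) = (fun s => (-1) *: (u p s - u q s))).
  by rewrite wnormZ ?normrN1 ?mul1e ?hd//; exact: smeasB.
by apply/funext => s; rewrite scaleN1r opprB opprK addrC.
Qed.

Lemma ctrlB u v : ctrl u -> ctrl v -> ctrl (fun p s => u p s - v p s).
Proof. by move=> cu cv; apply: (ctrlD cu (ctrlN cv)). Qed.

Lemma ctrlZ (a : P -> R^o) (w : R -> E) (A K : R) : uc dP a -> (forall p, `|a p| <= A) ->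
  smeas w -> 0 <= K -> (\forall s \ae mu, D s -> `|w s| <= (c s : R) * K) ->
  ctrl (fun p s => a p *: w s).
Proof.
move=> ua aA sw K0 wK; split=> [p||e e0]; first exact: (smeasZl (a p) sw).
  exists (`|A| * K); first by rewrite mulr_ge0.
  move=> p; apply: ae_imp wK => s h Ds; rewrite normrZ.
  apply: (@le_trans _ _ (`|A| * ((c s : R) * K))); last by rewrite mulrCA.
  by apply: ler_pM => //; [apply: le_trans (aA p) (ler_norm A)|exact: h].
have N1 := wnorm_fin sw K0 wK.
pose n := fine (wnorm T m w); have n0 : 0 <= n by apply: fine_ge0; exact: L1_ge0.
have wE : wnorm T m w = n%:E by exact: L1_fin.
have en : 0 < e / (n + 1) by rewrite divr_gt0// ltr_wpDl.
have [d d0 hd] := ua _ en; exists d => // p q pq.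
rewrite (_ : (fun s => _) = (fun s => (a p - a q) *: w s)); last first.
  by apply/funext => s; rewrite scalerBl.
rewrite wnormZ// wE -EFinM lee_fin.
have := ltW (hd p q pq); rewrite ler_pdivlMr ?ltr_wpDl//; apply: le_trans.
by rewrite ler_wpM2l// lerDl.
Qed.

Lemma ctrl_sum (I : eqType) (r : seq I) (u : I -> P -> R -> E) :
  (forall i, i \in r -> ctrl (u i)) -> ctrl (fun p s => \sum_(i <- r) u i p s).
Proof.
elim: r => [|i r IH] cu.
  rewrite (_ : (fun _ _ => _) = fun _ _ => 0); first exact: ctrl0.
  by apply/funext => p; apply/funext => s; rewrite big_nil.
rewrite (_ : (fun _ _ => _) = fun p s => u i p s + \sum_(j <- r) u j p s).
  apply: ctrlD; first by apply: cu; rewrite mem_head.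
  by apply: IH => j jr; apply: cu; rewrite inE jr orbT.
by apply/funext => p; apply/funext => s; rewrite big_cons.
Qed.

Definition cl (tau : R) (u : R -> E) := fun s => if s < tau then u s else 0.

Lemma smeas_cl tau u : smeas u -> smeas (cl tau u).
Proof.
move=> su; rewrite (_ : cl tau u = fun s => if s \in [set` `]-oo, tau[] then u s else 0).
  by apply: smeas_if => //; exact: smeas_cst.
by apply/funext => s; rewrite /cl mem_setE /= in_itv.
Qed.

(** Moving tau changes the control only between the two times, where it is bounded by K c and
    [pint_small] applies. *)
Lemma ctrl_cl (tau : P -> R^o) u : uc dP tau -> (forall p, 0 <= (tau p : R) <= T) ->
  ctrl u -> ctrl (fun p => cl (tau p) (u p)).
Proof.
move=> ut tT [su [K K0 uK] uu].
have scl p q : smeas (cl (tau p) (u q)) by exact: smeas_cl.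
split=> [p||e e0]; first exact: scl.
  exists K => // p; apply: ae_imp (uK p) => s h Ds; rewrite /cl.
  by case: ifP => _; [exact: h|rewrite normr0 mulr_ge0].
have e2 : 0 < e / 2 by rewrite divr_gt0.
have K1 : 0 < K + 1 by rewrite ltr_wpDl.
have [r r0 hr] := pint_small smc mc1 (divr_gt0 e2 K1).
have [d d0 hd] := uu _ e2; have [d' d'0 hd'] := ut _ r0.
exists (Num.min d d'); first by rewrite lt_min d0.
move=> p q; rewrite lt_min => /andP[h1 h2].
rewrite (_ : (fun s => _) = (fun s => cl (tau p) (fun s => u p s - u q s) s +
    (cl (tau p) (u q) s - cl (tau q) (u q) s))); last first.
  apply/funext => s; rewrite addrA; congr (_ - _); rewrite /cl.
  by case: ifP => _; rewrite ?subrK ?addr0.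
have sB := smeasB (su p) (su q).
apply: le_trans (wnormD (smeas_cl _ sB) (smeasB (scl p q) (scl q q))) _.
rewrite [e]splitr EFinD; apply: leeD.
  apply: le_trans (hd p q h1); apply: (le_L1 mD).
  - exact: (smeasZ sm (smeas_cl _ sB)).
  - exact: (smeasZ sm sB).
  apply: aeW => s _; rewrite /cl; case: ifP => _ //.
  by rewrite scaler0 normr0.
pose a := Num.min (tau p : R) (tau q); pose b := Num.max (tau p : R) (tau q).
have [/andP[p0 pT] /andP[q0 qT]] := (tT p, tT q).
have ab : a <= b by rewrite ge_min le_max lexx.
have a0 : 0 <= a by rewrite le_min p0.
have bT : b <= T by rewrite ge_max pT.
have bad : b - a <= r.
  have := hd' p q h2; rewrite /a /b.
  by case: (leP (tau p : R) (tau q)) => pq; rewrite ltr_norml => /andP[]; lra.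
have scc : smeas (cut [set` `[a, b]] mc) by exact: smeas_cut.
apply: (@le_trans _ _ (L1 D (fun s => K *: cut [set` `[a, b]] mc s : R^o))).
  apply: (le_L1 mD).
  - exact: (smeasZ sm (smeasB (scl p q) (scl q q))).
  - exact: (smeasZl K scc).
  apply: ae_imp (uK q) => s h Ds; have {}h := h Ds.
  have ge : 0 <= K *: cut [set` `[a, b]] mc s.
    by rewrite /cut; case: ifP => _; rewrite ?scaler0// mulr_ge0// mulr_ge0.
  rewrite normrZ (ger0_norm (m0 s)).
  have [sab|nsab] := boolP (s \in [set` `[a, b]]).
    rewrite /cut sab; apply: le_trans (ler_norm _).
    apply: (@le_trans _ _ ((m s : R) * ((c s : R) * K))); last by rewrite mulrA mulrC.
    rewrite ler_wpM2l// /cl; case: ifP => _; case: ifP => _;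
      by rewrite ?subrr ?subr0 ?sub0r ?normrN ?normr0// mulr_ge0.
  suff -> : cl (tau p) (u q) s = cl (tau q) (u q) s by rewrite subrr normr0 mulr0.
  move: nsab; rewrite notin_setE /= in_itv/= => /negP; rewrite negb_and -!ltNge.
  rewrite lt_min gt_max /cl => /orP[/andP[-> ->]//|/andP[h3 h4]].
  by rewrite !ltNge (ltW h3) (ltW h4).
rewrite (L1Z mD K scc) (ger0_norm K0) (L1_cut (sub_tint a0 bT)) (pintE smc mc1)//.
rewrite -EFinM lee_fin; have := ltW (hr a b a0 ab bT bad).
rewrite ler_pdivlMr//; apply: le_trans; rewrite mulrC ler_wpM2l ?pint_ge0//.
by rewrite lerDl.
Qed.

End Controls.

Lemma ae_seq (R : realType) (I : eqType) (l : seq I) (Q : I -> R -> Prop) :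
  (forall i, i \in l -> \forall s \ae (@lebesgue_measure R), Q i s) ->
  \forall s \ae (@lebesgue_measure R), forall i, i \in l -> Q i s.
Proof.
elim: l => [|i l IH] hQ; first by apply: aeW.
have h1 := hQ i (mem_head _ _).
have h2 : \forall s \ae (@lebesgue_measure R), forall j, j \in l -> Q j s.
  by apply: IH => j jl; apply: hQ; rewrite inE jl orbT.
have := ae_and h1 h2; apply: ae_imp => s [q1 q2] j.
by rewrite inE => /predU1P[->|/q2].
Qed.

Lemma ae_neq (R : realType) (x : R) : \forall s \ae (@lebesgue_measure R), s <> x.
Proof.
exists [set x]; split; [exact: measurable_set1|exact: lebesgue_measure_set1|].
by move=> s /= /contrapT.
Qed.

(** * Euler polygons with a switching time *)

Section EulerPolygons.
Context {R : realType} {E : completeNormedModType R} (T : R).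
Hypothesis T0 : 0 <= T.
Local Notation mu := (@lebesgue_measure R).
Local Notation D := (tint T).
Local Notation C := (cmap T E).
Local Notation pt := (tpt T0).
Variables (k : R -> R -> blin E E) (m c eta : R -> R^o) (F : R -> E -> set E).
Variable M : set C.
Hypothesis dat : inclusion_data k m c eta F M.
Variables (P : Type) (dP : P -> P -> R).
Hypothesis tP : tbd_dist dP.
Local Notation ctrl := (ctrl T m c dP).
Variables (h : P -> C) (u : P -> R -> E) (tau : P -> R^o) (r : R).
Hypotheses (uh : uc dP h) (Mh : forall p, M (h p)) (cu : ctrl u).
Hypotheses (ut : uc dP tau) (tT : forall p, 0 <= (tau p : R) <= T) (r0 : 0 < r).

Let c0 := id_c0 dat.
Let kK := id_kernel dat.

Definition gridpt (N j : nat) : R := j%:R * (T / N%:R).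

Section Grid.
Variable N : nat.
Hypothesis N0 : (0 < N)%N.
Local Notation mesh := (T / N%:R).
Local Notation gp := (gridpt N).

Let mesh0 : 0 <= mesh. Proof. by rewrite divr_ge0. Qed.
Let gpS j : gp j.+1 = gp j + mesh.
Proof. by rewrite /gridpt -natr1 mulrDl mul1r. Qed.
Let gp0 j : 0 <= gp j. Proof. by rewrite mulr_ge0. Qed.
Let gpN : gp N = T. Proof. by rewrite /gridpt mulrC divfK// pnatr_eq0 -lt0n. Qed.
Let gpT j : (j <= N)%N -> gp j <= T.
Proof. by move=> jN; rewrite -gpN ler_wpM2r// ler_nat. Qed.

(* the polygon U, Y follows u up to time tau and the Euler scheme from then
   on, and has been constructed up to the j-th grid point *)
Definition euler_inv j (U : P -> R -> E) (Y : P -> C) :=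
  [/\ [/\ ctrl U, forall p, isV k (U p) (Y p - h p) & uc dP Y],
    (forall p s, gp j <= s -> U p s = 0),
    (forall p s, 0 <= s -> s < gp j -> s < tau p -> U p s = u p s),
    (\forall s \ae mu, D s -> forall p, s < gp j -> tau p <= s -> exists t : D,
      [/\ set_val t <= s, s - set_val t <= mesh & Fhull F (2 * r) s (Y p t) (U p s)]) &
    (forall p q, h p = h q -> tau p = 0 -> tau q = 0 -> U p = U q)].

Lemma euler_step j U Y : (j < N)%N -> euler_inv j U Y -> exists U' Y', euler_inv j.+1 U' Y'.
Proof.
move=> jN [[cU VU uY] U0 Uu UF Uh].
have gj := gpT (ltnW jN); have gj1 := gpT jN.
have Dj : D (gp j) by apply/tintP.
pose y p := Y p (pt (gp j)).
have uy : uc dP y.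
  by apply: (uc_lip (L := 1) uY) => // p q; rewrite mul1r -cmapB; exact: cmap_le.
have [zs hzs] := uc_tbd tP uy r0.
have cy p : covered zs r (y p) by apply: hzs; exists p.
have /choice[sg hsg] : forall z : E, exists w : R -> E, smeas w /\
    \forall s \ae mu, D s -> F s z (w s).
  by move=> z; have [w sw wF] := id_F2 dat z; exists w.
pose G p s := \sum_(z <- zs) (pu zs r z (y p) : R^o) *: sg z s.
have cG : ctrl G.
  apply: (ctrl_sum dat) => z zz; have [ssg sgF] := hsg z.
  apply: (ctrlZ dat (A := 1) (K := 1 + `|z|)).
  - pose L := (1 + (size zs)%:R) / r.
    apply: (uc_lip (L := L) uy); first by rewrite divr_ge0 ?addr_ge0// ltW.
    by move=> p q; exact: pu_lip.
  - by move=> p; rewrite ger0_norm ?pu_ge0// pu_le1.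
  - exact: ssg.
  - by rewrite addr_ge0.
  - have := ae_and sgF (id_F4 dat); apply: ae_imp => s [h1 h2] Ds.
    by apply: h2 => //; exact: h1.
(* The time tau may fall inside the cell, so the switch from u to the Euler control is made
   pointwise in s. *)
pose H p s := if s < tau p then u p s else G p s.
have cH : ctrl H.
  rewrite (_ : H = fun p s => cl (tau p) (u p) s + (G p s - cl (tau p) (G p) s)).
    by apply: (ctrlD dat); [exact: (ctrl_cl dat)|apply: (ctrlB dat) => //; exact: (ctrl_cl dat)].
  apply/funext => p; apply/funext => s; rewrite /H /cl; case: ifP => _.
    by rewrite subrr addr0.
  by rewrite subr0 add0r.
pose U' p s := if s < gp j then U p s else if s < gp j.+1 then H p s else 0.
have ccl i : (i <= N)%N -> ctrl (fun p => cl (gp i) (H p)).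
  move=> iN; apply: (ctrl_cl dat (tau := fun=> gp i)) => //; first exact: uc_cst.
  by move=> p; rewrite gp0 gpT.
have cU' : ctrl U'.
  rewrite (_ : U' = fun p s => U p s + (cl (gp j.+1) (H p) s - cl (gp j) (H p) s)).
    by apply: (ctrlD dat) => //; apply: (ctrlB dat); apply: ccl => //; exact: ltnW.
  apply/funext => p; apply/funext => s; rewrite /U' /cl; case: ltP => [sj|js].
    by rewrite gpS (lt_le_trans sj) ?lerDl// subrr addr0.
  by rewrite U0// add0r subr0.
have [v hv uv] := ctrl_isV dat cU'.
pose Y' p := h p + v p.
have VY p : isV k (U' p) (Y' p - h p) by rewrite /Y' addrC addKr.
have YY p (t : D) : set_val t <= gp j -> Y' p t = Y p t.
  move=> tj; apply: (addIr (- h p t)); rewrite -!cmapB.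
  apply: (isV_causal kK (VY p) (VU p)); apply: ae_imp (ae_neq (gp j)) => s sj _ st.
  rewrite /U' ifT// lt_neqAle (le_trans st tj) andbT; exact/eqP.
(* Only net points closer than 2 r to the state have positive weight; this is the radius 2 r in
   [euler_inv]. *)
have GF : \forall s \ae mu, D s -> forall p, Fhull F (2 * r) s (y p) (G p s).
  have := ae_seq (fun z (_ : z \in zs) => (hsg z).2); apply: ae_imp => s h1 Ds p.
  apply: (hull_pu r0 (cy p)) => z zz yz; exists z; last exact: h1.
  by rewrite /= distrC ltW.
exists U', Y'; split.
- split=> //; exact: ucD.
- move=> p s; rewrite gpS => js; rewrite /U' !ltNge gpS js /=.
  by rewrite (le_trans _ js) ?lerDl.
- move=> p s s0 sj st; rewrite /U' /H; case: ltP => [sj'|_]; first exact: Uu.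
  by rewrite sj st.
- have := ae_and UF GF; apply: ae_imp => s [{}UF {}GF] Ds p sj ts.
  have [sj'|js] := ltP s (gp j).
    have [t [t1 t2 t3]] := UF Ds p sj' ts; exists t; split=> //.
    by rewrite YY ?(le_trans t1 (ltW sj'))// /U' sj'.
  exists (pt (gp j)); rewrite tptK//; split=> //.
    by rewrite lerBlDl -gpS ltW.
  rewrite YY ?tptK// /U' ltNge js /= sj /H ltNge ts /=; exact: GF.
move=> p q hpq tp tq; apply/funext => s.
have UUpq := Uh p q hpq tp tq.
have YYpq : Y p = Y q.
  apply: (addIr (- h p)); rewrite [in RHS]hpq; apply: (isV_unique kK (VU p)).
  by rewrite UUpq; exact: VU.
rewrite /U' /H UUpq tp tq; case: ltP => // js.
have s0 : (s < 0) = false by rewrite ltNge (le_trans (gp0 j) js).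
by rewrite s0 /G /y YYpq.
Qed.

Lemma euler_exists : exists U Y, euler_inv N U Y.
Proof.
suff H j : (j <= N)%N -> exists U Y, euler_inv j U Y by exact: H.
elim: j => [_|j IH jN].
  exists (fun _ _ => 0), h; rewrite /euler_inv /gridpt mul0r; split.
  - by split=> // [|p]; [exact: ctrl0|rewrite subrr; exact: isV0].
  - by [].
  - by move=> p s s0; rewrite ltNge s0.
  - by apply: aeW => s /tintP[s0 _] p; rewrite ltNge s0.
  - by [].
by have [U [Y]] := IH (ltnW jN); exact: euler_step.
Qed.

End Grid.

Variable X : P -> C.
Hypothesis uX : forall p, 0 < (tau p : R) -> isV k (u p) (X p - h p) /\
  \forall s \ae mu, D s -> s < tau p -> Fhull F (4 * r) s (X p (pt s)) (u p s).
Hypothesis r4 : 4 * r <= 1.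

(** After tau the control has radius 2 r at a state earlier by at most the mesh; a fine mesh makes
    the state move by less than 2 r meanwhile, whence 4 r. With tau = 0 the polygon forgets u, which
    later makes the final map of the contraction constant. *)
Lemma euler_polygons : exists Y : P -> C, [/\ uc dP Y,
  forall p, sol T0 k F M (4 * r) (Y p),
  forall p (t : D), 0 < (tau p : R) -> set_val t <= tau p -> Y p t = X p t &
  forall p q, h p = h q -> tau p = 0 -> tau q = 0 -> Y p = Y q].
Proof.
have [H0 H0ge MH] := M_bounded dat.
have r42 : 1 + 4 * r <= 2 by rewrite [2]mulr2n lerD2l.
(* B and the moduli of continuity are fixed before the mesh; this is possible because the a priori
   bound does not depend on N. *)
have [B [B0 hB]] := apriori T0 kK (id_sc dat) c0 (id_mc dat) H0ge (ler0n R 2).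
have B2 : 0 <= 2 + B by rewrite addr_ge0.
have [d1 d10 hd1] := isV_equicont kK (id_sc dat) (id_mc dat) B2 r0.
have [d2 d20 hd2] := cmap_equicont T0 (compact_tbd (id_Mc dat)) r0.
have d0 : 0 < Num.min d1 d2 by rewrite lt_min d10.
have [N N0 hN] : exists2 N : nat, (0 < N)%N & T / N%:R < Num.min d1 d2.
  exists (Num.bound (T / Num.min d1 d2)).+1 => //.
  rewrite ltr_pdivrMr ?ltr0n// mulrC -ltr_pdivrMr//.
  apply: lt_trans (archi_boundP _) _; first by rewrite divr_ge0// ltW.
  by rewrite ltr_nat.
have [U [Y [[cU VU uY] U0 Uu UF Uh]]] := euler_exists N0.
have gpN : gridpt N N = T by rewrite /gridpt mulrC divfK// pnatr_eq0 -lt0n.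
rewrite gpN in U0 Uu UF.
have YX p (t : D) : 0 < (tau p : R) -> set_val t <= tau p -> Y p t = X p t.
  move=> tp tt; apply: (addIr (- h p t)); rewrite -!cmapB.
  apply: (isV_causal kK (VU p) (uX tp).1).
  have /andP[_ tpT] := tT p.
  apply: ae_imp (ae_neq (tau p : R)) => s sn /tintP[s0 _] st.
  have stau : s < tau p.
    by rewrite lt_neqAle (le_trans st tt) andbT; exact/eqP.
  by apply: Uu => //; exact: lt_le_trans tpT.
(* Either u is followed at the current state, with radius 4 r already, or the control comes from an
   earlier state, with radius 2 r. The point s = T, excluded from the half-open cells, is
   negligible. *)
have Uinc p : \forall s \ae mu, D s -> exists t : D, [/\ set_val t <= s,
    s - set_val t <= T / N%:R, Fhull F (4 * r) s (Y p t) (U p s) &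
    t = pt s \/ Fhull F (2 * r) s (Y p t) (U p s)].
  have step (Q : R -> Prop) : (\forall s \ae mu, s <> T -> Q s) -> \forall s \ae mu, Q s.
    by move=> h1; have := ae_and h1 (ae_neq T); apply: ae_imp => s [h2 h3]; exact: h2.
  have r24 : 2 * r <= 4 * r by have := ltW r0; lra.
  apply: step; have [tp0|tp0] := ltP 0 (tau p : R).
    have := ae_and UF (uX tp0).2; apply: ae_imp => s [{}UF uF] sT Ds.
    have /tintP[s0 sT'] := Ds; have {}sT : s < T by rewrite lt_neqAle sT' andbT; exact/eqP.
    have [st|ts] := ltP s (tau p); last first.
      have [t [t1 t2 t3]] := UF Ds p sT ts; exists t; split=> //; last by right.
      exact: FhullS t3.
    exists (pt s); rewrite tptK// subrr divr_ge0//; split=> //; last by left.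
    by rewrite Uu// YX ?tptK ?(ltW st)//; exact: uF.
  apply: ae_imp UF => s {}UF sT Ds.
  have /tintP[s0 sT'] := Ds; have {}sT : s < T by rewrite lt_neqAle sT' andbT; exact/eqP.
  have [t [t1 t2 t3]] := UF Ds p sT (le_trans tp0 s0); exists t; split=> //; last by right.
  exact: FhullS t3.
have YB p : `|Y p| <= B.
  apply: (hB (h p) (Y p) (U p)) => //; first exact: MH.
  have := ae_and (Uinc p) (Fhull_norm dat); apply: ae_imp => s [h1 h2] Ds b Yb.
  have [t [ts _ Ft _]] := h1 Ds; apply: le_trans (h2 Ds _ _ _ Ft) _.
  by rewrite ler_wpM2l//; apply: lerD; [exact: r42|exact: Yb].
have UB p : \forall s \ae mu, D s -> `|U p s| <= (c s : R) * (2 + B).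
  have := ae_and (Uinc p) (Fhull_norm dat); apply: ae_imp => s [h1 h2] Ds.
  have [t [ts _ Ft _]] := h1 Ds; apply: le_trans (h2 Ds _ _ _ Ft) _.
  by rewrite ler_wpM2l//; apply: lerD; [exact: r42|exact: le_trans (cmap_le _ _) (YB p)].
exists Y; split=> //; last first.
  move=> p q hpq tp tq; apply: (addIr (- h p)); rewrite [in RHS]hpq.
  by apply: (isV_unique kK (VU p)); rewrite (Uh p q)//; exact: VU.
move=> p; exists (h p), (U p); split=> //.
apply: ae_imp (Uinc p) => s h1 Ds; have [t [ts tm Ft [<-//|{}Ft]]] := h1 Ds.
have osc : `|Y p (pt s) - Y p t| < 2 * r.
  have tN : `|set_val (pt s) - set_val t| < Num.min d1 d2.
    by rewrite tptK// ger0_norm ?subr_ge0//; exact: le_lt_trans tm hN.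
  move: tN; rewrite lt_min => /andP[tN1 tN2].
  have h2 := hd1 _ _ (VU p) (UB p) _ _ tN1; have h3 := hd2 _ _ _ (Mh p) tN2.
  rewrite (_ : Y p (pt s) - Y p t = ((Y p - h p) (pt s) - (Y p - h p) t) +
    (h p (pt s) - h p t)).
    by apply: le_lt_trans (ler_normD _ _) _; rewrite mulr_natl mulr2n ltrD.
  rewrite -[LHS](subrK (h p (pt s) - h p t)) !cmapB; congr (_ + _).
  by rewrite !opprD addrACA.
apply: hullS Ft => v' [z /= zy Fv]; exists z => //=.
rewrite -(subrK (Y p t) z) -addrA; apply: le_trans (ler_normD _ _) _.
by rewrite distrC in osc; have := ltW osc; lra.
Qed.

End EulerPolygons.

(** * Discrete contraction of the solution set *)

Section Acyclicity.
Context {R : realType} {E : completeNormedModType R} (T : R).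
Hypothesis T0 : 0 < T.
Let T0' := ltW T0.
Local Notation mu := (@lebesgue_measure R).
Local Notation D := (tint T).
Local Notation C := (cmap T E).
Local Notation pt := (tpt T0').
Variables (k : R -> R -> blin E E) (m c eta : R -> R^o) (F : R -> E -> set E).
Variable M : set C.
Hypothesis dat : inclusion_data k m c eta F M.
Local Notation S := (solutions T0' k F M).
Local Notation sol := (sol T0' k F M).


(** A single Euler polygon: one-point parameter space, switching time 0. *)
Lemma sol_neq0 r : 0 < r -> sol r !=set0.
Proof.
move=> r0; have [h0 Mh0] := id_M0 dat.
pose r' := Num.min (r / 4) (1 / 4); have r'0 : 0 < r' by rewrite lt_min !divr_gt0.
have r'1 : 4 * r' <= 1 by rewrite mulrC -ler_pdivlMr// ge_min lexx orbT.
have r'r : 4 * r' <= r by rewrite mulrC -ler_pdivlMr// ge_min lexx.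
have tU : tbd_dist (fun _ _ : unit => 0 : R).
  by move=> d d0; exists 1%N, (fun=> tt) => p; exists 0%N.
have [||||Y [_ Ysol _ _]] := euler_polygons (T0 := T0') dat tU (h := fun=> h0)
  (u := fun _ _ => 0) (tau := fun=> 0) (r := r') (uc_cst _ h0) _ _ (uc_cst _ 0) _ r'0
  (X := fun=> 0) _ r'1.
- by [].
- exact: ctrl0.
- by move=> p; rewrite lexx ltW.
- by move=> p; rewrite ltxx.
by exists (Y tt); exact: solS r'r _ (Ysol tt).
Qed.

(** For t >= 0 the parameter is the switching time; for t <= 0 the polygons start at time 0 while h
    moves to h0 with weight -t. At -1 nothing depends on x any more. *)
Lemma homotopy r h0 : 0 < r -> 4 * r <= 1 -> M h0 -> exists Y : C -> R -> C, [/\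
  forall x t, S x -> -1 <= t <= T -> sol (4 * r) (Y x t),
  forall e, 0 < e -> exists2 d : R, 0 < d & forall x y t t', S x -> S y ->
    -1 <= t <= T -> -1 <= t' <= T -> `|x - y| < d -> `|t - t'| < d ->
    `|Y x t - Y y t'| < e,
  forall x, S x -> `|Y x T - x| <= 2 * r &
  forall x y, S x -> S y -> Y x (-1) = Y y (-1)].
Proof.
move=> r0 r4 Mh0.
have cS : compact S by exact: compact_solutions dat.
have [zs [zsS zsx]] := tbd_in (compact_tbd cS) r0.
have [x0 Sx0] : S !=set0 by apply: solutions_neq0 dat _; exact: sol_neq0.
pose valid (q : C * R) := S q.1 /\ -1 <= q.2 <= T.
have v0 : valid (x0, 0) by split=> //=; rewrite lerN10 ltW.
pose P := {q : C * R | valid q}.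
(* A junk value outside the valid pairs; all conclusions concern solutions x and times in
   [[-1, T]]. *)
pose toP q : P := if pselect (valid q) is left h then exist _ q h else exist _ _ v0.
have toPK q : valid q -> proj1_sig (toP q) = q by rewrite /toP; case: pselect.
pose dP (p q : P) := Num.max `|(proj1_sig p).1 - (proj1_sig q).1|
  `|(proj1_sig p).2 - (proj1_sig q).2|.
have tP : tbd_dist dP.
  move=> d d0; have [s1 [s1S hs1]] := tbd_in (compact_tbd cS) d0.
  have [s2 [s2I hs2]] := tbd_in (compact_tbd (@segment_compact R (-1) T)) d0.
  pose L := [seq (a, b) | a <- s1, b <- s2].
  exists (size L), (fun i => toP (nth (x0, 0) L i)) => -[[x t] [/= Sx tI]].
  have [a as1 xa] := hs1 x Sx; have [|b bs2 tb] := hs2 t; first by rewrite /= in_itv.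
  have abL : (a, b) \in L by apply/allpairsP; exists (a, b).
  exists (index (a, b) L); first by rewrite index_mem.
  rewrite nth_index// /dP toPK/=; first by rewrite gt_max xa tb.
  by split=> /=; [exact: s1S|have := s2I b bs2; rewrite /= in_itv].
have u1 : uc dP (fun p => (proj1_sig p).1).
  by move=> e e0; exists e => // p q; rewrite gt_max => /andP[].
have u2 : uc dP (fun p => (proj1_sig p).2 : R^o).
  by move=> e e0; exists e => // p q; rewrite gt_max => /andP[].
have cov (p : P) : covered zs r (proj1_sig p).1 by case: p => -[x t] [/= Sx _]; exact: zsx.
have /choice[hz /choice[wz hwz]] : forall z, exists h w, z \in zs ->
    [/\ M h, isV k w (z - h) & \forall s \ae mu, D s -> F s (z (pt s)) (w s)].
  move=> z; have [zz|] := boolP (z \in zs); last by exists 0, (fun=> 0).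
  by have [h [w hw]] := zsS z zz; exists h, w.
pose ph z (p : P) : R^o := pu zs r z (proj1_sig p).1.
have uph z : z \in zs -> uc dP (ph z).
  move=> zz; apply: (uc_lip (L := (1 + (size zs)%:R) / r) u1).
    by rewrite divr_ge0 ?addr_ge0// ltW.
  by move=> p q; exact: pu_lip.
have ph1 z : z \in zs -> forall p, `|ph z p| <= 1.
  by move=> zz p; rewrite ger0_norm ?pu_ge0// pu_le1.
pose lam (p : P) : R^o := Num.max 0 (- (proj1_sig p).2).
have ulam : uc dP lam.
  apply: (uc_lip (L := 1) u2) => // p q; apply: le_trans (max0_lip _ _) _.
  by rewrite mul1r opprK addrC distrC.
have lam01 p : 0 <= (lam p : R) <= 1.
  by rewrite le_max lexx ge_max ler01 lerNl; case: p => -[x t] [/= _ /andP[]].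
pose tau (p : P) : R^o := Num.max 0 (proj1_sig p).2.
have utau : uc dP tau.
  by apply: (uc_lip (L := 1) u2) => // p q; rewrite mul1r; exact: max0_lip.
have tauT p : 0 <= (tau p : R) <= T.
  by rewrite le_max lexx ge_max T0'; case: p => -[x t] [/= _ /andP[]].
pose hx p := \sum_(z <- zs) ph z p *: hz z.
have uhx : uc dP hx.
  apply: uc_sum => z zz; apply: (ucZ (A := 1) (B := `|hz z|)) => //.
  - exact: uph.
  - exact: uc_cst.
  - exact: ph1.
have Mhx p : M (hx p).
  rewrite -(hull_id (id_Mv dat)); apply: (hull_pu r0 (cov p)) => z zz _.
  by have [] := hwz z zz.
pose h p := (lam p : R) *: h0 + (1 - (lam p : R)) *: hx p.
have uh : uc dP h.
  apply: ucD.
    apply: (ucZ (A := 1) (B := `|h0|)) => //; first exact: uc_cst.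
    by move=> p; have /andP[l0 l1] := lam01 p; rewrite ger0_norm.
  have [H H0 MH] := M_bounded dat.
  apply: (ucZ (a := fun p => 1 - (lam p : R) : R^o) (A := 1) (B := H)) => //.
  - apply: (uc_lip (L := 1) ulam) => // p q.
    by rewrite mul1r opprB addrCA addrAC subrr add0r distrC addrC.
  - move=> p; have /andP[l0 l1] := lam01 p; rewrite ger0_norm ?subr_ge0//.
    by rewrite lerBlDr lerDl.
  - by move=> p; exact: MH.
have Mh p : M (h p).
  by have /andP[l0 l1] := lam01 p; exact: convex_setE (id_Mv dat) Mh0 (Mhx p) l0 l1.
(* Controls of finitely many net solutions, combined with weights continuous in p. *)
pose u p s := \sum_(z <- zs) ph z p *: wz z s.
have cu : ctrl T m c dP u.
  have [B B0 hB] := witness_bounded T0' dat.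
  apply: (ctrl_sum dat) => z zz; have [Mz Vz Fz] := hwz z zz.
  have W : witness T0' k F M 0 z (hz z) (wz z).
    split=> //; apply: ae_imp Fz => s Fz Ds; apply: sub_hull.
    by exists (z (pt s)); [rewrite /= subrr normr0|exact: Fz].
  have [_ wB] := hB _ _ _ _ ler01 W.
  apply: (ctrlZ dat (uph z zz) (ph1 z zz) Vz.1 _ wB); exact: addr_ge0.
pose X (p : P) := \sum_(z <- zs) ph z p *: z.
have Xx p : `|X p - (proj1_sig p).1| <= 2 * r.
  pose A := [set v : C | `|v - (proj1_sig p).1| <= 2 * r].
  suff cA : convex_set A.
    suff : hull A (X p) by rewrite hull_id.
    by apply: (hull_pu (f := id) r0 (cov p)) => z _ zx; rewrite /A /= distrC ltW.
  apply: convex_setP => v w t; rewrite /A /= => hv hw t0 t1.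
  have t1' : 0 <= 1 - t by rewrite subr_ge0.
  have -> : t *: v + (1 - t) *: w - (proj1_sig p).1 =
      t *: (v - (proj1_sig p).1) + (1 - t) *: (w - (proj1_sig p).1).
    by rewrite !scalerBr addrACA -opprD -scalerDl [t + _]addrC subrK scale1r.
  apply: le_trans (ler_normD _ _) _; rewrite !normrZ (ger0_norm t0) (ger0_norm t1').
  have -> : 2 * r = t * (2 * r) + (1 - t) * (2 * r) by ring.
  exact: (lerD (ler_wpM2l t0 hv) (ler_wpM2l t1' hw)).
have uX p : 0 < (tau p : R) -> isV k (u p) (X p - h p) /\
    \forall s \ae mu, D s -> s < tau p -> Fhull F (4 * r) s (X p (pt s)) (u p s).
  move=> tp; have lam0 : lam p = 0.
    apply/max_idPl; rewrite oppr_le0 ltW//.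
    by move: tp; rewrite /tau; case: (leP 0 (proj1_sig p).2); rewrite ?ltxx//; case: ltP.
  have hE : h p = hx p by rewrite /h lam0 scale0r add0r subr0 scale1r.
  split.
    rewrite hE; have -> : X p - hx p = \sum_(z <- zs) ph z p *: (z - hz z).
      by rewrite /X /hx -sumrB; apply: eq_bigr => z _; rewrite scalerBr.
    by apply: isV_sum => z zz; have [] := hwz z zz.
  have : \forall s \ae mu, forall z, z \in zs -> D s -> F s (z (pt s)) (wz z s).
    by apply: ae_seq => z zz; have [] := hwz z zz.
  apply: ae_imp => s Fz Ds _; apply: (hull_pu r0 (cov p)) => z zz xz.
  (* [X p] and the net points of positive weight are both within 2 r of x, hence within 4 r of each
     other. *)
  exists (z (pt s)); last exact: Fz.
  rewrite /= -cmapB; apply: le_trans (cmap_le _ _) _.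
  rewrite -(subrK (proj1_sig p).1 z) -addrA; apply: le_trans (ler_normD _ _) _.
  rewrite (distrC z) (distrC _ (X p)).
  by have := Xx p; have := ltW xz; lra.
have [Y [uY Ysol YX Yh]] := euler_polygons (T0 := T0') dat tP uh Mh cu utau tauT r0 uX r4.
exists (fun x t => Y (toP (x, t))); split=> //.
- move=> e e0; have [d d0 hd] := uY e e0; exists d => // x y t t' Sx Sy tI tI' xy tt.
  by apply: hd; rewrite /dP !toPK//= gt_max xy tt.
- move=> x Sx; have T1 : -1 <= T by apply: le_trans T0'; rewrite lerN10.
  have vx : valid (x, T) by split=> //=; rewrite lexx T1.
  have tauE : tau (toP (x, T)) = T by rewrite /tau toPK//= (max_idPr _).
  have -> : Y (toP (x, T)) = X (toP (x, T)).
    apply/val_inj/funext => t; apply: YX; rewrite tauE//.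
    by have /tintP[] := set_valP t.
  by have := Xx (toP (x, T)); rewrite toPK.
move=> x y Sx Sy.
have T1 : -1 <= T by apply: le_trans T0'; rewrite lerN10.
have v1 z : S z -> valid (z, -1) by move=> Sz; split=> //=; rewrite lexx T1.
have tau1 z : S z -> tau (toP (z, -1)) = 0.
  by move=> Sz; rewrite /tau toPK; [apply/max_idPl; rewrite /= lerN10|exact: v1].
have h1 z : S z -> h (toP (z, -1)) = h0.
  move=> Sz; have l1 : lam (toP (z, -1)) = 1.
    by rewrite /lam toPK; [rewrite /= opprK; apply/max_idPr|exact: v1].
  by rewrite /h l1 subrr scale0r addr0 scale1r.
exact: (Yh _ _ (etrans (h1 x Sx) (esym (h1 y Sy))) (tau1 x Sx) (tau1 y Sy)).
Qed.

Lemma acyclic_solutions : acyclic (set_type S).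
Proof.
have cS : compact S by exact: compact_solutions dat.
have S0 : S !=set0 by apply: solutions_neq0 dat _; exact: sol_neq0.
have [h0 Mh0] := id_M0 dat.
apply: discrete_contraction_acyclic => // e e0.
have e4 : 0 < e / 4 by rewrite divr_gt0.
have [r1 r10 hr1] := sol_near_solutions T0' dat e4.
(* The bound r1 / 4 puts the polygons into [sol r1], 1 / 4 gives 4 r <= 1, and e / 4 / 2 makes the
   distance from [Y x T] to x at most e / 4. *)
pose r := Num.min (r1 / 4) (Num.min (1 / 4) (e / 4 / 2)).
have r0 : 0 < r by rewrite !lt_min !divr_gt0.
have r4 : 4 * r <= 1 by rewrite mulrC -ler_pdivlMr// !ge_min lexx !orbT.
have rr1 : 4 * r <= r1 by rewrite mulrC -ler_pdivlMr// ge_min lexx.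
have re : 2 * r <= e / 4 by rewrite mulrC -ler_pdivlMr// !ge_min lexx !orbT.
have [Y [Ysol uY YT Y1]] := homotopy r0 r4 Mh0.
(* A return map to S, possibly discontinuous, moving each approximate solution by less than e /
   4. *)
have /choice[rho hrho] : forall y : C, exists y', sol r1 y -> S y' /\ `|y - y'| < e / 4.
  move=> y; have [sy|] := pselect (sol r1 y); last by exists y.
  by have [y' Sy' yy'] := hr1 y sy; exists y'.
have rhoY x t : S x -> -1 <= t <= T ->
    S (rho (Y x t)) /\ `|Y x t - rho (Y x t)| < e / 4.
  by move=> Sx tI; apply: hrho; apply: solS rr1 _ (Ysol x t Sx tI).
have [d d0 hd] := uY _ e4.
have T1 : 0 <= T + 1 by rewrite addr_ge0.
have [n n0 nd] : exists2 n : nat, (0 < n)%N & (T + 1) / n%:R < d.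
  exists (Num.bound ((T + 1) / d)).+1 => //.
  rewrite ltr_pdivrMr ?ltr0n// mulrC -ltr_pdivrMr//.
  apply: lt_trans (archi_boundP _) _; first by rewrite divr_ge0// ltW.
  by rewrite ltr_nat.
pose tj j := T - j%:R * ((T + 1) / n%:R).
have st0 : 0 <= (T + 1) / n%:R by rewrite divr_ge0.
have tI j : (j <= n)%N -> -1 <= tj j <= T.
  move=> jn; rewrite /tj lerBlDr lerDl mulr_ge0// andbT.
  have : j%:R * ((T + 1) / n%:R) <= n%:R * ((T + 1) / n%:R) by rewrite ler_wpM2r// ler_nat.
  rewrite [n%:R * _]mulrC divfK ?pnatr_eq0 -?lt0n//; lra.
have tn : tj n = -1 by rewrite /tj [_ * _]mulrC divfK ?pnatr_eq0 -?lt0n//; ring.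
have tt j : `|tj j - tj j.+1| < d.
  have aux (a b : R) : T - a - (T - (a + b)) = b by ring.
  by rewrite /tj -natr1 [(_ + 1) * (_ / _)]mulrDl mul1r aux ger0_norm.
(* The identity comes first, then the times T down to -1 in n + 1 values; [minn] keeps the time in
   range for larger j. *)
pose g j x := if j is j'.+1 then (if `[< S x >] then rho (Y x (tj (minn j' n))) else x) else x.
have mI j : -1 <= tj (minn j n) <= T by apply: tI; exact: geq_minr.
have gE j x : S x -> g j.+1 x = rho (Y x (tj (minn j n))) by move=> Sx; rewrite /g asboolT.
exists (Num.min d (e / 4)); first by rewrite lt_min d0.
exists n.+1, g; split=> //.
- by move=> [//|j] x Sx; rewrite gE//; case: (rhoY x _ Sx (mI j)).
- have [y Sy] := S0; exists (rho (Y y (-1))) => x Sx.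
  by rewrite gE// minnn tn (Y1 x y).
have near x y t t' : S x -> S y -> -1 <= t <= T -> -1 <= t' <= T ->
    `|Y x t - Y y t'| < e / 4 -> `|rho (Y x t) - rho (Y y t')| < e.
  move=> Sx Sy tx ty xy; have [_ h1] := rhoY x t Sx tx; have [_ h2] := rhoY y t' Sy ty.
  rewrite (_ : rho (Y x t) - rho (Y y t') = (Y x t - Y y t') - (Y x t - rho (Y x t)) +
    (Y y t' - rho (Y y t'))).
    have := ler_normD ((Y x t - Y y t') - (Y x t - rho (Y x t))) (Y y t' - rho (Y y t')).
    have := ler_normB (Y x t - Y y t') (Y x t - rho (Y x t)); lra.
  by rewrite opprB [_ + (rho (Y x t) - _)]addrC !addrA !subrK.
move=> [|j] x y jn Sx Sy; rewrite lt_min => /andP[xyd xye].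
  split; first by apply: lt_trans xye _; lra.
  rewrite gE// min0n /tj mul0r subr0 /=.
  have TI : -1 <= T <= T by rewrite lexx andbT; apply: le_trans T0'; rewrite lerN10.
  have [_ h1] := rhoY y T Sy TI.
  have h2 := YT y Sy.
  rewrite (_ : x - rho (Y y T) = (x - y) - (Y y T - y) + (Y y T - rho (Y y T))).
    have := ler_normD ((x - y) - (Y y T - y)) (Y y T - rho (Y y T)).
    have := ler_normB (x - y) (Y y T - y); have := h1; lra.
  by rewrite opprB !addrA !subrK.
rewrite ltnS in jn; rewrite !gE//; split; apply: near => //; apply: hd => //.
  by rewrite subrr normr0.
by rewrite (minn_idPl (ltnW jn)) (minn_idPl jn).
Qed.

End Acyclicity.

(** * Translation of the original hypotheses and of the notion of solution *)

Section HausdorffMeasure.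
Context {R : realType} {W : normedModType R}.

Lemma hausdorff_mnc_ge0 (A : set W) : (0 <= hausdorff_mnc A)%E.
Proof. by apply: le_ereal_inf_tmp => _ [e [e0 _] <-]; rewrite lee_fin ltW. Qed.

Lemma fcov_hausdorff e (A : set W) : 0 < e -> fcov e A -> (hausdorff_mnc A <= e%:E)%E.
Proof.
move=> e0 [s As]; apply: ereal_inf_lbound; exists e => //; split=> //; exists s => x Ax.
by have [a as_ xa] := As x Ax; exists a => //; rewrite -ball_normE /= distrC.
Qed.

Lemma hausdorff_fcov e (A : set W) : (hausdorff_mnc A < e%:E)%E -> fcov e A.
Proof.
move=> /ereal_inf_lt[_ [e' [e'0 [s As]] <-]]; rewrite lte_fin => ee; exists s => x Ax.
have [a as_] := As x Ax; rewrite -ball_normE /= distrC => xa.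
by exists a => //; exact: lt_trans ee.
Qed.

End HausdorffMeasure.

Section VolterraSolutions.
Context {R : realType} {E : completeNormedModType R} (T : R).
Hypothesis T0 : 0 < T.
Let T0' := ltW T0.
Local Notation mu := (@lebesgue_measure R).
Local Notation D := (tint T).
Let mD : measurable (D : set R). Proof. exact: measurable_tint. Qed.

Lemma in_Lp_le (W W' : normedModType R) (p K : R) (f f' : R -> W) (w : R -> W') : 0 < p ->
  0 <= K -> in_Lp D p%:E f -> smeas f' -> (\forall s \ae mu, D s -> f s = f' s) ->
  smeas w -> (\forall s \ae mu, D s -> `|w s| <= K * `|f' s|) -> in_Lp D p%:E w.
Proof.
move=> p0 K0 fp sf ff sw wf; split; first exact: smeas_strongly_measurable.
have [sfp fpy] := in_Lp_powR p0 fp sf ff.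
have swp : smeas (fun s => powR `|w s| p : R^o).
  apply: (measurable_smeas (f := (@powR R ^~ p) \o (fun s => `|w s|))).
  have h := smeas_measurable (smeas_normr sw).
  exact: (measurableT_comp (@measurable_powR R p) h).
rewrite unlock; apply: poweR_lty.
apply: (@le_lt_trans _ _ (L1 D (fun s => powR `|w s| p : R^o))); last first.
  have sK := smeasZl (powR K p) sfp.
  apply: (@le_lt_trans _ _ (L1 D (fun s => powR K p *: (powR `|f' s| p : R^o)))).
    apply: (le_L1 mD swp sK); apply: ae_imp wf => s h Ds.
    rewrite !ger0_norm ?powR_ge0//; last by rewrite mulr_ge0// powR_ge0.
    rewrite -[leRHS]/(powR K p * powR `|f' s| p) -powRM//.
    by rewrite ge0_ler_powR ?nnegrE ?mulr_ge0 ?h// ltW.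
  by rewrite (L1Z mD _ sfp) lte_mul_pinfty ?lee_fin.
rewrite le_eqVlt; apply/orP; left; apply/eqP; rewrite /L1 [RHS]integral_mkcond.
apply: eq_integral => s _; rewrite !patchE; case: ifPn => _.
  by rewrite /= normr_id ger0_norm ?powR_ge0.
by rewrite abse0 poweR0r// gt_eqF.
Qed.

(** From left to right w is replaced by a Borel representative; from right to left membership in L^p
    is recovered from the growth condition, which bounds w by (1 + |x|) c. The two integrals are
    exchanged by [bochner_bint] and [bint_bochner]. *)
Lemma volterra_solutions_bridge (p : R) (k : R -> R -> blin E E) (m c eta c1 c1' : R -> R^o)
    (F : R -> E -> set E) (M : set (cmap T E)) : 0 < p ->
  inclusion_data k m c eta F M ->
  in_Lp D p%:E c1 -> smeas c1' -> (\forall s \ae mu, D s -> c1 s = c1' s) ->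
  (forall s, c s = `|c1' s| :> R) ->
  \bigcup_(h in M) volterra_solutions p%:E k F h = solutions T0' k F M.
Proof.
move=> p0 dat c1p sc1 c1E cE; have kK := id_kernel dat.
have [_ _ _ _ sk] := kK.
have tD (t : D) : 0 <= set_val t /\ set_val t <= T by apply/tintP; exact: set_valP.
have cutcut (A : set R) (g : R -> E) : cut A (cut A g) = cut A g.
  by apply/funext => s; rewrite /cut; case: ifP => // ->.
have cutE (t : R) (w w' : R -> E) : D t -> (\forall s \ae mu, D s -> w s = w' s) ->
    \forall s \ae mu, [set` `[0, t]] s ->
      k t s (w s) = cut [set` `[0, t]] (fun s => k t s (w' s)) s.
  move=> /tintP[t0 tT]; apply: ae_imp => s ww st.
  by rewrite /cut mem_set// ww//; exact: (sub_tint (lexx 0) tT).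
apply/seteqP; split=> x.
  move=> [h Mh [w [[wsm _] wF wx]]].
  have [w' sw' ww'] := strongly_measurable_smeas mD wsm.
  exists h, w'; split=> //; last first.
    have := ae_and wF ww'; apply: ae_imp => s [wFs wws] Ds.
    by rewrite -(wws Ds); apply: wFs; rewrite tptK.
  split=> // t; have [v bv xt] := wx t; have [t0 tT] := tD t.
  have sck := sk _ _ (set_valP t) sw'.
  have := bochner_bint mD (measurable_itv _) (sub_tint (lexx 0) tT) (tint_fin T) sck
    (cutE _ _ _ (set_valP t) ww') bv.
  by rewrite cutcut cmapB xt addrC addKr.
move=> [h [w [Mh [sw bw] wF]]]; exists h => //; exists w; split.
- have wc : \forall s \ae mu, D s -> `|w s| <= (1 + `|x|) * `|c1' s|.
    have := ae_and wF (id_F4 dat); apply: ae_imp => s [h1 h2] Ds.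
    apply: le_trans (h2 Ds _ _ (h1 Ds)) _; rewrite cE mulrC ler_wpM2r//.
    by rewrite lerD2l; exact: cmap_le.
  by apply: (in_Lp_le p0 _ c1p sc1 c1E sw wc); rewrite addr_ge0.
- apply: ae_imp wF => s h1 t ts; have Ds : D s by rewrite -ts; exact: set_valP.
  by rewrite (tval_tpt T0' ts); exact: h1.
move=> t; exists ((x - h) t); last by rewrite cmapB addrC subrK.
have [t0 tT] := tD t; have sck := sk _ _ (set_valP t) sw.
have ff := cutE _ w w (set_valP t) (aeW mu (fun s _ => erefl)).
apply: (bint_bochner mD (measurable_itv _) (sub_tint (lexx 0) tT) (tint_fin T) ff).
by rewrite cutcut; exact: bw.
Qed.

End VolterraSolutions.

(** The infimum in the measure of noncompactness need not be attained; the strict inequality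
    [b * e < e'] provides the room. The number b will be the absolute value of the representative of
    eta. *)
Lemma covering_F5 (R : realType) (E : normedModType R) (F : E -> set E) (Om : set E) (a b : R) :
  `|a| <= b -> (hausdorff_mnc (\bigcup_(x in Om) F x) <= a%:E * hausdorff_mnc Om)%E ->
  forall e e', fcov e Om -> b * e < e' -> fcov e' (\bigcup_(x in Om) F x).
Proof.
move=> ab hF e e' ce be; have [Om0|/set0P[x0 Omx0]] := eqVneq Om set0.
  by exists [::] => y [x]; rewrite Om0.
have e0 : 0 < e by have [s hs] := ce; have [z _ /(le_lt_trans (normr_ge0 _))] := hs x0 Omx0.
apply: hausdorff_fcov; apply: le_lt_trans hF _.
have b0 : 0 <= b by apply: le_trans ab.
apply: (@le_lt_trans _ _ (b%:E * hausdorff_mnc Om)%E).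
  apply: lee_wpmul2r; first exact: hausdorff_mnc_ge0.
  by rewrite lee_fin; apply: le_trans ab; exact: ler_norm.
apply: (@le_lt_trans _ _ (b%:E * e%:E)%E); last by rewrite -EFinM lte_fin.
by apply: lee_wpmul2l; [rewrite lee_fin|exact: fcov_hausdorff].
Qed.

Theorem theorem6 (R : realType) (T : R) (hT : 0 < T)
  (p : R) (q : \bar R) (hp : 1 <= p) (hq : (1 < q)%E)
  (hpq : (p%:E^-1 + q^-1 = 1)%E)
  (E : completeNormedModType R) (hE : 1 < p -> reflexive_space E)
  (F : R -> E -> set E)
  (F1 : forall t x, tint T t ->
    [/\ F t x !=set0, closed (F t x) & convex_set (F t x)])
  (F2 : forall x, exists w : R -> E,
    strongly_measurable (tint T) w /\ forall t, tint T t -> F t x (w t))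
  (F3 : \forall t \ae (@lebesgue_measure R), tint T t ->
    upper_hemicontinuous (F t))
  (F4 : exists2 c : R -> R^o, in_Lp (tint T) p%:E c &
    \forall t \ae (@lebesgue_measure R), tint T t -> forall x,
      (ereal_sup [set `|y|%:E | y in F t x] <= (c t * (1 + `|x|))%:E)%E)
  (F5 : exists2 eta : R -> R^o, in_Lp (tint T) p%:E eta &
    forall Omega : set E, bounded_set Omega ->
    \forall t \ae (@lebesgue_measure R), tint T t ->
      (hausdorff_mnc (\bigcup_(x in Omega) F t x)
        <= (eta t)%:E * hausdorff_mnc Omega)%E)
  (k dk : R -> R -> blin E E)
  (k1 : forall t s, 0 <= s -> s <= t -> t <= T ->
    derivative_within (k^~ s) [set` `[s, T]] t (dk t s))
  (k2 : forall t, tint T t -> {within [set` `[0, t]], continuous (k t)})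
  (k3 : {within tint T, continuous (fun t => k t t)} /\
    forall t, tint T t -> invertible_op (k t t))
  (k4 : exists2 mu : R -> R^o, in_Lp (tint T) q mu &
    forall t s, 0 <= s -> s <= t -> t <= T -> `|dk t s| <= mu s)
  (M : set (cmap T E)) (hM0 : M !=set0) (hMc : compact M)
  (hMv : convex_set M) :
  let S := \bigcup_(h in M) volterra_solutions p%:E k F h in
  compact S /\ acyclic (set_type S).
Proof.
Proof.
move=> S; pose T0 := ltW hT; have p0 : 0 < p by exact: lt_le_trans hp.
have mD : measurable (tint T : set R) by exact: measurable_tint.
have [c cp cF] := F4; have [eta etap etaF] := F5; have [nu nuq nuk] := k4.
have [c' sc' cc'] := strongly_measurable_smeas mD cp.1.
have [eta' seta' etaeta'] := strongly_measurable_smeas mD etap.1.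
have [nu' snu' nunu'] := strongly_measurable_smeas mD nuq.1.
have [C [C0 kK]] := volterra_kernel_exists T0 k1 k2 k3.1 nuk snu' nunu'.
have T1 : 0 <= T + 1 by rewrite addr_ge0.
(* Borel representatives replace c, eta and the bound of the derivative, and absolute values make
   them nonnegative. *)
have dat : inclusion_data k (fun s => C + (T + 1) * `|nu' s| : R^o)
    (fun s => `|c' s| : R^o) (fun s => `|eta' s| : R^o) F M.
  split=> //.
  - exact: smeas_normr.
  - exact: (L1_weight hp hq hpq C0 T1 cp sc' cc' nuq snu' nunu').
  - exact: smeas_normr.
  - exact: (L1_weight hp hq hpq C0 T1 etap seta' etaeta' nuq snu' nunu').
  - move=> x; have [w [wsm wF]] := F2 x.
    have [w' sw' ww'] := strongly_measurable_smeas mD wsm; exists w' => //.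
    by apply: ae_imp ww' => s ww Ds; rewrite -(ww Ds); exact: wF.
  - have := ae_and cF cc'; apply: ae_imp => s [cFs ccs] Ds x y Fy.
    rewrite -lee_fin; apply: (@le_trans _ _ (c s * (1 + `|x|))%:E).
      by apply: le_trans (cFs Ds x); apply: ereal_sup_ubound; exists y.
    by rewrite lee_fin ccs// ler_wpM2r ?addr_ge0// ler_norm.
  - move=> Om bOm; have := ae_and (etaF Om bOm) etaeta'; apply: ae_imp => s [eF ee] Ds.
    by apply: (covering_F5 _ (eF Ds)); rewrite ee.
have -> : S = solutions T0 k F M.
  exact: (volterra_solutions_bridge hT p0 dat cp sc' cc' (fun=> erefl)).
split; first exact: compact_solutions dat.
exact: (acyclic_solutions hT dat).
Qed.
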